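(* Let $\mathcal{L}_1,\mathcal{L}_2\in \mathrm{Mat}_d(\mathbb{Z})$ be irreducible and coprime. Then there are constants $D>0$ and $\sigma>0$ such that, for every finite subset $A$ of $\mathbb{R}^d$, $$|\mathcal{L}_1 A+\mathcal{L}_2 A|\geq \left(|\det(\mathcal{L}_1)|^{1/d}+|\det(\mathcal{L}_2)|^{1/d}\right)^d|A|-D|A|^{1-\sigma}.$$
   Context: $\mathcal{L}A=\{\mathcal{L}a:a\in A\}$. Irreducible: there are no non-trivial subspaces $U,V$ of $\mathbb{Q}^d$ of the same dimension (non-trivial meaning neither $\{0\}$ nor $\mathbb{Q}^d$) with $\mathcal{L}_1U\subseteq V$ and $\mathcal{L}_2U\subseteq V$. Coprime: there are no $\mathcal{P},\mathcal{Q}\in \mathrm{GL}_d(\mathbb{Q})$ with $0<|\det(\mathcal{P})\det(\mathcal{Q})|<1$ such that $\mathcal{P}\mathcal{L}_1\mathcal{Q},\mathcal{P}\mathcal{L}_2\mathcal{Q}\in\mathrm{Mat}_d(\mathbb{Z})$. *)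

(* Defs.v *)
From HB Require Import structures.
From mathcomp Require Import all_boot all_order all_algebra.
From mathcomp Require Import finmap.
From mathcomp Require Import reals exp.
Set Implicit Arguments. Unset Strict Implicit. Unset Printing Implicit Defensive.
Import Order.TTheory GRing.Theory Num.Theory.
Local Open Scope ring_scope.

Definition mxZ (K : nzRingType) (d : nat) (L : 'M[int]_d) : 'M[K]_d :=
  map_mx (fun z : int => z%:~R) L.

(* Subspaces of Q^d are represented by row spaces of matrices U : 'M[rat]_d
   (mxalgebra).  For a column vector u, L u corresponds to the row vector
   u^T *m L^T, so the image L U of the subspace U is the row space of U *m L^T. *)
Definition irreducible_pair (d : nat) (L1 L2 : 'M[int]_d) : Prop :=
  forall U V : 'M[rat]_d,
    \rank U = \rank V -> (0 < \rank U)%N -> (\rank U < d)%N ->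
    ~ ((U *m (mxZ rat L1)^T <= V)%MS /\ (U *m (mxZ rat L2)^T <= V)%MS).

Definition coprime_pair (d : nat) (L1 L2 : 'M[int]_d) : Prop :=
  ~ exists P Q : 'M[rat]_d,
      [/\ P \in unitmx, Q \in unitmx,
          0 < `|\det P * \det Q| < 1,
          exists M1 : 'M[int]_d, P *m mxZ rat L1 *m Q = mxZ rat M1 &
          exists M2 : 'M[int]_d, P *m mxZ rat L2 *m Q = mxZ rat M2].

Definition sumset_lin (R : realType) (d : nat) (L1 L2 : 'M[int]_d)
  (A : {fset 'cV[R]_d}) : {fset 'cV[R]_d} :=
  [fset (mxZ R L1 *m a + mxZ R L2 *m b)%R | a in A, b in A]%fset.

(* Main.v *)
Require Import Defs.
From HB Require Import structures.
From mathcomp Require Import all_boot all_order all_algebra all_field.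
From mathcomp Require Import finmap.
From mathcomp Require Import boolp reals exp.
From mathcomp Require Import zify ring lra.
Set Implicit Arguments. Unset Strict Implicit. Unset Printing Implicit Defensive.
Import Order.TTheory GRing.Theory Num.Theory.
Local Open Scope quotient_scope.
Local Open Scope fset_scope.
Local Open Scope ring_scope.

(** Put [T = L1^-1 L2] on [Q^d], [p = |det L2|], [q = |det L1|]; after rounding
    by simultaneous Diophantine approximation the task is to bound [A + T A]
    from below for [A] in [Z^d].  Let [K] be the localisation of [Z[T] Z^d] at the
    powers of [1 + T], let [K'] be the same group for [T^-1], and let
    [U(i,j) = T^i K] meet [T^-j K'].  Coprimality says that [K / T K] and
    [K' / T^-1 K'] have at least [p] and [q] elements; inverting [1 + T] makes every
    [U(i,j) / U(i+1,j+1)] split as the product of these quotients and makes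
    [|A + T A|] superadditive over the classes of [A] modulo [U(i,j)].

    If [A] is evenly distributed modulo a deep group of the tower, then splitting the two
    summands into classes modulo [U(i+1,j)] and [U(i,j+1)] and applying a discrete
    Brunn-Minkowski inequality to each pair of classes gives [(p^(1/d) + q^(1/d))^d |A|],
    up to a small multiple of [|A + T A + B|] for a box [B].  If it is not, passing
    to the classes shrinks [sum sqrt(|A_c|)] by a constant factor, so descending [k]
    levels costs only [theta^k |A|] with [theta < 1].

    When [|A + T A|] is [O(|A|)], Plunnecke's inequality, Ruzsa's covering lemma and the
    Bogolyubov-Ruzsa argument produce [w <> 0] with [j w] in [2A - 2A] for all
    [j <= |A|^c].  By irreducibility [w] is a cyclic vector, so a matrix commuting with
    [T] moves [A] into a position where every box needed in the descent lies in
    [sum_i T^i (2A - 2A)], and [|A + T A + B| = O(|A|)] for it.  This allows [k] of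
    order [log |A|], that is, a loss of [|A|^(1 - sigma)]. *)

(** * Sumsets *)

(** The obstacle is the evenly distributed case. Equal densities would give the constant exactly,
    but the relative deviations [s], [t] of the classes enter with a quadratic loss, which a mere
    bound on them turns into a positive proportion of |A|. Now each coset of the sumset is reached
    by pq pairs of classes, and the best pair may be taken. The linear terms average to 0 over all
    pairs, so the best pairs gain some [N] >= 0 in total, and a small [N] forces [s] and [t] to be
    nearly constant, hence nearly 0: they are O(N). If the imbalance allowed is at most a small
    constant c, the quadratic loss is c O(N) and the gain [N] absorbs it. This fixes [tree_c], and
    with it [tree_theta].

    An uneven set costs nothing when it is split, since |A + T A| is superadditive; only parts still
    uneven after k steps are lost. Square roots measure them because Cauchy-Schwarz has a definite
    defect as soon as one part deviates. The depth k is limited because representatives at depth k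
    have size exponential in k and need a progression of that length in 2A - 2A, hence |A| >=
    E^(k+1); so sigma = ln(1/theta) / ln E, with theta the larger of [tree_theta] and 1/2. *)

Section Counting.
Variables (I V : choiceType).

Lemma card_disjoint_le (s : seq I) (F : I -> {fset V}) (S : {fset V}) :
  uniq s -> (forall i, i \in s -> F i `<=` S) ->
  (forall i j x, i \in s -> j \in s -> x \in F i -> x \in F j -> i = j) ->
  (\sum_(i <- s) #|` F i| <= #|` S|)%N.
Proof.
elim: s S => [|i s IH] S; first by rewrite big_nil.
move=> /= /andP[nis us] FS dis; rewrite big_cons.
have FiS : F i `<=` S by apply: FS; rewrite mem_head.
have : (\sum_(j <- s) #|` F j| <= #|` S `\` F i|)%N.
  apply: IH => // [j js|j k x js ks].
    apply/fsubsetP=> x xj; rewrite inE; apply/andP; split; last first.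
      by apply: (fsubsetP (FS j _)) => //; rewrite inE js orbT.
    apply/negP=> xi; have E := dis i j x; move: nis.
    by rewrite E ?js // inE ?eqxx ?js ?orbT.
  by apply: dis; rewrite inE ?js ?ks orbT.
have := cardfsID (F i) S; rewrite (fsetIidPr FiS) => <-.
by rewrite leq_add2l.
Qed.

Lemma card_cover_le (s : seq I) (F : I -> {fset V}) (S : {fset V}) :
  (forall x, x \in S -> exists2 i, i \in s & x \in F i) ->
  (#|` S| <= \sum_(i <- s) #|` F i|)%N.
Proof.
elim: s S => [|i s IH] S cov.
  rewrite big_nil leqn0 cardfs_eq0; apply/eqP/fsetP=> x; rewrite inE.
  by apply/negP=> /cov[].
rewrite big_cons; have := cardfsID (F i) S.
have : (#|` S `&` F i| <= #|` F i|)%N by apply/fsubset_leq_card/fsubsetIr.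
have : (#|` S `\` F i| <= \sum_(j <- s) #|` F j|)%N.
  apply: IH => x; rewrite inE => /andP[xi xS].
  have [j] := cov x xS; rewrite inE => /orP[/eqP->|js xj]; last by exists j.
  by rewrite (negPf xi).
lia.
Qed.
End Counting.

Lemma cardfsM (K K' : choiceType) (A : {fset K}) (E : {fset K'}) :
  #|` A `*` E| = (#|` A| * #|` E|)%N.
Proof.
pose F a : {fset K * K'} := [fset (a, y) | y in E].
have cF a : #|` F a| = #|` E| by rewrite card_imfset //= => y y' [].
have -> : (#|` A| * #|` E| = \sum_(a <- A) #|` F a|)%N.
  under eq_bigr do rewrite cF.
  by rewrite big_const_seq count_predT iter_addn_0 mulnC.
apply/eqP; rewrite eqn_leq card_cover_le => [|[a e]] /=; last first.
  rewrite in_fsetM => /andP[/= aA eE]; exists a => //.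
  by apply/imfsetP; exists e.
apply: card_disjoint_le => [|a aA|a b x _ _]; first exact: fset_uniq.
  by apply/fsubsetP=> _ /imfsetP[y /= yE ->]; rewrite in_fsetM aA.
by move=> /imfsetP[y _ ->] /imfsetP[z _ []].
Qed.

Lemma fset_argmin (T : choiceType) d (O : orderType d) (f : T -> O) (s : seq T) x0 :
  x0 \in s -> exists2 x, x \in s & forall y, y \in s -> (f x <= f y)%O.
Proof.
elim: s x0 => [|a s IH] // x0 _; case: s IH => [_|b s IH].
  by exists a; rewrite ?mem_head // => y; rewrite inE => /eqP->.
have [x xs xm] := IH b (mem_head _ _).
have [le_ax|lt_xa] := leP (f a) (f x).
  exists a; first exact: mem_head.
  move=> y; rewrite inE => /orP[/eqP->//|/xm]; exact: le_trans.
exists x; first by rewrite inE xs orbT.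
by move=> y; rewrite inE => /orP[/eqP->|/xm //]; apply: ltW.
Qed.

Section Sumset.
Variable V : zmodType.
Implicit Types A B C X Y Z : {fset V}.

Definition sumfs A B : {fset V} := [fset a + b | a in A, b in B].
Definition oppfs A : {fset V} := [fset - a | a in A].
Local Notation "A +s B" := (sumfs A B) (at level 50, left associativity).

Lemma sumfsP A B x :
  reflect (exists a b, [/\ a \in A, b \in B & x = a + b]) (x \in A +s B).
Proof.
apply: (iffP (imfset2P _ _ _ _ _)) => [[a aA [b bB ->]]|[a [b [aA bB ->]]]].
  by exists a, b.
by exists a => //; exists b.
Qed.

Lemma mem_sumfs A B a b : a \in A -> b \in B -> a + b \in A +s B.
Proof. by move=> aA bB; apply/sumfsP; exists a, b. Qed.

Lemma oppfsP A x : (x \in oppfs A) = (- x \in A).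
Proof.
apply/imfsetP/idP => [[a /= aA ->]|xA]; first by rewrite opprK.
by exists (- x); rewrite ?opprK.
Qed.

Lemma sumfsC A B : A +s B = B +s A.
Proof.
by apply/fsetP=> x; apply/sumfsP/sumfsP => -[a [b [aA bB ->]]]; exists b, a; rewrite addrC.
Qed.

Lemma sumfsA A B C : A +s (B +s C) = A +s B +s C.
Proof.
apply/fsetP=> x; apply/sumfsP/sumfsP.
  move=> [a [_ [aA /sumfsP[b [c [bB cC ->]]] ->]]]; exists (a + b), c.
  by rewrite mem_sumfs // addrA.
move=> [_ [c [/sumfsP[a [b [aA bB ->]]] cC ->]]]; exists a, (b + c).
by rewrite mem_sumfs // addrA.
Qed.

Lemma sumfsS A B A' B' : A `<=` A' -> B `<=` B' -> A +s B `<=` A' +s B'.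
Proof.
move=> /fsubsetP sA /fsubsetP sB; apply/fsubsetP=> x /sumfsP[a [b [/sA aA /sB bB ->]]].
exact: mem_sumfs.
Qed.

Lemma sumfs0 A : A +s [fset 0] = A.
Proof.
apply/fsetP=> x; apply/sumfsP/idP => [[a [b [aA]]]|xA].
  by rewrite inE => /eqP-> ->; rewrite addr0.
by exists x, 0; rewrite inE eqxx addr0.
Qed.

Lemma card_sumfs1 A x : #|` A +s [fset x]| = #|` A|.
Proof.
have -> : A +s [fset x] = [fset a + x | a in A].
  apply/fsetP=> y; apply/sumfsP/imfsetP => [[a [b [aA]]]|[a /= aA ->]].
    by rewrite inE => /eqP-> ->; exists a.
  by exists a, x; rewrite inE eqxx.
by rewrite card_imfset //=; apply: addIr.
Qed.

Lemma card_sumfs_le A B : (#|` A +s B| <= #|` A| * #|` B|)%N.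
Proof.
have : (#|` A +s B| <= \sum_(b <- B) #|` A +s [fset b]|)%N.
  apply: card_cover_le => x /sumfsP[a [b [aA bB ->]]]; exists b => //.
  by apply: mem_sumfs; rewrite ?inE.
under eq_bigr do rewrite card_sumfs1.
by rewrite big_const_seq count_predT iter_addn_0 mulnC.
Qed.

Lemma card_sumfs_gel A B b : b \in B -> (#|` A| <= #|` A +s B|)%N.
Proof.
move=> bB; rewrite -(card_sumfs1 A b); apply/fsubset_leq_card/sumfsS => //.
by rewrite fsub1set.
Qed.

Lemma sumfs_eq0 A B : (A +s B == fset0) = (A == fset0) || (B == fset0).
Proof.
apply/idP/idP => [/eqP E|].
  apply/contraT; rewrite negb_or => /andP[/fset0Pn[a aA] /fset0Pn[b bB]].
  by have := mem_sumfs aA bB; rewrite E inE.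
by case/orP=> /eqP->; apply/eqP/fsetP=> x; rewrite inE; apply/sumfsP => -[a [b []]]; rewrite !inE.
Qed.

(* Induction on C: when c joins C, the part of X whose translate by c already lies in
   X + B + C is discounted by the minimality of the ratio of X. *)
Lemma petridis A B C X : X != fset0 ->
  (forall Z, Z `<=` X -> Z != fset0 -> (#|` X +s B| * #|` Z| <= #|` Z +s B| * #|` X|)%N) ->
  (#|` X +s B +s C| * #|` X| <= #|` X +s B| * #|` X +s C|)%N.
Proof.
move=> X0 minX; have Xgt0 : (0 < #|` X|)%N by rewrite cardfs_gt0.
elim/finSet_rect: C => C IH.
have [->|/fset0Pn[c cC]] := eqVneq C fset0.
  suff -> : X +s B +s fset0 = fset0 by rewrite cardfs0.
  by apply/eqP; rewrite sumfs_eq0 eqxx orbT.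
pose C0 := C `\ c; have IHC := IH C0 (fproperD1 cC).
have eqC : C = c |` C0 by rewrite fsetD1K.
pose X1 := [fset x in X | [fset x + c] +s B `<=` X +s B +s C0].
have X1X : X1 `<=` X by apply/fsubsetP=> x; rewrite !inE => /andP[].
have h1 : (#|` X1 +s B +s [fset c]| + #|` X +s B +s C| <=
           #|` X +s B +s C0| + #|` X +s B +s [fset c]|)%N.
  have s1 : X1 +s B +s [fset c] `<=` (X +s B +s C0) `&` (X +s B +s [fset c]).
    apply/fsubsetP=> _ /sumfsP[_ [c' [/sumfsP[x [b [xX1 bB ->]]] c'c ->]]].
    rewrite inE; apply/andP; split; last first.
      by rewrite !mem_sumfs // (fsubsetP X1X).
    move: xX1 c'c; rewrite !inE => /andP[_ /fsubsetP sub] /eqP->.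
    by apply: sub; rewrite addrAC mem_sumfs // inE.
  have s2 : X +s B +s C `<=` (X +s B +s C0) `|` (X +s B +s [fset c]).
    apply/fsubsetP=> _ /sumfsP[y [c' [yXB c'C ->]]].
    rewrite inE; move: c'C; rewrite eqC in_fset1U => /orP[/eqP->|c'C0].
      by rewrite [X in _ || X]mem_sumfs ?inE ?orbT.
    by rewrite mem_sumfs.
  have := fsubset_leq_card s1; have := fsubset_leq_card s2.
  have := cardfsUI (X +s B +s C0) (X +s B +s [fset c]); lia.
have h2 : (#|` X +s C0| + #|` X| <= #|` X +s C| + #|` X1|)%N.
  have s1 : (X +s C0) `&` (X +s [fset c]) `<=` X1 +s [fset c].
    apply/fsubsetP=> y; rewrite inE => /andP[yXC0 /sumfsP[x [c' [xX]]]].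
    rewrite inE => /eqP-> Ey; rewrite Ey mem_sumfs ?inE ?eqxx // xX /=.
    apply/fsubsetP=> _ /sumfsP[y' [b [+ bB ->]]]; rewrite inE => /eqP->.
    by rewrite -sumfsA (sumfsC B) sumfsA mem_sumfs // -Ey.
  have s2 : (X +s C0) `|` (X +s [fset c]) `<=` X +s C.
    rewrite fsubUset !sumfsS ?fsub1set //; exact: fsubD1set.
  have := fsubset_leq_card s1; have := fsubset_leq_card s2.
  have := cardfsUI (X +s C0) (X +s [fset c]); rewrite !card_sumfs1; lia.
have h3 : (#|` X +s B| * #|` X1| <= #|` X1 +s B| * #|` X|)%N.
  have [->|X10] := eqVneq X1 fset0; first by rewrite cardfs0 muln0.
  exact: minX.
move: h1 h2 h3 IHC Xgt0; rewrite !card_sumfs1; nia.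
Qed.

Lemma exists_min_ratio A B : A != fset0 -> exists X, [/\ X `<=` A, X != fset0,
   (#|` X +s B| * #|` A| <= #|` A +s B| * #|` X|)%N &
   forall Z, Z `<=` X -> Z != fset0 -> (#|` X +s B| * #|` Z| <= #|` Z +s B| * #|` X|)%N].
Proof.
move=> A0; pose f X : rat := #|` X +s B|%:R / #|` X|%:R.
have : A \in fpowerset A `\ fset0 by rewrite !inE A0 fpowersetE fsubset_refl.
case/(fset_argmin f) => X; rewrite !inE fpowersetE => /andP[X0 XA] Xm; exists X.
have fE Y Z : Y != fset0 -> Z != fset0 -> (f Y <= f Z) =
   (#|` Y +s B| * #|` Z| <= #|` Z +s B| * #|` Y|)%N.
  move=> Y0 Z0; rewrite /f ler_pdivrMr ?ltr0n ?cardfs_gt0 //.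
  rewrite mulrAC ler_pdivlMr ?ltr0n ?cardfs_gt0 //.
  by rewrite -!natrM ler_nat.
split=> //; first by rewrite -fE // Xm // !inE A0 fpowersetE fsubset_refl.
move=> Z ZX Z0; rewrite -fE // Xm // !inE Z0 fpowersetE; exact: fsubset_trans ZX XA.
Qed.

Fixpoint nsum n A : {fset V} := if n is n'.+1 then A +s nsum n' A else [fset 0].

(** Petridis's argument: for [X] of minimal ratio |X + B| / |X|, which is at most k, each further
    copy of [B] multiplies the size by at most that ratio. The same [X] serves every n. *)
Lemma plunnecke A B k : A != fset0 -> (#|` A +s B| <= k * #|` A|)%N ->
  exists X, [/\ X `<=` A, X != fset0 & forall n, (#|` X +s nsum n B| <= k ^ n * #|` X|)%N].
Proof.
move=> A0 hk; have [X [XA X0 hX minX]] := exists_min_ratio B A0.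
exists X; split=> //; have Xgt0 : (0 < #|` X|)%N by rewrite cardfs_gt0.
have Agt0 : (0 < #|` A|)%N by rewrite cardfs_gt0.
have kX : (#|` X +s B| <= k * #|` X|)%N by move: hX hk; nia.
elim=> [|n IH]; first by rewrite /= sumfs0 expn0 mul1n.
rewrite /= sumfsA expnS -mulnA.
have h := petridis A (nsum n B) X0 minX.
apply: leq_trans (leq_mul (leqnn k) IH).
rewrite -(leq_pmul2r Xgt0); apply: leq_trans h _.
by rewrite mulnAC leq_mul2r kX orbT.
Qed.

(** With one representation d = y - z fixed for each difference, (x, d) -> (x + y, x + z) is
    injective: the two images subtract to d, which determines y and then x. *)
Lemma ruzsa_triangle X Y Z : 
  (#|` X| * #|` Y +s oppfs Z| <= #|` X +s Y| * #|` X +s Z|)%N.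
Proof.
have ch d : d \in Y +s oppfs Z -> exists yz : V * V, (yz.1 \in Y) && (yz.2 \in Z) && (d == yz.1 - yz.2).
  case/sumfsP=> y [z [yY]]; rewrite oppfsP => zZ ->; exists (y, - z).
  by rewrite /= yY zZ opprK eqxx.
pose g d : V * V := if d \in Y +s oppfs Z =P true is ReflectT h then xchoose (ch d h) else (0, 0).
have gP d : d \in Y +s oppfs Z -> [/\ (g d).1 \in Y, (g d).2 \in Z & d = (g d).1 - (g d).2].
  rewrite /g; case: eqP => // h _.
  by have /andP[/andP[h1 h2] /eqP h3] := xchooseP (ch d h).
pose F (xd : V * V) := (xd.1 + (g xd.2).1, xd.1 + (g xd.2).2).
have -> : (#|` X| * #|` Y +s oppfs Z| = #|` X `*` (Y +s oppfs Z)|)%N by rewrite cardfsM.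
have -> : (#|` X +s Y| * #|` X +s Z| = #|` (X +s Y) `*` (X +s Z)|)%N by rewrite cardfsM.
have <- : #|` [fset F xd | xd in X `*` (Y +s oppfs Z)]| = #|` X `*` (Y +s oppfs Z)|.
  rewrite card_in_imfset //= => -[x d] [x' d']; rewrite /F !in_fsetM /=.
  move=> /andP[_ /gP[_ _ E]] /andP[_ /gP[_ _ E']] [e1 e2].
  have ed : d = d'.
    have eqd z u v : u - v = (z + u) - (z + v) :> V by rewrite opprD addrACA subrr add0r.
    by rewrite E E' (eqd x) e1 e2 -eqd.
  by move: e1; rewrite ed => /addIr->.
apply/fsubset_leq_card/fsubsetP=> y /imfsetP[[x d] /=]; rewrite in_fsetM /=.
by case/andP=> xX /gP[y1 y2 _] ->; rewrite in_fsetM /= !mem_sumfs.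
Qed.

Definition diffs A := A +s oppfs A.

Lemma nsum_diffs n A : nsum n (diffs A) `<=` nsum n A +s oppfs (nsum n A).
Proof.
elim: n => [|n IH] /=.
  by apply/fsubsetP=> x; rewrite inE => /eqP->; apply/sumfsP; exists 0, 0;
    rewrite oppfsP oppr0 !inE addr0.
apply/fsubsetP=> _ /sumfsP[_ [x [/sumfsP[a [b [aA +  ->]]] /(fsubsetP IH) + ->]]].
rewrite oppfsP => bA /sumfsP[y [z [yA +  ->]]]; rewrite oppfsP => zA.
by rewrite addrACA mem_sumfs ?mem_sumfs // oppfsP opprD mem_sumfs.
Qed.

Lemma diffs0 A : A != fset0 -> 0 \in diffs A.
Proof. by case/fset0Pn=> a aA; rewrite -(subrr a) mem_sumfs // oppfsP opprK. Qed.

Lemma diffsN A x : (- x \in diffs A) = (x \in diffs A).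
Proof.
suff sub y : y \in diffs A -> - y \in diffs A.
  by apply/idP/idP => /sub; rewrite ?opprK.
case/sumfsP=> a [b [aA]]; rewrite oppfsP => bA ->.
by rewrite opprD addrC mem_sumfs // oppfsP opprK.
Qed.

Lemma nsumN n D : (forall x, (- x \in D) = (x \in D)) ->
  forall x, (- x \in nsum n D) = (x \in nsum n D).
Proof.
move=> sD; suff sub y : y \in nsum n D -> - y \in nsum n D.
  by move=> x; apply/idP/idP => /sub; rewrite ?opprK.
elim: n y => [|n IH] y /=; first by rewrite !inE oppr_eq0.
by case/sumfsP=> a [b [aA /IH bA ->]]; rewrite opprD mem_sumfs // sD.
Qed.

Lemma nsumDS m n D : nsum m D +s nsum n D `<=` nsum (m + n) D.
Proof.
elim: m => [|m IH] /=; first by rewrite sumfsC sumfs0.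
by rewrite -sumfsA; apply: sumfsS.
Qed.

Lemma nsum_mono m n D : 0 \in D -> (m <= n)%N -> nsum m D `<=` nsum n D.
Proof.
move=> D0 /subnKC <-; elim: (n - m)%N => [|k IH]; first by rewrite addn0.
apply: fsubset_trans IH _; rewrite addnS /=; apply/fsubsetP=> x xk.
by rewrite -[x]add0r mem_sumfs.
Qed.

(** [Y] is a largest subset of [B] whose translates y + A are pairwise disjoint. They fit into A +
    B, so |Y| <= k; by maximality every b + A meets some y + A, which puts b in y + A - A. *)
Lemma ruzsa_cover A B k : A != fset0 -> (#|` A +s B| <= k * #|` A|)%N ->
  exists Y, (#|` Y| <= k)%N /\ B `<=` Y +s diffs A.
Proof.
move=> A0 hk.
pose P (Y : {fset V}) := (Y `<=` B) &&
  [forall y : Y, forall y' : Y, (([fset val y] +s A) `&` ([fset val y'] +s A) != fset0) ==> (y == y')].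
have P0 : P fset0.
  by rewrite /P fsub0set; apply/forallP=> -[y yY]; have := yY; rewrite inE.
have [Y /andP[YB /forallP Yd] maxY] : exists2 Y, P Y & forall Z, P Z -> (#|` Z| <= #|` Y|)%N.
  have : fset0 \in [fset Z in fpowerset B | P Z] by rewrite !inE fpowersetE fsub0set P0.
  case/(fset_argmin (fun Z : {fset V} => (#|` B| - #|` Z|)%N)) => Y.
  rewrite !inE fpowersetE => /andP[YB PY] mY; exists Y => // Z PZ.
  have ZB : Z `<=` B by case/andP: PZ.
  have := mY Z; rewrite !inE fpowersetE ZB PZ => /(_ isT); rewrite leEnat.
  have := fsubset_leq_card ZB; have := fsubset_leq_card YB; lia.
have dY y y' z : y \in Y -> y' \in Y -> z \in [fset y] +s A -> z \in [fset y'] +s A -> y = y'.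
  move=> yY y'Y z1 z2; have /forallP/(_ [` y'Y])/implyP := Yd [` yY].
  rewrite /= => h; suff : [` yY] == [` y'Y] by move/eqP=> [].
  by apply: h; apply/fset0Pn; exists z; rewrite inE z1.
exists Y; split.
  have : (\sum_(y <- Y) #|` [fset y] +s A| <= #|` A +s B|)%N.
    apply: card_disjoint_le => [|y yY|y y' z]; first exact: fset_uniq.
      by rewrite sumfsC; apply: sumfsS; rewrite // fsub1set (fsubsetP YB).
    exact: dY.
  under eq_bigr do rewrite sumfsC card_sumfs1.
  rewrite big_const_seq count_predT iter_addn_0.
  have : (0 < #|` A|)%N by rewrite cardfs_gt0.
  rewrite -/(#|` Y|); move: hk; nia.
apply/fsubsetP=> b bB; apply/contraT => nb.
have nbY : b \notin Y.
  by apply: contra nb => bY; rewrite -[b]addr0 mem_sumfs // diffs0.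
suff : P (b |` Y) by move/maxY; rewrite cardfsU1 nbY add1n ltnn.
have key y : y \in Y -> ([fset b] +s A) `&` ([fset y] +s A) = fset0.
  move=> yY; apply/eqP; apply: contraNT nb => /fset0Pn[z].
  rewrite inE => /andP[/sumfsP[b' [a [b'b aA ->]]] /sumfsP[y' [a' [y'y a'A]]]].
  move: b'b y'y; rewrite !inE => /eqP-> /eqP-> /(congr1 (fun x => x - a)).
  by rewrite addrK -addrA => ->; rewrite mem_sumfs // mem_sumfs // oppfsP opprK.
rewrite /P fsubUset fsub1set bB YB /=; apply/forallP=> -[y yY]; apply/forallP=> -[y' y'Y].
apply/implyP=> /= h; apply/eqP/val_inj => /=.
move: (yY) (y'Y) h; rewrite !in_fset1U => /orP[/eqP->|yY'] /orP[/eqP->|y'Y'] //.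
- by rewrite key // eqxx.
- by rewrite fsetIC key // eqxx.
- by move/fset0Pn=> [z]; rewrite inE => /andP[z1 z2]; apply: dY z1 z2.
Qed.

End Sumset.
Notation "A +s B" := (sumfs A B) (at level 50, left associativity).

(** * A discrete Brunn-Minkowski inequality *)

Lemma ltn_stair i j F G : (i.+1 < F)%N -> (j < G)%N -> ((i + j).+1 < (F + G).-1)%N.
Proof. lia. Qed.

Lemma ltn_stair' i j F G : (i < F)%N -> (j.+1 < G)%N -> ((i + j).+1 < (F + G).-1)%N.
Proof. lia. Qed.

Lemma leq_stair i j F G N : (i < F)%N -> ((F - i) + (G - j) <= N.+1)%N -> ((F - i.+1) + (G - j) <= N)%N.
Proof. lia. Qed.

Lemma leq_stair' i j F G N : (j < G)%N -> ((F - i) + (G - j) <= N.+1)%N -> ((F - i) + (G - j.+1) <= N)%N.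
Proof. lia. Qed.

Section Numeric.
Variable R : realFieldType.

(** Radon's inequality, that is, convexity of the power with weights x and y. The induction step is
    Chebyshev's inequality for the equally ordered pairs u, v and u^(n+1), v^(n+1). *)
Lemma radon (x y u v : R) n : 0 <= x -> 0 <= y -> 0 <= u -> 0 <= v ->
  (x * u + y * v) ^+ n.+1 <= (x + y) ^+ n * (x * u ^+ n.+1 + y * v ^+ n.+1).
Proof.
move=> x0 y0 u0 v0; elim: n => [|n IH]; first by rewrite !expr1 expr0 mul1r.
have step : (x * u + y * v) * (x * u ^+ n.+1 + y * v ^+ n.+1) <=
   (x + y) * (x * u ^+ n.+2 + y * v ^+ n.+2).
  rewrite -subr_ge0.
  have -> : (x + y) * (x * u ^+ n.+2 + y * v ^+ n.+2) -
     (x * u + y * v) * (x * u ^+ n.+1 + y * v ^+ n.+1) =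
     x * y * ((u - v) * (u ^+ n.+1 - v ^+ n.+1)).
    by rewrite !(exprS _ n.+1); ring.
  apply: mulr_ge0; first exact: mulr_ge0.
  have [uv|/ltW vu] := leP v u.
    by apply: mulr_ge0; rewrite subr_ge0 // lerXn2r.
  by rewrite -mulrNN; apply: mulr_ge0; rewrite oppr_ge0 subr_le0 // lerXn2r.
rewrite exprS; apply: le_trans (_ : (x * u + y * v) * ((x + y) ^+ n *
   (x * u ^+ n.+1 + y * v ^+ n.+1)) <= _).
  by rewrite ler_wpM2l // addr_ge0 // mulr_ge0.
rewrite mulrCA [X in _ <= X * _]exprSr -mulrA ler_wpM2l //.
by rewrite exprn_ge0 // addr_ge0.
Qed.

(* The two staircases are traversed at equal speed in relative mass. *)
Lemma transport (E : R) (F G : nat) (al be c : nat -> R) :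
  (forall i, (i < F)%N -> 0 < al i) -> (forall j, (j < G)%N -> 0 < be j) ->
  (forall k, c k.+1 <= c k) -> (forall k, 0 <= c k) ->
  (forall i j, (i < F)%N -> (j < G)%N -> E <= c (i + j)%N * ((al i)^-1 + (be j)^-1)) ->
  forall N i j x y mu, ((F - i) + (G - j) <= N)%N -> (i < F)%N -> (j < G)%N ->
  0 <= x <= al i -> 0 <= y <= be j ->
  x + \sum_(i.+1 <= k < F) al k = mu -> y + \sum_(j.+1 <= k < G) be k = mu ->
  E * mu <= \sum_((i + j).+1 <= k < (F + G).-1) c k + c (i + j)%N * (x / al i + y / be j).
Proof.
(* [N] bounds the number of stairs left; [x] and [y] are the masses left on stairs [i] and [j], and
   [mu] is the mass left on either side. *)
move=> al0 be0 cd c0 hE; elim=> [|N IH] i j x y mu leN iF jG.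
  by move: leN; rewrite leqn0 addn_eq0 subn_eq0 leqNgt iF.
move=> /andP[x0 xa] /andP[y0 yb] hx hy.
have ai0 := al0 i iF; have bj0 := be0 j jG.
have cS : 0 <= \sum_((i + j).+1 <= k < (F + G).-1) c k by apply: sumr_ge0.
have cons z : 0 <= z -> E * z <= c (i + j)%N * (z / al i + z / be j).
  move=> z0; have := ler_wpM2r z0 (hE i j iF jG).
  by rewrite -mulrA mulrDl ![_^-1 * z]mulrC.
(* The stair with less mass left is finished first. The mass consumed pays for E, the next [c] taken
   out of the sum pays for the new full stair, and monotonicity of [c] handles what remains of the
   other stair. *)
have [xy|yx] := leP x y.
  have yx0 : 0 <= (y - x) / be j by rewrite divr_ge0 ?subr_ge0 // ltW.
  have dec : c (i + j)%N * (x / al i + y / be j) =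
     c (i + j)%N * (x / al i + x / be j) + c (i + j)%N * ((y - x) / be j) by ring.
  have [iF1|] := ltnP i.+1 F; last first.
    move=> Fi; have Ex : x = mu by rewrite -hx big_geq ?addr0 //.
    rewrite -Ex dec addrCA; apply: le_trans (cons x x0) _.
    by rewrite lerDl addr_ge0 // mulr_ge0.
  have /(_ i.+1 j (al i.+1) (y - x) (mu - x)) IH1 := IH.
  have : E * (mu - x) <= \sum_((i.+1 + j).+1 <= k < (F + G).-1) c k +
      c (i.+1 + j)%N * (al i.+1 / al i.+1 + (y - x) / be j).
    apply: IH1 => //; first exact: leq_stair iF leN.
    - by rewrite lexx andbT ltW // al0.
    - by rewrite subr_ge0 xy /= (le_trans _ yb) // gerBl.
    - by rewrite -hx addrAC subrr add0r [RHS]big_ltn.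
    - by rewrite -hy addrAC.
  rewrite divff ?gt_eqF ?al0 // addSn => h1.
  rewrite (@big_ltn _ _ _ (i + j).+1); last exact: ltn_stair iF1 jG.
  rewrite dec; have := cons x x0; have := cd (i + j)%N.
  set s := \sum_(_ <= _ < _) _ in h1 *; move: h1; set t := (y - x) / _ in yx0 *.
  set c0' := c (i + j)%N; set c1 := c _.+1; set w := _ + x / be j.
  move=> h1 h2 h3; have : c1 * t <= c0' * t by rewrite ler_wpM2r.
  move: h1 h3; rewrite mulrBr mulrDr mulr1 => h1 h3 h4; lra.
have xy0 : 0 <= (x - y) / al i by rewrite divr_ge0 ?subr_ge0 // ltW.
have {}xy0 : 0 <= (x - y) / al i by [].
have dec : c (i + j)%N * (x / al i + y / be j) =
   c (i + j)%N * (y / al i + y / be j) + c (i + j)%N * ((x - y) / al i) by ring.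
have [jG1|] := ltnP j.+1 G; last first.
  move=> Gj; have Ey : y = mu by rewrite -hy big_geq ?addr0 //.
  rewrite -Ey dec addrCA; apply: le_trans (cons y y0) _.
  by rewrite lerDl addr_ge0 // mulr_ge0.
have : E * (mu - y) <= \sum_((i + j.+1).+1 <= k < (F + G).-1) c k +
    c (i + j.+1)%N * ((x - y) / al i + be j.+1 / be j.+1).
  apply: IH => //; first exact: leq_stair' jG leN.
  - by rewrite subr_ge0 ltW //= (le_trans _ xa) // gerBl.
  - by rewrite lexx andbT ltW // be0.
  - by rewrite -hx addrAC.
  - by rewrite -hy addrAC subrr add0r [RHS]big_ltn.
rewrite divff ?gt_eqF ?be0 // addnS => h1.
rewrite (@big_ltn _ _ _ (i + j).+1); last exact: ltn_stair' iF jG1.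
rewrite dec; have := cons y y0; have := cd (i + j)%N.
set s := \sum_(_ <= _ < _) _ in h1 *; move: h1; set t := (x - y) / _ in xy0 *.
set c0' := c (i + j)%N; set c1 := c _.+1; set w := _ + y / be j.
move=> h1 h2 h3; have : c1 * t <= c0' * t by rewrite ler_wpM2r.
move: h1 h3; rewrite mulrBr mulrDr mulr1 => h1 h3 h4; lra.
Qed.

(** Masses are normalised to 1. The F + G full stairs are charged to the F + G - 1 values of i + j
    along the path; the walk starts on two full stairs at index 0, whence the additional [c 0]. *)
Lemma transport_total (E A B : R) (F G : nat) (a b c : nat -> R) :
  (0 < F)%N -> (0 < G)%N ->
  (forall i, (i < F)%N -> 0 < a i) -> (forall j, (j < G)%N -> 0 < b j) ->
  (forall k, c k.+1 <= c k) -> (forall k, 0 <= c k) ->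
  \sum_(0 <= i < F) a i = A -> \sum_(0 <= j < G) b j = B ->
  (forall i j, (i < F)%N -> (j < G)%N -> E <= c (i + j)%N * (A / a i + B / b j)) ->
  E <= \sum_(0 <= k < (F + G).-1) c k + c 0%N.
Proof.
move=> F0 G0 a0 b0 cd c0 hA hB hE.
have A0 : 0 < A.
  rewrite -hA big_ltn // ltr_pwDl ?a0 // big_nat_cond sumr_ge0 // => i.
  by rewrite andbT => /andP[_ /a0/ltW].
have B0 : 0 < B.
  rewrite -hB big_ltn // ltr_pwDl ?b0 // big_nat_cond sumr_ge0 // => i.
  by rewrite andbT => /andP[_ /b0/ltW].
have := @transport E F G (fun i => a i / A) (fun j => b j / B) c.
have ga i : (i < F)%N -> 0 < a i / A by move=> /a0 ?; rewrite divr_gt0.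
have gb i : (i < G)%N -> 0 < b i / B by move=> /b0 ?; rewrite divr_gt0.
move=> /(_ ga gb cd c0) h; have {h} := h _ (F + G)%N 0%N 0%N (a 0%N / A) (b 0%N / B) 1.
rewrite mulr1 !divff ?gt_eqF ?ga ?gb // => h.
apply: le_trans (_ : _ <= \sum_(1 <= k < (F + G).-1) c k + c 0%N * (1 + 1)) _.
  apply: h => //; first by move=> i j iF jG; rewrite !invf_div; apply: hE.
  - by rewrite !subn0.
  - by rewrite lexx ltW ?ga.
  - by rewrite lexx ltW ?gb.
  - by rewrite -mulr_suml -mulrDl -(@big_ltn _ _ _ 0 F) // hA divff ?gt_eqF.
  - by rewrite -mulr_suml -mulrDl -(@big_ltn _ _ _ 0 G) // hB divff ?gt_eqF.
have h0 : (0 < (F + G).-1)%N by move: F0 G0; clear; lia.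
by rewrite (big_ltn h0) mulrDr mulr1 addrA [c 0%N + _]addrC.
Qed.
End Numeric.

Lemma sum_ltn f n : (f <= n)%N -> (\sum_(0 <= i < n) (i < f) = f)%N.
Proof.
elim: n f => [|n IH] f; first by rewrite leqn0 => /eqP->; rewrite big_nil.
rewrite big_nat_recr //= leq_eqVlt ltnS => /orP[/eqP->|fn].
  rewrite ltnSn big_nat_cond (eq_bigr (fun=> 1%N)).
    by rewrite -big_nat_cond sum_nat_const_nat subn0 muln1 addn1.
  by move=> i; rewrite andbT => /andP[_ /ltnW]; rewrite -ltnS => ->.
by rewrite IH // ltnNge fn /= addn0.
Qed.

Definition zfree (G : zmodType) (bs : seq G) := forall ns : seq int, size ns = size bs ->
  \sum_(p <- zip bs ns) p.1 *~ p.2 = 0 -> all (pred1 0) ns.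

Section Lines.
Variable G : zmodType.
Implicit Types (b : G) (X Y : {fset G}).

(** Classical logic makes membership Boolean, so that the quotient group by this cyclic subgroup can
    be formed. *)
Definition zline b : {pred G} := [pred x | `[<exists n : int, x = b *~ n>]].

Lemma zlineP b x : reflect (exists n : int, x = b *~ n) (x \in zline b).
Proof. exact: asboolP. Qed.

Lemma zline_closed b : zmod_closed (zline b).
Proof.
split; first by apply/zlineP; exists 0; rewrite mulr0z.
by move=> x y /zlineP[n ->] /zlineP[m ->]; apply/zlineP; exists (n - m); rewrite mulrzBr.
Qed.
HB.instance Definition _ b := GRing.isZmodClosed.Build G (zline b) (zline_closed b).

Definition ap b m : {fset G} := [fset b *+ n | n in iota 0 m].
Fixpoint box (bs : seq G) m : {fset G} :=
  if bs is b :: bs' then ap b m +s box bs' m else [fset 0].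

Lemma mem_ap b m n : (n < m)%N -> b *+ n \in ap b m.
Proof. by move=> nm; apply/imfsetP; exists n => //=; rewrite mem_iota. Qed.

Lemma box0 bs m : (0 < m)%N -> 0 \in box bs m.
Proof.
move=> m0; elim: bs => [|b bs IH] /=; first by rewrite inE.
by rewrite -[0]addr0 mem_sumfs // -(mulr0n b) mem_ap.
Qed.

Lemma zfree_head b bs n : zfree (b :: bs) -> b *~ n = 0 -> n = 0.
Proof.
move=> fr bn; have := fr (n :: nseq (size bs) 0).
rewrite /= size_nseq big_cons /= bn add0r => /(_ erefl).
rewrite big1_seq ?eqxx => [/(_ erefl)/andP[/eqP]//|p /andP[_]].
elim: bs {fr} => [|c bs IH] //=; rewrite inE => /orP[/eqP-> /=|/IH //].
by rewrite mulr0z.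
Qed.

(* In one dimension the extremal translates overlap in a single point. *)
Lemma card_sum_line b X Y x0 y0 : (forall n : int, b *~ n = 0 -> n = 0) ->
  X != fset0 -> Y != fset0 ->
  (forall x, x \in X -> x - x0 \in zline b) -> (forall y, y \in Y -> y - y0 \in zline b) ->
  (#|` X| + #|` Y| <= (#|` X +s Y|).+1)%N.
Proof.
move=> binf X0 Y0 Xl Yl.
have ht z0 (Z : {fset G}) : (forall z, z \in Z -> z - z0 \in zline b) ->
    exists f : G -> int, forall z, z \in Z -> z = z0 + b *~ f z.
  move=> Zl; have /choice[f fP] : forall z, exists n : int, z \in Z -> z = z0 + b *~ n.
    move=> z; have [/Zl/zlineP[n E]|_] := boolP (z \in Z); last by exists 0.
    by exists n; rewrite -E addrC subrK.
  by exists f.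
have [f fP] := ht _ _ Xl; have [g gP] := ht _ _ Yl.
have [x1 x1X] := fset0Pn _ X0; have [y1 y1Y] := fset0Pn _ Y0.
have [x xX xm] := fset_argmin (fun x => - f x) x1X.
have [y yY ym] := fset_argmin g y1Y.
have sub : (X +s [fset y]) `|` (Y +s [fset x]) `<=` X +s Y.
  by rewrite fsubUset [Y +s _]sumfsC !sumfsS ?fsub1set.
have one : (X +s [fset y]) `&` (Y +s [fset x]) `<=` [fset x + y].
  apply/fsubsetP=> z; rewrite inE => /andP[/sumfsP[x' [? [x'X]]]].
  rewrite inE => /eqP-> -> /sumfsP[y' [? [y'Y]]]; rewrite inE => /eqP-> E.
  have := xm _ x'X; have := ym _ y'Y; rewrite lerN2 => le1 le2.
  have eqf : f x' - f x + (g y - g y') = 0.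
    apply: binf; apply: (addrI (x0 + y0 + b *~ (f x + g y'))).
    rewrite addr0 -addrA -mulrzDr.
    have -> : f x + g y' + (f x' - f x + (g y - g y')) = f x' + g y by ring.
    have {E} : (x0 + b *~ f x') + (y0 + b *~ g y) = (y0 + b *~ g y') + (x0 + b *~ f x).
      by rewrite -(fP _ x'X) -(gP _ yY) -(gP _ y'Y) -(fP _ xX).
    rewrite addrACA [X in _ = X]addrACA -!mulrzDr [y0 + x0]addrC [g y' + f x]addrC.
    by move=> ->.
  have -> : x' = x.
    have ef : f x' = f x by move: eqf le1 le2; clear; lia.
    by rewrite (fP _ x'X) ef -(fP _ xX).
  by rewrite inE.
have := fsubset_leq_card sub; have := fsubset_leq_card one.
have := cardfsUI (X +s [fset y]) (Y +s [fset x]); rewrite !card_sumfs1 cardfs1.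
by clear; lia.
Qed.

End Lines.

(** * Fibres and level sets over the quotient by a cyclic subgroup *)

Section Fibers.
Variables (G : zmodType) (b : G).
Implicit Types (X Y : {fset G}).
Hypothesis binf : forall n : int, b *~ n = 0 -> n = 0.
Local Notation Q := (Quotient.quot (zline b)).
Local Notation pr := (\pi_Q : G -> Q).

Lemma prE x y : (pr x == pr y) = (x - y \in zline b).
Proof. by rewrite Quotient.idealrBE. Qed.

Definition fib X (t : Q) : {fset G} := [fset x in X | pr x == t].
Definition shad X : {fset Q} := [fset pr x | x in X].
(** The layers of the fibre-size function: their cardinalities add up to that of [X], so a bound for
    pairs of layers can be integrated to a bound for sets. *)
Definition lev X i : {fset Q} := [fset t in shad X | (i < #|` fib X t|)%N].

Lemma mem_fib X t x : (x \in fib X t) = (x \in X) && (pr x == t).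
Proof. by rewrite !inE. Qed.

Lemma mem_lev X i t : (t \in lev X i) = (i < #|` fib X t|)%N.
Proof.
rewrite !inE; case: ltnP => h; rewrite ?andbF // andbT.
have : fib X t != fset0 by rewrite -cardfs_gt0; apply: leq_ltn_trans h.
case/fset0Pn=> x; rewrite mem_fib => /andP[xX /eqP<-].
by apply/imfsetP; exists x.
Qed.

Lemma card_fib_sum X : (#|` X| = \sum_(t <- shad X) #|` fib X t|)%N.
Proof.
apply/eqP; rewrite eqn_leq card_cover_le => [|x xX] /=; last first.
  by exists (pr x); rewrite ?mem_fib ?xX ?eqxx //; apply/imfsetP; exists x.
apply: card_disjoint_le => [|t _|t u x _ _]; first exact: fset_uniq.
  by apply/fsubsetP=> x; rewrite mem_fib => /andP[].
by rewrite !mem_fib => /andP[_ /eqP<-] /andP[_ /eqP<-].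
Qed.

Lemma card_lev X i : (#|` lev X i| = \sum_(t <- shad X) (i < #|` fib X t|))%N.
Proof.
rewrite card_fset_sum1 /lev big_fset /= big_mkcond /=.
by apply: eq_bigr => t _; case: ltnP.
Qed.

Lemma sum_lev X n : (forall t, (#|` fib X t| <= n)%N) ->
  (\sum_(0 <= i < n) #|` lev X i| = #|` X|)%N.
Proof.
move=> bd; rewrite card_fib_sum.
under eq_bigr do rewrite card_lev.
by rewrite exchange_big /=; apply: eq_bigr => t _; rewrite sum_ltn.
Qed.

Lemma lev_decr X i : lev X i.+1 `<=` lev X i.
Proof. by apply/fsubsetP=> t; rewrite !mem_lev; apply: ltnW. Qed.

(** Fibres with at least i + 1 and j + 1 elements have a sum with at least i + j + 1 elements, by
    [card_sum_line]; the level indices therefore add without loss. *)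
Lemma lev_sum X Y i j : lev X i +s lev Y j `<=` lev (X +s Y) (i + j).
Proof.
apply/fsubsetP=> z /sumfsP[t [u [+ + ->]]]; rewrite !mem_lev => it ju.
have [x xt] : exists x, x \in fib X t.
  by apply/fset0Pn; rewrite -cardfs_gt0; apply: leq_ltn_trans it.
have [y yu] : exists y, y \in fib Y u.
  by apply/fset0Pn; rewrite -cardfs_gt0; apply: leq_ltn_trans ju.
have : (#|` fib X t| + #|` fib Y u| <= (#|` fib X t +s fib Y u|).+1)%N.
  apply: (@card_sum_line _ b _ _ x y binf).
  - by apply/fset0Pn; exists x.
  - by apply/fset0Pn; exists y.
  - move=> x'; move: xt; rewrite !mem_fib => /andP[_ /eqP<-] /andP[_].
    by rewrite prE.
  - move=> y'; move: yu; rewrite !mem_fib => /andP[_ /eqP<-] /andP[_].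
    by rewrite prE.
have : (#|` fib X t +s fib Y u| <= #|` fib (X +s Y) (t + u)%R|)%N.
  apply/fsubset_leq_card/fsubsetP=> z' /sumfsP[x' [y' [+ + ->]]].
  rewrite !mem_fib => /andP[x'X /eqP<-] /andP[y'Y /eqP<-].
  by rewrite mem_sumfs // raddfD eqxx.
move: it ju; clear; lia.
Qed.

Lemma lev_shift X B i : lev X i +s shad B `<=` lev (X +s B) i.
Proof.
apply/fsubsetP=> z /sumfsP[t [u [+ /imfsetP[c /= cB ->] ->]]]; rewrite !mem_lev => it.
apply: leq_trans it _; rewrite -(card_sumfs1 (fib X t) c); apply: fsubset_leq_card.
apply/fsubsetP=> y /sumfsP[x [c' [+ + ->]]]; rewrite mem_fib inE => /andP[xX /eqP<-] /eqP->.
by rewrite mem_fib mem_sumfs // raddfD eqxx.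
Qed.

(** One point of [X] over each point of the shadow, translated along [ap b m], gives disjoint
    progressions of length m. So the shadow, which is the boundary term of the induction, costs only
    a fraction 1/m of an enlarged sumset. *)
Lemma card_shad_ap X m : (m * #|` lev X 0| <= #|` X +s ap b m|)%N.
Proof.
have /choice[f fP] : forall t, exists x, t \in lev X 0 -> x \in X /\ pr x = t.
  move=> t; have [|_] := boolP (t \in lev X 0); last by exists 0.
  rewrite mem_lev cardfs_gt0 => /fset0Pn[x]; rewrite mem_fib => /andP[xX /eqP xt].
  by exists x.
have cap x : #|` [fset x] +s ap b m| = m.
  rewrite sumfsC card_sumfs1 card_in_imfset /= ?undup_id ?iota_uniq ?size_iota //.
  move=> i j _ _ /eqP; rewrite -subr_eq0 !pmulrn -mulrzBr => /eqP/binf.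
  by clear; lia.
have : (\sum_(t <- lev X 0) #|` [fset f t] +s ap b m| <= #|` X +s ap b m|)%N.
  apply: card_disjoint_le => [|t tX|t u x tX uX]; first exact: fset_uniq.
    by apply: sumfsS => //; rewrite fsub1set; case: (fP t tX).
  have pap z : z \in ap b m -> pr z = 0.
    case/imfsetP=> n _ ->; rewrite -(raddf0 pr); apply/eqP; rewrite prE subr0.
    by apply/zlineP; exists n%:Z; rewrite pmulrn.
  have mem v : v \in lev X 0 -> x \in [fset f v] +s ap b m -> pr x = v.
    move=> vX /sumfsP[w [z [+ /pap zb ->]]]; rewrite inE => /eqP->.
    by rewrite raddfD /= zb addr0; case: (fP v vX).
  by move=> /(mem _ tX)<- /(mem _ uX)<-.
under eq_bigr do rewrite cap.
by rewrite big_const_seq count_predT iter_addn_0.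
Qed.

Lemma shad_box bs m : shad (box bs m) = box (map pr bs) m.
Proof.
elim: bs => [|c bs IH] /=.
  apply/fsetP=> t; rewrite inE; apply/imfsetP/eqP => [[x /=]|->].
    by rewrite inE => /eqP-> ->; rewrite raddf0.
  by exists 0; rewrite ?inE ?raddf0.
have apE : shad (ap c m) = [fset pr c *+ n | n in iota 0 m].
  apply/fsetP=> t; apply/imfsetP/imfsetP => [[_ /imfsetP[n /= nm ->] ->]|[n /= nm ->]].
    by exists n => //; rewrite raddfMn.
  by exists (c *+ n); rewrite ?raddfMn //; apply/imfsetP; exists n.
rewrite -IH; have -> : ap (pr c) m = shad (ap c m) by rewrite apE.
apply/fsetP=> t; apply/imfsetP/sumfsP.
  move=> [x /sumfsP[y [z [yA zB ->]]] ->]; exists (pr y), (pr z).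
  by rewrite raddfD; split=> //; apply/imfsetP; [exists y | exists z].
move=> [_ [_ [/imfsetP[y /= yA ->] /imfsetP[z /= zB ->] ->]]].
by exists (y + z); rewrite ?raddfD // mem_sumfs.
Qed.

Lemma zfree_quot bs : zfree (b :: bs) -> @zfree Q (map pr bs).
Proof.
move=> fr ns; rewrite size_map => sz E.
have /eqP := E; have -> : \sum_(p <- zip (map pr bs) ns) p.1 *~ p.2 =
    pr (\sum_(p <- zip bs ns) p.1 *~ p.2).
  rewrite raddf_sum; elim: bs ns sz {fr E} => [|c bs IH] [|n ns] //=.
    by rewrite !big_nil.
  by move=> [/IH e]; rewrite !big_cons e raddfMz.
rewrite -(raddf0 pr) prE subr0 => /zlineP[n En].
have := fr (- n :: ns); rewrite /= sz big_cons /= mulrNz -En addNr => /(_ erefl erefl).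
by case/andP.
Qed.
End Fibers.
Arguments fib {G} b X t.
Arguments shad {G} b X.
Arguments lev {G} b X i.

Section BrunnMinkowski.
Variable R : realType.

Lemma root_exists n (a : R) : 0 <= a -> exists2 x, 0 <= x & x ^+ n.+1 = a.
Proof.
move=> a0; exists (a `^ n.+1%:R^-1); first exact: powR_ge0.
by rewrite -powR_mulrn ?powR_ge0 // -powRrM mulVf ?pnatr_eq0 // powRr1.
Qed.

(** For positive a and b this follows from [bm] by Radon's inequality. Unlike [bm] it has content at
    k = 0, where it says that c is at least a and b, and it is the form that [transport_total] takes
    as input. *)
Definition bm_dual k (a b c : R) := forall P Q, 0 <= P -> 0 <= Q ->
  (P + Q) ^+ k.+1 <= c * (P ^+ k.+1 / a + Q ^+ k.+1 / b).

(* a^(1/k) + b^(1/k) <= c^(1/k), without roots. *)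
Definition bm k (a b c : R) := forall x y, 0 <= x -> 0 <= y ->
  x ^+ k <= a -> y ^+ k <= b -> (x + y) ^+ k <= c.

Lemma bm_dual_of_bm k a b c : 0 < a -> 0 < b -> bm k.+1 a b c -> bm_dual k.+1 a b c.
Proof.
move=> a0 b0 h P Q P0 Q0.
have [x x0 xa] := root_exists k (ltW a0); have [y y0 yb] := root_exists k (ltW b0).
have xgt0 : 0 < x by rewrite lt0r x0 andbT; apply: contraTneq a0 => z; rewrite -xa z expr0n ltxx.
have ygt0 : 0 < y by rewrite lt0r y0 andbT; apply: contraTneq b0 => z; rewrite -yb z expr0n ltxx.
have hc : (x + y) ^+ k.+1 <= c by apply: h; rewrite ?xa ?yb.
have := @radon R x y (P / x) (Q / y) k.+1 x0 y0.
rewrite !divr_ge0 // => /(_ isT isT).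
have e (z w : R) : 0 < z -> z * (w / z) = w by move=> z0; rewrite mulrCA divff ?mulr1 ?gt_eqF.
have e2 (z w : R) : 0 < z -> z * (w / z) ^+ k.+2 = w ^+ k.+2 / z ^+ k.+1.
  move=> z0; rewrite expr_div_n [z ^+ k.+2]exprS invfM mulrCA (mulrA z).
  by rewrite divff ?gt_eqF // mul1r.
rewrite !e // !e2 // xa yb => h2; apply: le_trans h2 _.
by rewrite ler_wpM2r // addr_ge0 // divr_ge0 ?exprn_ge0 // ltW.
Qed.

(** In [bm_step] the error of lower dimension occurs twice, in the sum over the levels and in the
    additional [c 0]; the shadow of X + Y contributes 1 more. *)
Fixpoint bmC k : R := if k is k'.+1 then 2 * bmC k' + 1 else 0.

Lemma bmC_ge0 k : 0 <= bmC k.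
Proof. by elim: k => //= k IH; rewrite addr_ge0 // mulr_ge0. Qed.

(** Induction on the dimension: the dual inequality in the quotient by [b] is applied to every pair
    of level sets, and [transport_total] integrates over the levels. *)
Lemma bm_step (m : nat) (G : zmodType) (b : G) (bs : seq G) (X Y : {fset G}) :
  (0 < m)%N -> zfree (b :: bs) -> X != fset0 -> Y != fset0 ->
  (forall X' Y' : {fset (Quotient.quot (zline b))}, X' != fset0 -> Y' != fset0 ->
     bm_dual (size bs) #|` X'|%:R #|` Y'|%:R (#|` X' +s Y'|%:R +
       bmC (size bs) / m%:R * #|` X' +s Y' +s box (map \pi_(Quotient.quot (zline b)) bs) m|%:R)) ->
  bm (size bs).+1 #|` X|%:R #|` Y|%:R (#|` X +s Y|%:R +
       bmC (size bs).+1 / m%:R * #|` X +s Y +s box (b :: bs) m|%:R).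
Proof.
move=> m0 fr X0 Y0 IH x y x0 y0 hx hy.
have binf := zfree_head fr.
set k := size bs in IH hx hy *; set S := X +s Y; set e := bmC k / m%:R.
have e0 : 0 <= e by rewrite divr_ge0 ?bmC_ge0.
pose mx (Z : {fset G}) := (\max_(t <- shad b Z) #|` fib b Z t|)%N.
have mxP Z t : (#|` fib b Z t| <= mx Z)%N.
  have [tZ|] := boolP (t \in lev b Z 0); last by rewrite mem_lev -leqNgt leqn0 => /eqP->.
  apply: (leq_bigmax_seq (F := fun t => #|` fib b Z t|)) => //.
  by move: tZ; rewrite !inE => /andP[].
have levN0 Z i : (i < mx Z)%N -> lev b Z i != fset0.
  move=> iZ; apply/fset0Pn; apply: contrapT => none.
  suff : (mx Z <= i)%N by rewrite leqNgt iZ.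
  apply/bigmax_leqP_seq => t _ _; rewrite leqNgt -mem_lev; apply/negP=> h.
  by apply: none; exists t.
have mx0 Z : Z != fset0 -> (0 < mx Z)%N.
  case/fset0Pn=> z zZ; apply: leq_trans (mxP Z (\pi z)).
  by rewrite cardfs_gt0; apply/fset0Pn; exists z; rewrite mem_fib zZ eqxx.
pose SB := S +s box bs m.
(* By [lev_sum] and [lev_shift] this dominates the lower-dimensional estimate for all pairs of
   levels whose indices add to [i], box included. *)
pose c i : R := #|` lev b S i|%:R + e * #|` lev b SB i|%:R.
have sumR Z n : (mx Z <= n)%N -> \sum_(0 <= i < n) (#|` lev b Z i|%:R : R) = #|` Z|%:R.
  by move=> Zn; rewrite -natr_sum sum_lev // => t; apply: leq_trans (mxP Z t) Zn.
have sumle Z n : \sum_(0 <= i < n) (#|` lev b Z i|%:R : R) <= #|` Z|%:R.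
  rewrite -(sumR Z (maxn n (mx Z))) ?leq_maxr //.
  by rewrite (big_cat_nat (leq0n n) (leq_maxl n _)) /= lerDl sumr_ge0.
have levle Z i : (#|` lev b Z i| <= #|` Z|)%N.
  have := sumle Z i.+1; rewrite big_nat_recr //= -(ler_nat R); apply: le_trans.
  by rewrite lerDr sumr_ge0.
have : (x + y) ^+ k.+1 <= \sum_(0 <= i < (mx X + mx Y).-1) c i + c 0%N.
  apply: (@transport_total R _ #|` X|%:R #|` Y|%:R (mx X) (mx Y)
      (fun i => #|` lev b X i|%:R) (fun i => #|` lev b Y i|%:R)) => //.
  - exact: mx0.
  - exact: mx0.
  - by move=> i iX; rewrite ltr0n cardfs_gt0 levN0.
  - by move=> i iX; rewrite ltr0n cardfs_gt0 levN0.
  - by move=> i; rewrite lerD ?ler_wpM2l // ler_nat fsubset_leq_card // lev_decr.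
  - by move=> i; rewrite addr_ge0 // mulr_ge0.
  - exact: sumR.
  - exact: sumR.
  move=> i j iX jY; have := IH _ _ (levN0 _ _ iX) (levN0 _ _ jY) x y x0 y0.
  set a := #|` lev b X i|%:R; set a' := #|` lev b Y j|%:R; set c' := _ + _ * _.
  have a0 : 0 < a by rewrite ltr0n cardfs_gt0 levN0.
  have a'0 : 0 < a' by rewrite ltr0n cardfs_gt0 levN0.
  move/le_trans; apply; apply: ler_pM.
  - by rewrite addr_ge0 // mulr_ge0.
  - by rewrite addr_ge0 // divr_ge0 ?exprn_ge0 // ltW.
  - have s1 := lev_sum binf X Y i j.
    apply: lerD; first by rewrite ler_nat fsubset_leq_card.
    rewrite ler_wpM2l // ler_nat fsubset_leq_card //.
    have s2 := lev_shift b S (box bs m) (i + j).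
    by apply: fsubset_trans s2; rewrite shad_box sumfsS.
  - by rewrite lerD // ler_wpM2r // invr_ge0 ltW.
move/le_trans; apply.
have m0' : 0 < m%:R :> R by rewrite ltr0n.
pose V : R := #|` S +s box (b :: bs) m|%:R.
have sSB : SB `<=` S +s box (b :: bs) m.
  apply: sumfsS => //=; apply/fsubsetP=> z zb; rewrite -[z]add0r mem_sumfs //.
  by rewrite -(mulr0n b) mem_ap.
have h1 : #|` lev b S 0|%:R <= V / m%:R.
  rewrite ler_pdivlMr // -natrM ler_nat mulnC; apply: leq_trans (card_shad_ap binf S m) _.
  apply/fsubset_leq_card/sumfsS => //=; apply/fsubsetP=> z zb.
  by rewrite -[z]addr0 mem_sumfs // box0.
have h2 : #|` SB|%:R <= V by rewrite ler_nat fsubset_leq_card.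
have h3 : #|` lev b SB 0|%:R <= V by apply: le_trans h2; rewrite ler_nat.
rewrite /c big_split /= -mulr_sumr.
have := sumle S (mx X + mx Y).-1; have := sumle SB (mx X + mx Y).-1.
set s1 := \sum_(_ <= _ < _) _; set s2 := \sum_(_ <= _ < _) _ => l1 l2.
rewrite -/k -/V.
have -> : (2 * bmC k + 1) / m%:R * V = V / m%:R + e * V + e * V by rewrite /e; ring.
have : e * s1 <= e * V by rewrite ler_wpM2l // (le_trans l1).
have : e * #|` lev b SB 0|%:R <= e * V by rewrite ler_wpM2l.
move: h1 l2; lra.
Qed.

Lemma bm_dual_box (m : nat) k : (0 < m)%N ->
  forall (G : zmodType) (bs : seq G) (X Y : {fset G}), size bs = k ->
  zfree bs -> X != fset0 -> Y != fset0 ->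
  bm_dual k #|` X|%:R #|` Y|%:R (#|` X +s Y|%:R + bmC k / m%:R * #|` X +s Y +s box bs m|%:R).
Proof.
move=> m0; elim: k => [|k IH] G bs X Y.
  move=> /size0nil-> _ X0 Y0 P Q P0 Q0; rewrite !expr1 mul0r mul0r addr0 mulrDr.
  have [x xX] := fset0Pn _ X0; have [y yY] := fset0Pn _ Y0.
  apply: lerD; rewrite mulrCA ler_peMr // ler_pdivlMr ?ltr0n ?cardfs_gt0 // mul1r ler_nat.
    exact: card_sumfs_gel yY.
  by rewrite sumfsC; apply: card_sumfs_gel xX.
case: bs => [|b bs] //= [sz] fr X0 Y0.
apply: bm_dual_of_bm; rewrite ?ltr0n ?cardfs_gt0 //.
rewrite -sz; apply: bm_step => // X' Y' X'0 Y'0; rewrite sz; apply: IH => //.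
  by rewrite size_map.
exact: zfree_quot.
Qed.

Theorem brunn_minkowski_box (m : nat) (G : zmodType) (bs : seq G) (X Y : {fset G}) :
  (0 < m)%N -> (0 < size bs)%N -> zfree bs -> X != fset0 -> Y != fset0 ->
  bm (size bs) #|` X|%:R #|` Y|%:R
    (#|` X +s Y|%:R + bmC (size bs) / m%:R * #|` X +s Y +s box bs m|%:R).
Proof.
move=> m0; case: bs => [|b bs] // _ fr X0 Y0.
apply: bm_step => // X' Y' X'0 Y'0; apply: bm_dual_box => //; first by rewrite size_map.
exact: zfree_quot.
Qed.

End BrunnMinkowski.

(** * The tower of subgroups *)

Section Reps.
Variable V : zmodType.
Implicit Types (U W : zmodClosed V) (rs ss : seq V) (A : {fset V}).

Definition reps (U W : {pred V}) rs :=
  [/\ uniq rs, {subset rs <= U}, (forall x, x \in U -> exists2 r, r \in rs & x - r \in W) &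
      forall r r', r \in rs -> r' \in rs -> r - r' \in W -> r = r'].

Lemma reps_tower U W W' rs ss : {subset W <= U} -> {subset W' <= W} ->
  reps U W rs -> reps W W' ss -> reps U W' [seq r + s | r <- rs, s <- ss].
Proof.
move=> WU W'W [ur rU rc ri] [us sW sc si].
have inj r r' s s' : r \in rs -> r' \in rs -> s \in ss -> s' \in ss ->
    (r + s) - (r' + s') \in W' -> r = r' /\ s = s'.
  move=> rr rr' s1 s2 h; have er : r = r'.
    apply: ri => //; have -> : r - r' = ((r + s) - (r' + s')) + (s' - s).
      by rewrite opprD [r + s + _]addrACA -[_ + (s - s') + _]addrA subrKA subrr addr0.
    by apply: rpredD; [apply: W'W | apply: rpredB; apply: sW].
  by split=> //; apply: si => //; move: h; rewrite er opprD addrACA subrr add0r.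
split.
- apply: allpairs_uniq => // -[r s] [r' s'] /allpairsP[[a b] [/= ar bs [-> ->]]].
  move=> /allpairsP[[a' b'] [/= ar' bs' [-> ->]]] /= E.
  by have [] := inj a a' b b' ar ar' bs bs'; rewrite ?E ?subrr ?rpred0 // => -> ->.
- move=> x /allpairsP[[r s] /= [rr ss' ->]].
  by apply: rpredD; [apply: rU | apply/WU/sW].
- move=> x /rc[r rr xr]; have [s s1 h] := sc _ xr; exists (r + s).
    by apply/allpairsP; exists (r, s).
  by rewrite opprD addrA.
- move=> x y /allpairsP[[r s] /= [rr s1 ->]] /allpairsP[[r' s'] /= [rr' s1' ->]].
  by case/inj => // -> ->.
Qed.

Lemma reps_shift U W rs z : z \in U -> reps U W rs -> reps U W [seq r + z | r <- rs].
Proof.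
move=> zU [ur rU rc ri]; split.
- by rewrite map_inj_uniq //; apply: addIr.
- by move=> _ /mapP[r rr ->]; apply: rpredD => //; apply: rU.
- move=> x xU; have [|r rr h] := rc (x - z); first by rewrite rpredB.
  by exists (r + z); [apply: map_f | rewrite opprD [- r + _]addrC addrA].
- move=> _ _ /mapP[r rr ->] /mapP[r' rr' ->]; rewrite opprD addrACA subrr addr0.
  by move/ri->.
Qed.

Definition cl (W : {pred V}) A x := [fset a in A | a - x \in W].

Lemma mem_cl (W : {pred V}) A x a : (a \in cl W A x) = (a \in A) && (a - x \in W).
Proof. by rewrite !inE. Qed.

Lemma cl_sub (W : {pred V}) A x : cl W A x `<=` A.
Proof. by apply/fsubsetP=> a; rewrite mem_cl => /andP[]. Qed.

Lemma cl_eq W A x y : x - y \in W -> cl W A x = cl W A y.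
Proof.
move=> xy; apply/fsetP=> a; rewrite !mem_cl; congr (_ && _).
by rewrite -[a - y](subrKA x) (rpredDr _ xy).
Qed.

Lemma card_cl_reps W W' rs A x : {subset W' <= W} -> reps W W' rs ->
  (#|` cl W A x| = \sum_(r <- rs) #|` cl W' A (x + r)|)%N.
Proof.
move=> W'W [ur rW rc ri]; apply/eqP; rewrite eqn_leq card_cover_le => [|a] /=; last first.
  rewrite mem_cl => /andP[aA /rc[r rr h]]; exists r => //.
  by rewrite mem_cl aA opprD addrA.
apply: card_disjoint_le => // [r rr|r r' a rr rr'].
  apply/fsubsetP=> a; rewrite !mem_cl => /andP[-> h] /=.
  have -> : a - x = (a - (x + r)) + r by rewrite opprD addrA subrK.
  by apply: rpredD; [apply: W'W | apply: rW].
rewrite !mem_cl => /andP[_ h1] /andP[_ h2]; apply: ri => //.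
have -> : r - r' = (a - (x + r')) - (a - (x + r)).
  by rewrite opprB [RHS]addrC addrA subrK opprD [RHS]addrACA subrr add0r.
by rewrite rpredB.
Qed.

Lemma class_reps W A : exists cs : seq V, [/\ uniq cs, {subset cs <= A},
  (forall a, a \in A -> exists2 c, c \in cs & a - c \in W) &
  forall c c', c \in cs -> c' \in cs -> c - c' \in W -> c = c'].
Proof.
elim/finSet_rect: A => A IH; have [->|/fset0Pn[a aA]] := eqVneq A fset0.
  by exists [::]; split=> // a; rewrite inE.
have [cs [uc cA cc ci]] := IH _ (fproperD1 aA).
have cA' : {subset cs <= A} by move=> c /cA; rewrite inE => /andP[].
have [/hasP[c ccs ac]|/hasPn nc] := boolP (has (fun c => a - c \in W) cs).
  exists cs; split=> // b bA; have [->|ba] := eqVneq b a; first by exists c.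
  by apply: cc; rewrite !inE ba.
exists (a :: cs); split=> [|c|b bA|c c'].
- rewrite /= uc andbT; apply/negP=> /nc; by rewrite subrr rpred0.
- by rewrite inE => /orP[/eqP->|/cA'].
- have [->|ba] := eqVneq b a; first by exists a; rewrite ?mem_head // subrr rpred0.
  by have [|c ccs h] := cc b; rewrite ?inE ?ba //; exists c => //; rewrite inE ccs orbT.
- rewrite !inE => /orP[/eqP->|cc1] /orP[/eqP->|cc2] //.
  + by move=> h; have := nc _ cc2; rewrite h.
  + by rewrite -opprB rpredN => h; have := nc _ cc1; rewrite h.
  + exact: ci.
Qed.

End Reps.

Section Half.
Variables (V : zmodType) (T T' Rr : {additive V -> V}).
Hypotheses (TK : cancel T T') (TK' : cancel T' T).
Hypotheses (R1 : forall x, Rr (x + T x) = x) (R2 : forall x, Rr x + T (Rr x) = x).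

Lemma RT x : Rr (T x) = T (Rr x).
Proof. by rewrite -[RHS]R1 -raddfD R2. Qed.

Lemma RT' x : Rr (T' x) = T' (Rr x).
Proof. by apply: (can_inj TK); rewrite -RT !TK'. Qed.

Lemma iterB (f : {additive V -> V}) n x y : iter n f (x - y) = iter n f x - iter n f y.
Proof. by elim: n => //= n ->; rewrite raddfB. Qed.

Lemma iter_add0 (f : {additive V -> V}) n : iter n f 0 = 0.
Proof. by elim: n => //= n ->; rewrite raddf0. Qed.

Lemma iter_comm (f g : V -> V) n x : (forall x, f (g x) = g (f x)) ->
  iter n f (g x) = g (iter n f x).
Proof. by move=> fg; elim: n => //= n ->. Qed.

Lemma iter_commn (f g : V -> V) n m x : (forall x, f (g x) = g (f x)) ->
  iter n f (iter m g x) = iter m g (iter n f x).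
Proof. by move=> fg; elim: m => //= m <-; rewrite iter_comm. Qed.

Lemma iter_can (f g : V -> V) n : cancel f g -> cancel (iter n f) (iter n g).
Proof. by move=> fK; elim: n => // n IH x; rewrite iterSr iterS fK IH. Qed.

(* T^i K meet T'^j K', as T and T' are mutually inverse. *)
Definition twr (K K' : {pred V}) i j : {pred V} :=
  [pred x | (iter i T' x \in K) && (iter j T x \in K')].

Variables (K K' : zmodClosed V).

Lemma twr_closed i j : zmod_closed (twr K K' i j).
Proof.
split; first by rewrite inE !iter_add0 !rpred0.
by move=> x y; rewrite !inE => /andP[h1 h2] /andP[h3 h4]; rewrite !iterB !rpredB.
Qed.
HB.instance Definition _ i j := GRing.isZmodClosed.Build V (twr K K' i j) (twr_closed i j).

Hypotheses (KT : forall x, x \in K -> T x \in K) (KR : forall x, x \in K -> Rr x \in K).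
Hypotheses (KT' : forall x, x \in K' -> T' x \in K') (KR' : forall x, x \in K' -> T (Rr x) \in K').

Lemma twr_S1 i j : {subset twr K K' i.+1 j <= twr K K' i j}.
Proof. by move=> x; rewrite !inE /= => /andP[/KT + ->]; rewrite TK' => ->. Qed.

Lemma twr_S2 i j : {subset twr K K' i j.+1 <= twr K K' i j}.
Proof. by move=> x; rewrite !inE /= => /andP[-> /KT']; rewrite TK => ->. Qed.

Lemma twr_sub i j a b : {subset twr K K' (a + i) (b + j) <= twr K K' i j}.
Proof.
elim: a => [|a IH x]; last by rewrite addSn => /twr_S1/IH.
by elim: b => [|b IH x]; rewrite ?addSn // => /twr_S2/IH.
Qed.

Lemma twr_T i j x : x \in twr K K' i j.+1 -> T x \in twr K K' i.+1 j.
Proof. by rewrite !inE (iterSr i) TK -iterSr => /andP[-> ->]. Qed.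

Lemma twr_T' i j x : x \in twr K K' i.+1 j -> T' x \in twr K K' i j.+1.
Proof. by rewrite !inE (iterSr i) (iterSr j) TK' => /andP[-> ->]. Qed.

(** T^(j+1) (Rr x) = T (Rr (T^j x)), and T Rr preserves K'. Together with [twr_TR], the identity x =
    Rr x + T (Rr x) writes U(i,j) as U(i,j+1) + U(i+1,j). *)
Lemma twr_R i j x : x \in twr K K' i j -> Rr x \in twr K K' i j.+1.
Proof.
rewrite !inE => /andP[h1 h2].
rewrite iter_comm; last by move=> y; rewrite RT'.
by rewrite KR //= iter_comm ?KR' // => y; rewrite RT.
Qed.

Lemma twr_TR i j x : x \in twr K K' i j -> T (Rr x) \in twr K K' i.+1 j.
Proof. by move/twr_R/twr_T. Qed.

Variable ras : seq V.
Hypotheses (ras_uniq : uniq ras) (rasK : {subset ras <= K}) (rasK' : {subset ras <= K'}).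
Hypothesis ras_cov : forall x, x \in K -> exists2 r, r \in ras & T' (x - r) \in K.
Hypothesis ras_inj : forall r r', r \in ras -> r' \in ras -> T' (r - r') \in K -> r = r'.

(** [Rr] is the identity on K / T K, because x - Rr x = T (Rr x). *)
Lemma R_iter_near n x : x \in K -> T' (x - iter n Rr x) \in K.
Proof.
move=> xK; elim: n => [|n IH]; first by rewrite subrr raddf0 rpred0.
have hn : iter n Rr x \in K by elim: n {IH} => //= n; apply: KR.
rewrite -[x - _](subrKA (iter n Rr x)) raddfD rpredD //=.
by rewrite -{1}[iter n Rr x]R2 addrAC subrr add0r TK KR.
Qed.

(** T'^i maps T^i Rr^(i+j) r to Rr^(i+j) r, which is r modulo T K, so the classes are those of
    [ras]. The power of [Rr] serves the other side: T^j maps the same element to (T Rr)^(i+j) r,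
    which is in K'. Hence the index is the same for all i and j. *)
Lemma reps_half i j :
  reps (twr K K' i j) (twr K K' i.+1 j) [seq iter i T (iter (i + j) Rr r) | r <- ras].
Proof.
pose g r := iter i T (iter (i + j) Rr r).
have TRc m n x : iter m T (iter n Rr x) = iter n Rr (iter m T x).
  by rewrite iter_commn // => y; rewrite RT.
have gK r : iter i T' (g r) = iter (i + j) Rr r by rewrite /g iter_can.
have gU r : r \in ras -> g r \in twr K K' i j.
  move=> rr; rewrite inE gK; apply/andP; split.
    by have := rasK rr; elim: (i + j)%N => //= n IH /IH; apply: KR.
  rewrite /g -iterD addnC; have := rasK' rr.
  elim: (i + j)%N => //= n IH /IH h.
  by rewrite (_ : iter n T (Rr (iter n Rr r)) = Rr (iter n T (iter n Rr r))) ?KR' //; exact: (TRc n 1).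
have near x r : x \in K -> r \in ras -> (T' (x - iter (i + j) Rr r) \in K) = (T' (x - r) \in K).
  move=> xK rr; rewrite -[x - iter _ _ _](subrKA r) raddfD rpredDr //.
  exact/R_iter_near/rasK.
have gS x r : (x - g r \in twr K K' i.+1 j) = (T' (iter i T' x - iter (i + j) Rr r) \in K)
     && (iter j T (x - g r) \in K').
  by rewrite inE /= iterB gK.
split.
- rewrite map_inj_in_uniq // => r r' rr rr' E.
  apply: ras_inj => //; rewrite -(near _ _ (rasK rr) rr').
  have <- : iter (i + j) Rr r = iter (i + j) Rr r' by rewrite -gK -[RHS]gK /g E.
  by apply/R_iter_near/rasK.
- by move=> _ /mapP[r rr ->]; apply: gU.
- move=> x xU; have := xU; rewrite inE => /andP[/[dup] xK /ras_cov[r rr h] xK'].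
  exists (g r); first exact: map_f.
  rewrite gS near // h /= iterB rpredB //.
  by have := gU _ rr; rewrite inE => /andP[].
- move=> _ _ /mapP[r rr ->] /mapP[r' rr' ->]; rewrite gS gK => /andP[h _].
  congr g; apply: ras_inj => //; set a := iter (i + j) Rr r in h.
  have aK : a \in K by rewrite /a -gK; have := gU _ rr; rewrite inE => /andP[].
  rewrite -[r - r'](subrKA a) raddfD rpredD //; first exact/R_iter_near/rasK.
  by rewrite -(near _ _ aK rr').
Qed.

End Half.

Section Tower.
Variables (V : zmodType) (T T' Rr : {additive V -> V}) (K K' : zmodClosed V) (ras rbs : seq V).

(* Rr is the inverse of 1 + T; ras and rbs represent K / T K and K' / T' K'. *)
Record tower_axiom : Prop := TowerAxiom {
  tw_TK : cancel T T'; tw_TK' : cancel T' T;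
  tw_R1 : forall x, Rr (x + T x) = x; tw_R2 : forall x, Rr x + T (Rr x) = x;
  tw_KT : forall x, x \in K -> T x \in K; tw_KR : forall x, x \in K -> Rr x \in K;
  tw_KT' : forall x, x \in K' -> T' x \in K'; tw_KR' : forall x, x \in K' -> T (Rr x) \in K';
  tw_ras : [/\ uniq ras, {subset ras <= K}, {subset ras <= K'},
     (forall x, x \in K -> exists2 r, r \in ras & T' (x - r) \in K) &
     forall r r', r \in ras -> r' \in ras -> T' (r - r') \in K -> r = r'];
  tw_rbs : [/\ uniq rbs, {subset rbs <= K}, {subset rbs <= K'},
     (forall x, x \in K' -> exists2 r, r \in rbs & T (x - r) \in K') &
     forall r r', r \in rbs -> r' \in rbs -> T (r - r') \in K' -> r = r'] }.

Hypothesis tw : tower_axiom.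
Local Notation U := (twr T T' K K').
Let p := size ras.
Let q := size rbs.

Lemma repsA_digits i j :
  reps (U i j) (U i.+1 j) [seq iter i T (iter (i + j) Rr r) | r <- ras].
Proof.
case: tw => a1 a2 a3 a4 a5 a6 a7 a8 [b1 b2 b3 b4 b5] _.
exact: (@reps_half _ _ _ _ a1 a3 a4 K K' a6 a8 ras b1 b2 b3 b4 b5).
Qed.

Lemma repsA i j : exists2 rs, size rs = p & reps (U i j) (U i.+1 j) rs.
Proof. by eexists; last exact: repsA_digits; rewrite size_map. Qed.

Lemma twr_swap i j x : (x \in U i j) = (x \in twr T' T K' K j i).
Proof. by rewrite !inE andbC. Qed.

(** The mirror image of [repsA_digits]: exchanging T with T' and K with K' replaces [Rr] by T Rr,
    the inverse of 1 + T'. *)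
Lemma repsB_digits i j :
  reps (U i j) (U i j.+1) [seq iter j T' (iter (j + i) (T \o Rr) r) | r <- rbs].
Proof.
case: tw => a1 a2 a3 a4 a5 a6 a7 a8 _ [b1 b2 b3 b4 b5].
pose R' : {additive V -> V} := T \o Rr.
have r1 x : R' (x + T' x) = x.
  rewrite /R' /= -(RT a3 a4) raddfD /= a2 addrC; exact: a3.
have r2 x : R' x + T' (R' x) = x by rewrite /R' /= a1 addrC a4.
have kr x : x \in K -> T' (R' x) \in K by rewrite /R' /= a1; apply: a6.
have [c1 c2 c3 c4] := @reps_half _ _ _ R' a2 r1 r2 K' K a8 kr rbs b1 b3 b2 b4 b5 j i.
split=> // [x /c2|x|r r' r_in r'_in]; first by rewrite twr_swap.
  by rewrite twr_swap => /c3[r rr h]; exists r; rewrite ?twr_swap.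
by rewrite twr_swap; apply: c4.
Qed.

Lemma repsB i j : exists2 rs, size rs = q & reps (U i j) (U i j.+1) rs.
Proof. by eexists; last exact: repsB_digits; rewrite size_map. Qed.

Lemma twrS a b i j : {subset U (a + i) (b + j) <= U i j}.
Proof. by case: tw => a1 a2 a3 a4 a5 a6 a7 a8 _ _; apply: twr_sub. Qed.

Lemma repsAB a b i j : exists2 rs, size rs = (p ^ a * q ^ b)%N & reps (U i j) (U (a + i) (b + j)) rs.
Proof.
elim: a => [|a [rs sz hr]].
  elim: b => [|b [rs sz hr]].
    exists [:: 0] => //; split=> //; first by move=> x; rewrite inE => /eqP->; rewrite rpred0.
      by move=> x xU; exists 0; rewrite ?mem_head // subr0.
    by move=> r r'; rewrite !inE => /eqP-> /eqP->.
  have [ss sz' hs] := repsB i (b + j); exists [seq r + s | r <- rs, s <- ss].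
    by rewrite size_allpairs sz sz' expnSr mulnA.
  by apply: reps_tower hr hs; [exact: (@twrS 0 b i j) | exact: (@twrS 0 1 i (b + j))].
have [ss sz' hs] := repsA (a + i) (b + j); exists [seq r + s | r <- rs, s <- ss].
  by rewrite size_allpairs sz sz' expnSr mulnAC.
by apply: reps_tower hr hs; [exact: (@twrS a b i j) | exact: (@twrS 1 0 (a + i) (b + j))].
Qed.

Definition tim (A : {fset V}) : {fset V} := [fset T a | a in A].
Definition Sset (A : {fset V}) := A +s tim A.

Lemma mem_tim A a : a \in A -> T a \in tim A.
Proof. by move=> aA; apply/imfsetP; exists a. Qed.

Lemma timP A x : reflect (exists2 a, a \in A & x = T a) (x \in tim A).
Proof. by apply: (iffP (imfsetP _ _ _ _)) => -[a aA ->]; exists a. Qed.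

(** The sumset over the class of c lies in c + T c + U(i,j). As [Rr] inverts 1 + T and maps U(i,j)
    into U(i,j+1), the point z determines the class of c. *)
Lemma Sset_disjoint i j A B c c' z :
  (forall b, b \in B -> b \in U i j.+1) ->
  z \in Sset (cl (U i j.+1) A c) +s B -> z \in Sset (cl (U i j.+1) A c') +s B ->
  c - c' \in U i j.+1.
Proof.
case: tw => a1 a2 a3 a4 a5 a6 a7 a8 _ _ BU.
have key e : z \in Sset (cl (U i j.+1) A e) +s B -> z - (e + T e) \in U i j.
  case/sumfsP=> _ [b [/sumfsP[x [_ [xA /timP[y yA ->] ->]]] /BU bU ->]].
  move: xA yA; rewrite !mem_cl => /andP[_ xe] /andP[_ ye].
  have -> : x + T y + b - (e + T e) = (x - e) + T (y - e) + b.
    by rewrite addrAC opprD addrACA raddfB.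
  apply: rpredD; last exact: (@twrS 0 1 i j).
  apply: rpredD; first exact: (@twrS 0 1 i j).
  by apply: (@twrS 1 0 i j); apply: twr_T.
move=> /key h1 /key h2.
have : Rr ((z - (c' + T c')) - (z - (c + T c))) \in U i j.+1.
  by apply: twr_R => //; apply: rpredB.
rewrite opprB addrC addrA subrK opprD addrACA -raddfB a3 //.
Qed.

Lemma Sset_superadd i j (A : {fset V}) (B : {fset V}) cs : uniq cs ->
  (forall c c', c \in cs -> c' \in cs -> c - c' \in U i j.+1 -> c = c') ->
  (forall b, b \in B -> b \in U i j.+1) ->
  (\sum_(c <- cs) #|` Sset (cl (U i j.+1) A c) +s B| <= #|` Sset A +s B|)%N.
Proof.
move=> ucs ics BU; apply: card_disjoint_le => // [c _|c c' z cc cc' h1 h2].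
  apply: sumfsS => //; apply: sumfsS; first exact: cl_sub.
  apply/fsubsetP=> _ /timP[a aA ->]; apply: mem_tim; exact: (fsubsetP (cl_sub _ _ _)) aA.
by apply: ics => //; apply: Sset_disjoint h1 h2.
Qed.

End Tower.

(** * Evenly distributed sets *)

Section LeafNumeric.
Variable R : realType.

Lemma exprn_tangent (w e : R) n : 0 <= w -> 0 <= w + e ->
  w ^+ n.+1 + n.+1%:R * w ^+ n * e <= (w + e) ^+ n.+1.
Proof.
move=> w0 we0; elim: n => [|n IH]; first by rewrite expr0 mulr1 mul1r !expr1.
rewrite [X in _ <= X]exprS; apply: le_trans (ler_wpM2l we0 IH).
rewrite -subr_ge0.
have -> : (w + e) * (w ^+ n.+1 + n.+1%:R * w ^+ n * e) -
  (w ^+ n.+2 + n.+2%:R * w ^+ n.+1 * e) = n.+1%:R * w ^+ n * e ^+ 2.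
  by rewrite !exprS -[n.+2%:R]natr1; ring.
by rewrite mulr_ge0 ?sqr_ge0 // mulr_ge0 ?exprn_ge0.
Qed.

(** A lower bound for a root of 1 + s. With z = e / (n+1) and 1 - e = 1 / (1 + s), Bernoulli's
    inequality gives (1 - z)^(n+1) >= 1 / (1 + s), while (1 + z)(1 - z) <= 1. *)
Lemma root_lower (s : R) n : -(1/2) <= s ->
  0 <= 1 + s / (1 + s) / n.+1%:R /\ (1 + s / (1 + s) / n.+1%:R) ^+ n.+1 <= 1 + s.
Proof.
move=> hs; have s1 : 0 < 1 + s by lra.
have n1 : 1 <= n.+1%:R :> R by rewrite ler1n.
have n0 : 0 < n.+1%:R :> R by rewrite ltr0n.
set e := s / (1 + s).
have e1 : 1 - e = (1 + s)^-1 by rewrite /e; field; rewrite gt_eqF.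
have e2 : e < 1 by rewrite /e ltr_pdivrMr //; lra.
have e3 : -1 <= e by rewrite /e ler_pdivlMr //; lra.
set z := e / n.+1%:R.
have z1 : z <= 1 by rewrite /z ler_pdivrMr //; lra.
have z2 : -1 <= z by rewrite /z ler_pdivlMr //; lra.
have z0 : 0 <= 1 + z by lra.
split=> //; have := @exprn_tangent 1 (- z) n ler01.
rewrite subr_ge0 => /(_ z1); rewrite !expr1n mulr1 mulrN /z.
rewrite [n.+1%:R * _]mulrC divfK ?gt_eqF // e1 -/z => h.
have : (1 + z) ^+ n.+1 * (1 - z) ^+ n.+1 <= 1.
  rewrite -exprMn; have -> : (1 + z) * (1 - z) = 1 - z ^+ 2 by ring.
  rewrite exprn_ile1 //; last by rewrite gerBl sqr_ge0.
  by move: z1 z2; rewrite expr2; clear; nra.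
have := ler_wpM2l (exprn_ge0 n.+1 z0) h.
move=> h1 /(le_trans h1); by rewrite ler_pdivrMr // mul1r.
Qed.

(** Brunn-Minkowski for classes with relative densities 1 + s and 1 + t, expanded at s = t = 0 with
    exact linear term. The factor 2 bounds u - u / (1 + u) = u^2 / (1 + u) when u >= -1/2. *)
Lemma leaf_point (fr gr s t c : R) n : 0 <= fr -> 0 <= gr ->
  -(1/2) <= s -> -(1/2) <= t ->
  bm n.+1 (fr ^+ n.+1 * (1 + s)) (gr ^+ n.+1 * (1 + t)) c ->
  (fr + gr) ^+ n.+1 + (fr + gr) ^+ n * (fr * (s - 2 * s ^+ 2) + gr * (t - 2 * t ^+ 2)) <= c.
Proof.
move=> f0 g0 hs ht h.
have [x0 xs] := root_lower n hs; have [y0 yt] := root_lower n ht.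
have n0 : 0 < n.+1%:R :> R by rewrite ltr0n.
have ee (u : R) : -(1/2) <= u -> u - 2 * u ^+ 2 <= u / (1 + u).
  move=> hu; rewrite ler_pdivlMr; last by lra.
  rewrite -subr_ge0; have -> : u - (u - 2 * u ^+ 2) * (1 + u) = u ^+ 2 * (1 + 2 * u) by ring.
  by rewrite mulr_ge0 ?sqr_ge0 //; lra.
have := ee _ hs; have := ee _ ht.
move: x0 xs y0 yt; set es := s / (1 + s); set et := t / (1 + t) => x0 xs y0 yt h2 h1.
have := h (fr * (1 + es / n.+1%:R)) (gr * (1 + et / n.+1%:R)).
rewrite !mulr_ge0 // => /(_ isT isT); rewrite !exprMn !ler_wpM2l ?exprn_ge0 // => /(_ isT isT).
apply: le_trans.
have -> : fr * (1 + es / n.+1%:R) + gr * (1 + et / n.+1%:R) =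
  (fr + gr) + (fr * es + gr * et) / n.+1%:R by ring.
have fg0 : 0 <= fr + gr by rewrite addr_ge0.
apply: le_trans (exprn_tangent n fg0 _); last first.
  have -> : (fr + gr) + (fr * es + gr * et) / n.+1%:R =
     fr * (1 + es / n.+1%:R) + gr * (1 + et / n.+1%:R) by ring.
  by rewrite addr_ge0 // mulr_ge0.
have -> : n.+1%:R * (fr + gr) ^+ n * ((fr * es + gr * et) / n.+1%:R) =
  (fr + gr) ^+ n * (fr * es + gr * et).
  by rewrite mulrC mulrA divfK ?gt_eqF // mulrC.
rewrite lerD2l.
by rewrite ler_wpM2l ?exprn_ge0 // lerD // ler_wpM2l.
Qed.
End LeafNumeric.

Lemma addrB_shift (V : zmodType) (x y u v l : V) :
  x + y - (u + v) = (x - (u + l)) + (y - (v - l)).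
Proof. by rewrite [RHS]addrACA -[- (u + l) - (v - l)]opprD [u + l + _]addrACA subrr addr0. Qed.

(** * The balanced case: best pairs of classes *)

Section Leaf.
Variables (V : zmodType) (T T' Rr : {additive V -> V}) (K K' : zmodClosed V) (ras rbs : seq V).
Hypothesis tw : tower_axiom T T' Rr K K' ras rbs.
Local Notation U := (twr T T' K K').
Variable R : realType.
Let p : R := (size ras)%:R.
Let q : R := (size rbs)%:R.

Lemma size_ras_gt0 : (0 < size ras)%N.
Proof.
case: tw => _ _ _ _ _ _ _ _ [_ _ _ cov _] _.
by have [r] := cov 0 (rpred0 _); case: ras.
Qed.

Lemma size_rbs_gt0 : (0 < size rbs)%N.
Proof.
case: tw => _ _ _ _ _ _ _ _ _ [_ _ _ cov _].
by have [r] := cov 0 (rpred0 _); case: rbs.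
Qed.

Let p1 : 1 <= p. Proof. by rewrite ler1n size_ras_gt0. Qed.
Let q1 : 1 <= q. Proof. by rewrite ler1n size_rbs_gt0. Qed.
Let p0 : 0 < p. Proof. exact: lt_le_trans p1. Qed.
Let q0 : 0 < q. Proof. exact: lt_le_trans q1. Qed.

Variable (n : nat) (A B : {fset V}) (c ep : R) (d : nat).
Hypothesis AU : forall a, a \in A -> a \in U n.+1 n.+1.
Hypothesis A0 : A != fset0.
Hypothesis BU : forall b, b \in B -> b \in U n.+3 n.+3.
Hypothesis ep0 : 0 <= ep.
Let a : R := #|` A|%:R.
Let a0 : 0 < a. Proof. by rewrite ltr0n cardfs_gt0. Qed.
Hypothesis bal : forall x, x \in U n.+1 n.+1 ->
  `| #|` cl (U n.+3 n.+3) A x|%:R * (p * q) ^+ 2 - a | <= c * a.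
Hypothesis BMh : forall X Y : {fset V}, X != fset0 -> Y != fset0 ->
  bm d.+1 #|` X|%:R #|` Y|%:R (#|` X +s Y|%:R + ep * #|` X +s Y +s B|%:R : R).
Hypothesis c_small : c * (8 * (p * q) ^+ 3 * (2 + p + q)) = 1.

Local Notation U0 := (U n.+1 n.+1).
Local Notation Ua := (U n.+2 n.+1).
Local Notation Ub := (U n.+1 n.+2).
Local Notation U1 := (U n.+2 n.+2).
Local Notation W1 := (U n.+3 n.+2).
Local Notation W2 := (U n.+2 n.+3).
Local Notation Up := (U n.+3 n.+3).

Lemma leaf_cl_bound (W : zmodClosed V) rs x : {subset W <= U0} -> {subset Up <= W} ->
  reps W Up rs -> x \in U0 ->
  `| #|` cl W A x|%:R * (p * q) ^+ 2 - (size rs)%:R * a | <= (size rs)%:R * (c * a).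
Proof.
move=> WU UW rp xU; rewrite (card_cl_reps A x UW rp) natr_sum mulr_suml.
have -> : (size rs)%:R * a = \sum_(r <- rs) a by rewrite big_const_seq count_predT iter_addr addr0 mulr_natl.
have -> : (size rs)%:R * (c * a) = \sum_(r <- rs) (c * a).
  by rewrite big_const_seq count_predT iter_addr addr0 mulr_natl.
rewrite -sumrB; apply: le_trans (ler_norm_sum _ _ _) _.
rewrite big_seq [X in _ <= X]big_seq; apply: ler_sum => r rr; apply: bal.
by apply: rpredD => //; apply: WU; case: rp => _ h _ _; apply: h.
Qed.

(** Relative deviations of [A] in the classes of W1 and W2. These two groups are paired because T
    maps W2 into W1, so that a W1-class plus the image of a W2-class lies in one W1-class. *)
Let s x : R := #|` cl W1 A x|%:R * (p ^+ 2 * q) / a - 1.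
Let t x : R := #|` cl W2 A x|%:R * (p * q ^+ 2) / a - 1.

Lemma sE x : #|` cl W1 A x|%:R = a / (p ^+ 2 * q) * (1 + s x).
Proof. by rewrite /s; field; rewrite !gt_eqF ?p0 ?q0 ?a0. Qed.

Lemma tE x : #|` cl W2 A x|%:R = a / (p * q ^+ 2) * (1 + t x).
Proof. by rewrite /t; field; rewrite !gt_eqF ?p0 ?q0 ?a0. Qed.

Lemma s_per x y : x - y \in W1 -> s x = s y.
Proof. by rewrite /s => /(cl_eq A)->. Qed.

Lemma t_per x y : x - y \in W2 -> t x = t y.
Proof. by rewrite /t => /(cl_eq A)->. Qed.

Lemma s_le x : x \in U0 -> `|s x| <= c.
Proof.
move=> xU; have [rs sz rp] := repsAB tw 0 1 n.+3 n.+2.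
have sub1 : {subset W1 <= U0} by exact: (@twrS _ _ _ _ _ _ _ _ tw 2 1 n.+1 n.+1).
have sub2 : {subset Up <= W1} by exact: (@twrS _ _ _ _ _ _ _ _ tw 0 1 n.+3 n.+2).
have := leaf_cl_bound sub1 sub2 rp xU.
rewrite sz expn0 mul1n expn1 -/q sE => h.
have -> : `|s x| = `|a / (p ^+ 2 * q) * (1 + s x) * (p * q) ^+ 2 - q * a| / (q * a).
  have qa0 : 0 < q * a by rewrite mulr_gt0 ?q0 ?a0.
  rewrite -[X in _ / X](gtr0_norm qa0) -normf_div; congr `|_|.
  by field; rewrite !gt_eqF ?p0 ?q0 ?a0.
by rewrite ler_pdivrMr ?mulr_gt0 ?q0 ?a0 //; apply: le_trans h _; rewrite mulrCA.
Qed.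

Lemma t_le x : x \in U0 -> `|t x| <= c.
Proof.
move=> xU; have [rs sz rp] := repsAB tw 1 0 n.+2 n.+3.
have sub1 : {subset W2 <= U0} by exact: (@twrS _ _ _ _ _ _ _ _ tw 1 2 n.+1 n.+1).
have sub2 : {subset Up <= W2} by exact: (@twrS _ _ _ _ _ _ _ _ tw 1 0 n.+2 n.+3).
have := leaf_cl_bound sub1 sub2 rp xU.
rewrite sz expn0 muln1 expn1 -/p tE => h.
have -> : `|t x| = `|a / (p * q ^+ 2) * (1 + t x) * (p * q) ^+ 2 - p * a| / (p * a).
  have pa0 : 0 < p * a by rewrite mulr_gt0 ?p0 ?a0.
  rewrite -[X in _ / X](gtr0_norm pa0) -normf_div; congr `|_|.
  by field; rewrite !gt_eqF ?p0 ?q0 ?a0.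
by rewrite ler_pdivrMr ?mulr_gt0 ?p0 ?a0 //; apply: le_trans h _; rewrite mulrCA.
Qed.

Lemma cl_full : cl U0 A 0 = A.
Proof.
by apply/fsetP=> x; rewrite mem_cl subr0; case: (boolP (x \in A)) => // /AU ->.
Qed.

Lemma sum_s rs : reps U0 W1 rs -> (size rs)%:R = p ^+ 2 * q -> \sum_(x <- rs) s x = 0.
Proof.
move=> rp sz.
have sub1 : {subset W1 <= U0} by exact: (@twrS _ _ _ _ _ _ _ _ tw 2 1 n.+1 n.+1).
have := card_cl_reps A 0 sub1 rp; rewrite cl_full => E.
rewrite /s sumrB -!mulr_suml -natr_sum.
have -> : (\sum_(i <- rs) #|` cl W1 A i| = #|` A|)%N.
  by rewrite E; apply: eq_bigr => r _; rewrite add0r.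
rewrite -/a big_const_seq count_predT iter_addr addr0 -/(size rs) sz mulrAC divff ?gt_eqF ?a0 //.
by rewrite mul1r subrr.
Qed.

Lemma sum_t rs : reps U0 W2 rs -> (size rs)%:R = p * q ^+ 2 -> \sum_(x <- rs) t x = 0.
Proof.
move=> rp sz.
have sub1 : {subset W2 <= U0} by exact: (@twrS _ _ _ _ _ _ _ _ tw 1 2 n.+1 n.+1).
have := card_cl_reps A 0 sub1 rp; rewrite cl_full => E.
rewrite /t sumrB -!mulr_suml -natr_sum.
have -> : (\sum_(i <- rs) #|` cl W2 A i| = #|` A|)%N.
  by rewrite E; apply: eq_bigr => r _; rewrite add0r.
rewrite -/a big_const_seq count_predT iter_addr addr0 -/(size rs) sz mulrAC divff ?gt_eqF ?a0 //.
by rewrite mul1r subrr.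
Qed.

(** Both sides come from counting [A] in one class of U1, which consists of p classes of W1 and of q
    classes of W2. This is the only link between s and t. *)
Lemma avg_st x rs1 rs2 : reps U1 W1 rs1 -> reps U1 W2 rs2 ->
  (size rs1)%:R = p -> (size rs2)%:R = q ->
  q * \sum_(r <- rs1) s (x + r) = p * \sum_(r <- rs2) t (x + r).
Proof.
move=> rp1 rp2 sz1 sz2.
have sub1 : {subset W1 <= U1} by exact: (@twrS _ _ _ _ _ _ _ _ tw 1 0 n.+2 n.+2).
have sub2 : {subset W2 <= U1} by exact: (@twrS _ _ _ _ _ _ _ _ tw 0 1 n.+2 n.+2).
have E : (\sum_(r <- rs1) #|` cl W1 A (x + r)|)%:R = (\sum_(r <- rs2) #|` cl W2 A (x + r)|)%:R :> R.
  by rewrite -(card_cl_reps A x sub1 rp1) -(card_cl_reps A x sub2 rp2).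
have e1 : (\sum_(r <- rs1) #|` cl W1 A (x + r)|)%:R = a / (p ^+ 2 * q) * (p + \sum_(r <- rs1) s (x + r)).
  rewrite natr_sum; under eq_bigr do rewrite sE.
  rewrite -mulr_sumr big_split /= big_const_seq count_predT iter_addr addr0 -/(size rs1).
  by rewrite -[X in X + _]/((size rs1)%:R) sz1.
have e2 : (\sum_(r <- rs2) #|` cl W2 A (x + r)|)%:R = a / (p * q ^+ 2) * (q + \sum_(r <- rs2) t (x + r)).
  rewrite natr_sum; under eq_bigr do rewrite tE.
  rewrite -mulr_sumr big_split /= big_const_seq count_predT iter_addr addr0 -/(size rs2).
  by rewrite -[X in X + _]/((size rs2)%:R) sz2.
move: E; rewrite e1 e2; set S1 := \sum_(_ <- _) _; set S2 := \sum_(_ <- _) _ => E.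
have -> : q * S1 = (a / (p ^+ 2 * q) * (p + S1)) * (p ^+ 2 * q ^+ 2 / a) - p * q.
  by field; rewrite !gt_eqF ?p0 ?q0 ?a0.
rewrite E; by field; rewrite !gt_eqF ?p0 ?q0 ?a0.
Qed.

(** The sums u + T y hit (pq)^2 classes of W1, each through the pq pairs (u + l, y - T' l) with l in
    Ua / W1; [lm] selects the l with the largest linear term. The total N of these maxima controls
    how far any pair falls short, and thereby s and t themselves. *)
Lemma leaf_choice (al be : R) : 0 < al -> 0 < be ->
  exists (us ys : seq V) (lm : V * V -> V),
  let h x y := al * s x + be * t y in
  let N := \sum_(u <- us) \sum_(y <- ys) h (u + lm (u, y)) (y - T' (lm (u, y))) in
  [/\ reps U0 Ua us, (size us)%:R = p, reps U0 W2 ys, (size ys)%:R = p * q ^+ 2 &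
    (forall uy, lm uy \in Ua) /\
    forall x, x \in U0 -> `|s x| <= 4 * (al^-1 + be^-1) * (p * q * N) /\
                          `|t x| <= 4 * (al^-1 + be^-1) * (p * q * N)].
Proof.
move=> al0 be0; have [a1 a2 a3 a4 a5 a6 a7 a8 _ _] := tw.
have sub i j k l : {subset U (k + i) (l + j) <= U i j} by exact: (@twrS _ _ _ _ _ _ _ _ tw k l i j).
have [us usz usR] := repsAB tw 1 0 n.+1 n.+1.
have [ys ysz ysR] := repsAB tw 1 2 n.+1 n.+1.
have [ls lsz lsR] := repsAB tw 1 1 n.+2 n.+1.
pose h x y := al * s x + be * t y.
have ls0 : exists l, l \in ls.
  by have [_ _ /(_ 0 (rpred0 _))[l ll _] _] := lsR; exists l.
have /choice[lm lmP] : forall uy : V * V, exists l, l \in ls /\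
    forall l', l' \in ls -> h (uy.1 + l') (uy.2 - T' l') <= h (uy.1 + l) (uy.2 - T' l).
  move=> uy; case: ls0 => l0 /(fset_argmin (fun l => - h (uy.1 + l) (uy.2 - T' l)))[l ll lmin].
  by exists l; split=> // l' /lmin; rewrite lerN2.
exists us, ys, lm => h' N; have Nh : N = \sum_(u <- us) \sum_(y <- ys) h (u + lm (u, y)) (y - T' (lm (u, y))) by [].
have [_ lsU lsC _] := lsR; have [_ usU usC _] := usR; have [_ ysU ysC _] := ysR.
have pqsz : (size ls)%:R = p * q :> R by rewrite lsz !expn1 natrM.
have T'Ua x : x \in Ua -> T' x \in Ub by apply: twr_T'.
have UaU : {subset Ua <= U0} by exact: (sub _ _ 1 0).
have UbU : {subset Ub <= U0} by exact: (sub _ _ 0 1).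
have W1Ua : {subset W1 <= Ua} by exact: (sub _ _ 1 1).
have usz' : (size us)%:R = p :> R by rewrite usz expn1 muln1.
have ysz' : (size ys)%:R = p * q ^+ 2 :> R by rewrite ysz expn1 natrM natrX.
have const (rs : seq V) (z : R) : \sum_(r <- rs) z = (size rs)%:R * z.
  by rewrite big_const_seq count_predT iter_addr addr0 mulr_natl.
(* For fixed l the points y - T' l again represent U0 / W2, so the t part sums to 0; the points u +
   l represent U0 / W1, so the s part does too. *)
have tot : \sum_(u <- us) \sum_(y <- ys) \sum_(l <- ls) h (u + l) (y - T' l) = 0.
  have e1 : \sum_(u <- us) \sum_(l <- ls) s (u + l) = 0.
    have := sum_s (reps_tower UaU W1Ua usR lsR); rewrite big_allpairs_dep /=; apply.
    by rewrite size_allpairs natrM usz' pqsz expr2 mulrA.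
  have e2 l : l \in ls -> \sum_(y <- ys) t (y - T' l) = 0.
    move=> ll; rewrite -(big_map (fun y => y - T' l) xpredT t); apply: sum_t; last by rewrite size_map.
    by apply: reps_shift => //; rewrite rpredN; apply/UbU/T'Ua/lsU.
  have step u : \sum_(y <- ys) \sum_(l <- ls) h (u + l) (y - T' l) =
      (size ys)%:R * al * \sum_(l <- ls) s (u + l).
    rewrite exchange_big mulr_sumr /= big_seq [RHS]big_seq; apply: eq_bigr => l ll.
    by rewrite /h big_split /= const -mulr_sumr e2 // mulr0 addr0 mulrA.
  by under eq_bigr => u _ do rewrite step; rewrite -mulr_sumr e1 mulr0.
(* By [tot], [e] is the sum over all u, y, l of the nonnegative differences between the maximum and
   the value at l, so it bounds each of them. *)
pose e := p * q * N.
have near u y l : u \in us -> y \in ys -> l \in ls ->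
    h (u + lm (u, y)) (y - T' (lm (u, y))) - h (u + l) (y - T' l) <= e.
  move=> uu yy ll.
  have eE : e = \sum_(u <- us) \sum_(y <- ys) \sum_(l <- ls)
      (h (u + lm (u, y)) (y - T' (lm (u, y))) - h (u + l) (y - T' l)).
    under eq_bigr => u1 _ do under eq_bigr => y1 _ do rewrite sumrB const pqsz.
    under eq_bigr => u1 _ do rewrite sumrB -mulr_sumr.
    by rewrite sumrB tot subr0 -mulr_sumr -Nh.
  have pos u1 y1 l1 : l1 \in ls -> 0 <= h (u1 + lm (u1, y1)) (y1 - T' (lm (u1, y1))) - h (u1 + l1) (y1 - T' l1).
    by move=> ll1; rewrite subr_ge0; have [_ /(_ l1 ll1)] := lmP (u1, y1).
  have one (I : eqType) (rs : seq I) (F : I -> R) i : i \in rs ->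
      (forall j, j \in rs -> 0 <= F j) -> F i <= \sum_(j <- rs) F j.
    move=> ii Fp; rewrite (perm_big _ (perm_to_rem ii)) big_cons lerDl big_seq sumr_ge0 // => j /mem_rem.
    exact: Fp.
  rewrite eE; apply: le_trans (one _ _ (fun l => _) _ ll _) _; first by move=> j jl; exact: pos.
  apply: le_trans (one _ _ (fun y => \sum_(l <- ls) (h (u + lm (u, y)) (y - T' (lm (u, y))) - h (u + l) (y - T' l))) _ yy _) _.
    by move=> j jl; rewrite big_seq sumr_ge0 // => k; exact: pos.
  apply: (one _ _ (fun u => \sum_(y <- ys) \sum_(l <- ls) (h (u + lm (u, y)) (y - T' (lm (u, y))) - h (u + l) (y - T' l))) _ uu _).
  by move=> i iu; apply: sumr_ge0 => j _; rewrite big_seq sumr_ge0 // => k; exact: pos.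
(* Modulo W1 and W2 every pair (x, y) is some (u + l0, y1 - T' l0), and the shift by l keeps u and
   y1, so both values of h lie below the same maximum and the first is within [e] of it. *)
have move_h x y l : x \in U0 -> y \in U0 -> l \in Ua ->
    h (x + l) (y - T' l) - h x y <= e.
  move=> xU yU lU; have [u uu xu] := usC _ xU; have [l0 ll0 h0] := lsC _ xu.
  have [y1 yy1 hy1] : exists2 r, r \in ys & (y + T' l0) - r \in W2.
    by apply: ysC; apply: rpredD => //; apply/UbU/T'Ua/lsU.
  have [l1 ll1 h1] : exists2 r, r \in ls & (x - u + l) - r \in W1.
    by apply: lsC; apply: rpredD.
  have <- : h (u + l0) (y1 - T' l0) = h x y.
    congr (al * _ + be * _); first by apply: s_per; rewrite -rpredN opprB opprD addrA.
    by apply: t_per; rewrite -rpredN opprB opprB addrA.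
  have -> : h (x + l) (y - T' l) = h (u + l1) (y1 - T' l1).
    congr (al * _ + be * _).
      by apply: s_per; rewrite opprD addrA [x + l - u]addrAC.
    apply: t_per.
    have -> : y - T' l - (y1 - T' l1) = (y + T' l0 - y1) - T' ((x - u + l - l1) - (x - u - l0)).
      have -> z : (z + l - l1) - (z - l0) = l - l1 + l0.
        by rewrite opprB -[z + l - l1]addrA [LHS]addrC addrA subrK addrC.
      rewrite (raddfD T') (raddfB T') /= [in RHS]opprD [y + _ - y1]addrAC [RHS]addrACA subrr addr0.
      by rewrite !opprB [LHS]addrACA [RHS]addrACA [- T' l + _]addrC.
    by apply: rpredB => //; apply: twr_T' => //; apply: rpredB.
  have [_ /(_ l1 ll1) /= hm] := lmP (u, y1).
  by have := near u y1 l0 uu yy1 ll0; lra.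
have uni (f : V -> R) W rs : reps U0 W rs -> (forall x y, x - y \in W -> f x = f y) ->
    exists2 x, x \in U0 & forall y, y \in U0 -> f x <= f y.
  move=> [_ rU rC _] fper; have [r0 rr0 _] := rC _ (rpred0 _).
  have [x xr xm] := fset_argmin f rr0; exists x; first exact: rU.
  by move=> y /rC[r rr /fper ->]; apply: xm.
have [xs xsz xsR] := repsAB tw 2 1 n.+1 n.+1.
have xsz' : (size xs)%:R = p ^+ 2 * q :> R by rewrite xsz expn1 natrM natrX.
(* At a minimiser y of t the shift cannot lower the t part, so the bound on h becomes a bound on s
   alone. *)
have s_move x l : x \in U0 -> l \in Ua -> al * (s (x + l) - s x) <= e.
  move=> xU lU; have [y yU ym] := uni t _ _ ysR t_per.
  have yU' : y - T' l \in U0 by apply: rpredB => //; apply/UbU/T'Ua.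
  have := move_h x y l xU yU lU; have := ym _ yU'; rewrite /h => h1 h2.
  have := ler_wpM2l (ltW be0) h1; lra.
have t_move y l : y \in U0 -> l \in Ub -> be * (t (y + l) - t y) <= e.
  move=> yU lU; have [x xU xm] := uni s _ _ xsR s_per.
  have TlU : - T l \in Ua by rewrite rpredN; apply: twr_T.
  have xU' : x - T l \in U0 by apply: rpredD => //; apply: UaU.
  have := move_h x y (- T l) xU yU TlU; have := xm _ xU'.
  rewrite /h raddfN opprK a1 => h1 h2.
  have := ler_wpM2l (ltW al0) h1; lra.
have s_up x l : x \in U0 -> l \in Ua -> s (x + l) <= s x + e / al.
  by move=> xU lU; rewrite -lerBlDl ler_pdivlMr // mulrC; apply: s_move.
have s_dn x l : x \in U0 -> l \in Ua -> s x <= s (x + l) + e / al.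
  move=> xU lU; rewrite -{1}[x](addrK l); apply: s_up; last by rewrite rpredN.
  by apply: rpredD => //; apply: UaU.
have t_up x l : x \in U0 -> l \in Ub -> t (x + l) <= t x + e / be.
  by move=> xU lU; rewrite -lerBlDl ler_pdivlMr // mulrC; apply: t_move.
have t_dn x l : x \in U0 -> l \in Ub -> t x <= t (x + l) + e / be.
  move=> xU lU; rewrite -{1}[x](addrK l); apply: t_up; last by rewrite rpredN.
  by apply: rpredD => //; apply: UbU.
have [rs1 sz1 rp1] := repsAB tw 1 0 n.+2 n.+2.
have [rs2 sz2 rp2] := repsAB tw 0 1 n.+2 n.+2.
have sz1' : (size rs1)%:R = p :> R by rewrite sz1 expn1 muln1.
have sz2' : (size rs2)%:R = q :> R by rewrite sz2 expn0 mul1n expn1.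
have r1U r : r \in rs1 -> r \in Ua.
  by case: rp1 => _ h1 _ _ /h1; apply: (sub n.+2 n.+1 0 1).
have r2U r : r \in rs2 -> r \in Ub.
  by case: rp2 => _ h1 _ _ /h1; apply: (sub n.+1 n.+2 1 0).
pose k := al^-1 + be^-1.
have sum_le (rs : seq V) (f : V -> R) z : (forall r, r \in rs -> f r <= z) ->
    \sum_(r <- rs) f r <= (size rs)%:R * z.
  by move=> h1; rewrite -const big_seq [X in _ <= X]big_seq ler_sum.
have sum_ge (rs : seq V) (f : V -> R) z : (forall r, r \in rs -> z <= f r) ->
    (size rs)%:R * z <= \sum_(r <- rs) f r.
  by move=> h1; rewrite -const big_seq [X in _ <= X]big_seq ler_sum.
have pq0 : 0 < p * q by rewrite mulr_gt0 ?p0 ?q0.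
(* The shifts in [avg_st] lie in Ua for s and in Ub for t, where s and t hardly change; so the
   averages may be replaced by s x and t x. *)
have st x : x \in U0 -> s x <= t x + e * k /\ t x <= s x + e * k.
  move=> xU; have E := avg_st x rp1 rp2 sz1' sz2'.
  have l1 : p * (s x - e / al) <= \sum_(r <- rs1) s (x + r).
    by rewrite -sz1'; apply: sum_ge => r /r1U rU; rewrite lerBlDr s_dn.
  have l2 : \sum_(r <- rs1) s (x + r) <= p * (s x + e / al).
    by rewrite -sz1'; apply: sum_le => r /r1U rU; rewrite s_up.
  have l3 : q * (t x - e / be) <= \sum_(r <- rs2) t (x + r).
    by rewrite -sz2'; apply: sum_ge => r /r2U rU; rewrite lerBlDr t_dn.
  have l4 : \sum_(r <- rs2) t (x + r) <= q * (t x + e / be).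
    by rewrite -sz2'; apply: sum_le => r /r2U rU; rewrite t_up.
  move: E l1 l2 l3 l4; set S1 := \sum_(_ <- _) _; set S2 := \sum_(_ <- _) _ => E l1 l2 l3 l4.
  have {l1}l1 := ler_wpM2l (ltW q0) l1; have {l2}l2 := ler_wpM2l (ltW q0) l2.
  have {l3}l3 := ler_wpM2l (ltW p0) l3; have {l4}l4 := ler_wpM2l (ltW p0) l4.
  rewrite /k; split; rewrite -(ler_pM2l pq0).
    have -> : p * q * s x = q * (p * (s x - e / al)) + p * q * (e / al) by ring.
    apply: le_trans (_ : p * (q * (t x + e / be)) + p * q * (e / al) <= _).
      by rewrite lerD2r (le_trans l1) // E.
    by rewrite le_eqVlt; apply/orP; left; apply/eqP; ring.
  have -> : p * q * t x = p * (q * (t x - e / be)) + p * q * (e / be) by ring.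
  apply: le_trans (_ : q * (p * (s x + e / al)) + p * q * (e / be) <= _).
    by rewrite lerD2r (le_trans l3) // -E.
  by rewrite le_eqVlt; apply/orP; left; apply/eqP; ring.
(* x' - x = l1 + l2 with l1 in Ua, which s tolerates, and l2 in Ub, which t tolerates. Two exchanges
   of s and t cost 2 e k, the two moves together e k. *)
have osc x x' : x \in U0 -> x' \in U0 -> s x' <= s x + 3 * (e * k).
  move=> xU x'U; set w := x' - x; have wU : w \in U0 by apply: rpredB.
  pose l1 := T (Rr w); pose l2 := Rr w.
  have l1U : l1 \in Ua by apply: twr_TR.
  have l2U : l2 \in Ub by apply: twr_R.
  have -> : x' = x + l2 + l1 by rewrite -addrA /l1 /l2 a4 /w addrC subrK.
  have xlU : x + l2 \in U0 by apply: rpredD => //; apply: UbU.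
  have := s_up _ _ xlU l1U; have [+ _] := st _ xlU; have := t_up _ _ xU l2U.
  have [_] := st _ xU; rewrite /k mulrDr; lra.
have ek0 x : x \in U0 -> `|s x| <= 3 * (e * k).
  move=> xU; have S0 := sum_s xsR xsz'.
  have xsp : 0 < (size xs)%:R :> R by rewrite xsz' mulr_gt0 ?exprn_gt0 ?p0 ?q0.
  have [_ xsU _ _] := xsR.
  rewrite ler_norml; apply/andP; split.
    have : \sum_(r <- xs) s r <= (size xs)%:R * (s x + 3 * (e * k)).
      by apply: sum_le => r /xsU rU; apply: osc.
    by rewrite S0 pmulr_rge0 //; lra.
  have : (size xs)%:R * (s x - 3 * (e * k)) <= \sum_(r <- xs) s r.
    by apply: sum_ge => r /xsU rU; rewrite lerBlDr; apply: osc.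
  by rewrite S0 pmulr_rle0 //; lra.
split=> //; split=> [uy|x xU]; first by apply: lsU; case: (lmP uy).
have h1 := ek0 _ xU; have [h2 h3] := st _ xU.
have ekp : 0 <= e * k by have := le_trans (normr_ge0 _) h1; rewrite pmulr_rge0.
have -> : 4 * (al^-1 + be^-1) * (p * q * N) = 4 * (e * k) by rewrite /e /k; ring.
split; first by apply: le_trans h1 _; lra.
by move: h1; rewrite !ler_norml => /andP[h4 h5]; apply/andP; split; lra.
Qed.

Lemma c_gt0 : 0 < c.
Proof.
have h : 0 < 8 * (p * q) ^+ 3 * (2 + p + q).
  by rewrite !mulr_gt0 ?exprn_gt0 ?mulr_gt0 ?p0 ?q0 //; move: p0 q0; lra.
by rewrite -(pmulr_lgt0 _ h) c_small.
Qed.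

Lemma c_le_half : c <= 1/2.
Proof.
have h : 2 <= 8 * (p * q) ^+ 3 * (2 + p + q).
  have h3 : 1 <= (p * q) ^+ 3 by rewrite exprn_ege1 // mulr_ege1.
  by move: p1 q1 h3; nra.
have := c_small; have := c_gt0; move: h; set z := _ * (2 + p + q); nra.
Qed.

(** A point over (u, y) is u + T y modulo W1, whatever l is. Since T (y - y') is in U(n+2,n), whose
    intersection with U0 is Ua, it determines u modulo Ua, and then y modulo W2. *)
Lemma leaf_sum us ys (lm : V * V -> V) :
  reps U0 Ua us -> reps U0 W2 ys -> (forall uy, lm uy \in Ua) ->
  let X uy := cl W1 A (uy.1 + lm uy) in
  let Y uy := tim T (cl W2 A (uy.2 - T' (lm uy))) in
  forall C : {fset V}, (forall b, b \in C -> b \in W1) ->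
  (\sum_(uy <- [seq (u, y) | u <- us, y <- ys]) #|` X uy +s Y uy +s C| <= #|` Sset T A +s C|)%N.
Proof.
move=> [uus usU usC usI] [uys ysU ysC ysI] lmU X Y C CW.
have [a1 a2 a3 a4 a5 a6 a7 a8 _ _] := tw.
apply: card_disjoint_le.
- by apply: allpairs_uniq => // -[u y] [u' y'].
- move=> uy _; apply: sumfsS => //; apply: sumfsS; first exact: cl_sub.
  apply/fsubsetP=> _ /timP[b bA ->]; apply: mem_tim; exact: (fsubsetP (cl_sub _ _ _)) bA.
have key z uy : z \in X uy +s Y uy +s C -> z - (uy.1 + T uy.2) \in W1.
  case/sumfsP=> _ [b [/sumfsP[x [_ [xA /timP[y yA ->] ->]]] /CW bU ->]].
  move: xA yA; rewrite !mem_cl => /andP[_ xe] /andP[_ ye].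
  have -> : x + T y + b - (uy.1 + T uy.2) =
      (x - (uy.1 + lm uy)) + T (y - (uy.2 - T' (lm uy))) + b.
    have -> : T (y - (uy.2 - T' (lm uy))) = T y - (T uy.2 - lm uy).
      by rewrite !(raddfB T) /= a2.
    by rewrite -addrB_shift [LHS]addrAC.
  apply: rpredD => //; apply: rpredD => //; exact: twr_T.
move=> [u y] [u' y'] z /allpairsP[[u1 y1] /= [uu yy [E1 E2]]].
move=> /allpairsP[[u2 y2] /= [uu' yy' [E3 E4]]]; subst u1 y1 u2 y2.
move=> /key/= h1 /key/= h2; have {h1 h2} := rpredB h2 h1.
rewrite opprB addrC addrA subrK opprD [X in X \in _]addrACA -raddfB => h.
have eu : u = u'.
  apply: usI => //.
  have h1 : T (y - y') \in U n.+2 n by apply: twr_T => //; apply: rpredB; apply: ysU.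
  have h2 : (u - u') + T (y - y') \in U n.+2 n by apply: (@twrS _ _ _ _ _ _ _ _ tw 1 2 n.+2 n).
  have : u - u' \in U n.+2 n by rewrite -(rpredDr _ h1).
  have : u - u' \in U0 by apply: rpredB; apply: usU.
  by rewrite !inE => /andP[_ ->] /andP[-> _].
congr (_, _) => //; apply: ysI => //.
rewrite -[y - y']a1; apply: twr_T' => //.
by move: h; rewrite eu subrr add0r.
Qed.

Theorem leaf (Pr Qr : R) : 0 <= Pr -> 0 <= Qr -> Pr ^+ d.+1 = p -> Qr ^+ d.+1 = q ->
  (Qr + Pr) ^+ d.+1 * a <= #|` Sset T A|%:R + ep * #|` Sset T A +s B|%:R.
Proof.
move=> P0 Q0 Pd Qd.
have ge1 (z w : R) : 0 <= z -> z ^+ d.+1 = w -> 1 <= w -> 1 <= z <= w.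
  move=> z0 <- h; have z1 : 1 <= z by move: h; rewrite expr_ge1.
  by rewrite z1 exprS ler_peMr // exprn_ege1.
have /andP[Pr1 Prp] := ge1 _ _ P0 Pd p1.
have /andP[Qr1 Qrq] := ge1 _ _ Q0 Qd q1.
have [ar ar0 ard] := root_exists d (ltW a0).
have [D D0 Dd] : exists2 D : R, 0 <= D & D ^+ d.+1 = (p * q) ^+ 2.
  by apply: root_exists; rewrite exprn_ge0 // mulr_ge0 ?ltW ?p0 ?q0.
have pq1 : 1 <= (p * q) ^+ 2 by rewrite exprn_ege1 // mulr_ege1.
have /andP[D1 _] := ge1 _ _ D0 Dd pq1.
have Dgt0 : 0 < D by lra.
have argt0 : 0 < ar.
  rewrite lt0r ar0 andbT; apply/eqP=> z; move: a0; rewrite -ard z expr0n /=.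
  by rewrite ltxx.
(* The (d+1)-th powers of [fr] and [gr] are the mean sizes of the classes of W1 and W2. *)
pose fr := Qr * ar / D; pose gr := Pr * ar / D.
have fr0 : 0 < fr by rewrite /fr divr_gt0 // mulr_gt0 //; lra.
have gr0 : 0 < gr by rewrite /gr divr_gt0 // mulr_gt0 //; lra.
have frd : fr ^+ d.+1 = a / (p ^+ 2 * q).
  rewrite /fr expr_div_n exprMn Qd ard Dd.
  by field; rewrite !gt_eqF ?p0 ?q0.
have grd : gr ^+ d.+1 = a / (p * q ^+ 2).
  rewrite /gr expr_div_n exprMn Pd ard Dd.
  by field; rewrite !gt_eqF ?p0 ?q0.
pose w := fr + gr; have w0 : 0 < w by rewrite addr_gt0.
pose al := w ^+ d * fr; pose be := w ^+ d * gr.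
have al0 : 0 < al by rewrite mulr_gt0 ?exprn_gt0.
have be0 : 0 < be by rewrite mulr_gt0 ?exprn_gt0.
have [us [ys [lm [usR usz ysR ysz [lmU bnd]]]]] := leaf_choice al0 be0.
set N := \sum_(u <- us) _ in bnd.
pose M := 4 * (al^-1 + be^-1) * (p * q * N).
have [a1 a2 a3 a4 a5 a6 a7 a8 _ _] := tw.
have UaU : {subset Ua <= U0} by exact: (@twrS _ _ _ _ _ _ _ _ tw 1 0 n.+1 n.+1).
have UbU : {subset Ub <= U0} by exact: (@twrS _ _ _ _ _ _ _ _ tw 0 1 n.+1 n.+1).
have UpW : {subset Up <= W1} by exact: (@twrS _ _ _ _ _ _ _ _ tw 0 1 n.+3 n.+2).
pose ix := [seq (u, y) | u <- us, y <- ys].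
pose xx (uy : V * V) := uy.1 + lm uy; pose yy (uy : V * V) := uy.2 - T' (lm uy).
have ixU uy : uy \in ix -> xx uy \in U0 /\ yy uy \in U0.
  case/allpairsP=> -[u y] /= [uu yy' ->]; rewrite /xx /yy /=.
  have [_ usU _ _] := usR; have [_ ysU _ _] := ysR.
  split; first by apply: rpredD; [exact: usU | exact/UaU].
  by apply: rpredB; [exact: ysU | apply/UbU/twr_T'].
pose X uy := cl W1 A (xx uy); pose Y uy := tim T (cl W2 A (yy uy)).
have nonneg x : x \in U0 -> 0 <= M by move=> /bnd[h _]; exact: le_trans (normr_ge0 _) h.
have M0 : 0 <= M by apply: (nonneg 0); apply: rpred0.
have hh := c_le_half; have cp := c_gt0.
have half x : x \in U0 -> -(1/2) <= s x /\ -(1/2) <= t x.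
  move=> xU; have := s_le xU; have := t_le xU; rewrite !ler_norml.
  by move=> /andP[h1 _] /andP[h2 _]; split; lra.
have n0W z : 0 < z :> R -> forall m : nat, m%:R = z -> (0 < m)%N.
  by move=> z0 m mz; rewrite -(ltr0n R) mz.
(* In each square one factor is bounded by the threshold [c] and the other by [M], a multiple of N;
   this makes the quadratic loss comparable with the gain N. *)
have pt uy : uy \in ix -> w ^+ d.+1 + (al * s (xx uy) + be * t (yy uy)) - 2 * (al + be) * (c * M)
    <= #|` X uy +s Y uy|%:R + ep * #|` X uy +s Y uy +s B|%:R.
  move=> /ixU[xU yU]; have [hs _] := half _ xU; have [_ ht] := half _ yU.
  have cY : #|` Y uy| = #|` cl W2 A (yy uy)|.
    by rewrite card_imfset //=; apply: can_inj a1.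
  have cX0 : X uy != fset0.
    rewrite -cardfs_gt0; apply: (n0W _ _ _ (sE _)).
    by rewrite mulr_gt0 ?divr_gt0 ?mulr_gt0 ?exprn_gt0 ?p0 ?q0 ?a0 //; lra.
  have cY0 : Y uy != fset0.
    rewrite -cardfs_gt0 cY; apply: (n0W _ _ _ (tE _)).
    by rewrite mulr_gt0 ?divr_gt0 ?mulr_gt0 ?exprn_gt0 ?p0 ?q0 ?a0 //; lra.
  have := BMh cX0 cY0; rewrite cY sE tE -frd -grd => hbm.
  have := leaf_point (ltW fr0) (ltW gr0) hs ht hbm.
  apply: le_trans; rewrite -/w.
  have sq (z : R) : `|z| <= c -> `|z| <= M -> z ^+ 2 <= c * M.
    move=> z1 z2; rewrite -[z ^+ 2]ger0_norm ?sqr_ge0 // normrX expr2.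
    by rewrite ler_pM.
  have [sM _] := bnd _ xU; have [_ tM] := bnd _ yU.
  have h1 := sq _ (s_le xU) sM; have h2 := sq _ (t_le yU) tM.
  have h3 := ler_wpM2l (ltW al0) h1; have h4 := ler_wpM2l (ltW be0) h2.
  rewrite [X in _ <= _ + X](_ : _ = al * s (xx uy) + be * t (yy uy) -
    2 * (al * s (xx uy) ^+ 2 + be * t (yy uy) ^+ 2)); last by rewrite /al /be; ring.
  by rewrite -!addrA !lerD2l; lra.
have sz_ix : (size ix)%:R = (p * q) ^+ 2 :> R.
  by rewrite size_allpairs natrM usz ysz exprMn; ring.
have tot : (p * q) ^+ 2 * w ^+ d.+1 + N - (p * q) ^+ 2 * (2 * (al + be) * (c * M)) <=
   #|` Sset T A|%:R + ep * #|` Sset T A +s B|%:R.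
  have Ns : N = \sum_(uy <- ix) (al * s (xx uy) + be * t (yy uy)).
    by rewrite big_allpairs_dep.
  have cst z : (p * q) ^+ 2 * z = \sum_(uy <- ix) z.
    by rewrite big_const_seq count_predT iter_addr addr0 -mulr_natl -/(size ix) sz_ix.
  rewrite Ns !cst -big_split -sumrB /=.
  apply: le_trans (_ : \sum_(uy <- ix) (#|` X uy +s Y uy|%:R + ep * #|` X uy +s Y uy +s B|%:R) <= _).
    by rewrite big_seq [X in _ <= X]big_seq; apply: ler_sum.
  rewrite big_split /= -mulr_sumr -!natr_sum.
  apply: lerD; last first.
    rewrite ler_wpM2l // ler_nat; apply: leaf_sum => // b /BU; exact: UpW.
  rewrite ler_nat; have := leaf_sum usR ysR lmU (C := [fset 0]).
  rewrite sumfs0 /= => h; apply: leq_trans (h _); last by move=> b; rewrite inE => /eqP->; rewrite rpred0.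
  by apply: leq_sum => uy _; rewrite sumfs0.
apply: le_trans tot.
have -> : (p * q) ^+ 2 * w ^+ d.+1 = (Qr + Pr) ^+ d.+1 * a.
  rewrite -Dd -exprMn -ard -exprMn; congr (_ ^+ _); rewrite /w /fr /gr.
  by field; rewrite gt_eqF.
rewrite -addrA lerDl subr_ge0.
pose k := al^-1 + be^-1.
have kk : (al + be) * k <= 2 + p + q.
  have -> : (al + be) * k = 2 + Pr / Qr + Qr / Pr.
    pose G := w ^+ d * ar / D.
    have G0 : G != 0 by rewrite gt_eqF // divr_gt0 // mulr_gt0 // exprn_gt0.
    have Pn0 : Pr != 0 by rewrite gt_eqF //; lra.
    have Qn0 : Qr != 0 by rewrite gt_eqF //; lra.
    have alE : al = G * Qr by rewrite /al /fr /G; ring.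
    have beE : be = G * Pr by rewrite /be /gr /G; ring.
    by rewrite /k alE beE; clearbody G; field; rewrite G0 Pn0 Qn0.
  have h1 : Pr / Qr <= p by rewrite ler_pdivrMr; [apply: le_trans Prp _; rewrite ler_peMr //; lra | lra].
  have h2 : Qr / Pr <= q by rewrite ler_pdivrMr; [apply: le_trans Qrq _; rewrite ler_peMr //; lra | lra].
  lra.
have k0 : 0 < k by rewrite addr_gt0 ?invr_gt0.
have N0 : 0 <= N.
  have : 0 < 4 * k * (p * q) by rewrite !mulr_gt0 ?p0 ?q0.
  have ME : 4 * k * (p * q) * N = M by rewrite /M /k; ring.
  by move=> h; rewrite -(pmulr_rge0 _ h) ME.
(* The total loss is c 8 (pq)^3 (al + be) k N, and (al + be) k <= 2 + p + q by [kk]; [c_small] was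
   chosen to make it at most N. *)
rewrite /M -/k.
have -> : (p * q) ^+ 2 * (2 * (al + be) * (c * (4 * k * (p * q * N)))) =
  c * (8 * (p * q) ^+ 3 * ((al + be) * k)) * N by ring.
rewrite ler_piMl // -[X in _ <= X]c_small; apply: ler_wpM2l; first exact: ltW.
apply: ler_wpM2l => //; apply: mulr_ge0 => //; apply: exprn_ge0.
by apply: mulr_ge0; apply: ltW; [exact: p0 | exact: q0].
Qed.

End Leaf.

(** * Descent in the tower *)

Section Imbalance.
Variable R : realType.

(** Cauchy-Schwarz with its defect. The numbers u r = sqrt(x r P / a) have squares summing to P, so
    they sum to P - 1/2 sum (u r - 1)^2; at r0, |u^2 - 1| >= c and u <= P give |u - 1| >= c / (P +
    1). *)
Lemma sum_sqrt_imbalance (I : eqType) (rs : seq I) (x : I -> R) (c : R) r0 :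
  let P : R := (size rs)%:R in let a := \sum_(r <- rs) x r in
  (forall r, 0 <= x r) -> 0 < a -> r0 \in rs -> 0 <= c -> c * a <= `|x r0 * P - a| ->
  \sum_(r <- rs) Num.sqrt (x r) <= (1 - c ^+ 2 / (2 * P * (P + 1) ^+ 2)) * Num.sqrt (a * P).
Proof.
move=> P a x0 a0 r0s c0 hc.
have P1 : 1 <= P by rewrite ler1n; case: (rs) r0s.
have P0 : 0 < P by apply: lt_le_trans P1.
pose u r := Num.sqrt (x r * P / a).
have y0 r : 0 <= x r * P / a by rewrite divr_ge0 ?mulr_ge0 // ltW.
have u0 r : 0 <= u r by apply: sqrtr_ge0.
have u2 r : u r ^+ 2 = x r * P / a by apply: sqr_sqrtr.
have one (F : I -> R) : (forall j, 0 <= F j) -> F r0 <= \sum_(j <- rs) F j.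
  move=> Fp; rewrite (perm_big _ (perm_to_rem r0s)) big_cons lerDl sumr_ge0 //.
have uP : u r0 <= P.
  rewrite -(ler_pXn2r (n := 2)) ?nnegrE // ?(ltW P0) // u2.
  rewrite ler_pdivrMr // (_ : P ^+ 2 * a = P * a * P); last by ring.
  apply: ler_wpM2r; first exact: ltW.
  by apply: le_trans (one x x0) _; rewrite -/a ler_peMl // ltW.
have dev : c / (P + 1) <= `|u r0 - 1|.
  rewrite ler_pdivrMr; last by lra.
  have : c <= `|u r0 - 1| * (u r0 + 1).
    have -> : u r0 + 1 = `|u r0 + 1| by rewrite ger0_norm // addr_ge0.
    rewrite -normrM; have -> : (u r0 - 1) * (u r0 + 1) = u r0 ^+ 2 - 1 by ring.
    rewrite u2; have -> : x r0 * P / a - 1 = (x r0 * P - a) / a by field; rewrite gt_eqF.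
    by rewrite normf_div (gtr0_norm a0) ler_pdivlMr.
  move/le_trans; apply; rewrite ler_wpM2l // lerD2r //.
have su : \sum_(r <- rs) u r <= P * (1 - c ^+ 2 / (2 * P * (P + 1) ^+ 2)).
  have e1 : \sum_(r <- rs) u r = P - 1/2 * \sum_(r <- rs) (u r - 1) ^+ 2.
    have e2 : \sum_(r <- rs) (u r - 1) ^+ 2 = P + P - 2 * \sum_(r <- rs) u r.
      transitivity (\sum_(r <- rs) (u r ^+ 2 + 1 - 2 * u r)).
        by apply: eq_bigr => r _; ring.
      rewrite sumrB big_split /= -mulr_sumr.
      rewrite [\sum_(r <- rs) 1]big_const_seq count_predT iter_addr addr0 -/P.
      congr (_ + _ - _); under eq_bigr do rewrite u2.
      by rewrite -!mulr_suml -/a mulrAC divff ?gt_eqF // mul1r.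
    by rewrite e2; field.
  have e3 : (c / (P + 1)) ^+ 2 <= \sum_(r <- rs) (u r - 1) ^+ 2.
    apply: le_trans (one (fun r => (u r - 1) ^+ 2) _); last by move=> j; apply: sqr_ge0.
    rewrite -[X in _ <= X]ger0_norm ?sqr_ge0 // normrX ler_pXn2r // nnegrE //.
    by rewrite divr_ge0 //; lra.
  rewrite e1 mulrBr mulr1 lerB //.
  have -> : P * (c ^+ 2 / (2 * P * (P + 1) ^+ 2)) = 1/2 * (c / (P + 1)) ^+ 2.
    by field; rewrite !gt_eqF //; lra.
  by rewrite ler_wpM2l //; lra.
have xE r : Num.sqrt (x r) = Num.sqrt (a / P) * u r.
  rewrite -sqrtrM; last by rewrite divr_ge0 // ltW.
  by congr Num.sqrt; field; rewrite !gt_eqF.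
under eq_bigr do rewrite xE.
rewrite -mulr_sumr; apply: le_trans (ler_wpM2l (sqrtr_ge0 _) su) _.
have -> : Num.sqrt (a * P) = Num.sqrt (a / P) * P.
  have PE : P = Num.sqrt (P ^+ 2) by rewrite sqrtr_sqr ger0_norm // ltW.
  rewrite [X in _ = _ * X]PE -sqrtrM; last by rewrite divr_ge0 // ltW.
  by congr Num.sqrt; field; rewrite gt_eqF.
by rewrite le_eqVlt; apply/orP; left; apply/eqP; ring.
Qed.

Lemma sqrt_cs2 (a b c e : R) : 0 <= a -> 0 <= b -> 0 <= c -> 0 <= e ->
  Num.sqrt (a * b) + Num.sqrt (c * e) <= Num.sqrt ((a + c) * (b + e)).
Proof.
move=> a0 b0 c0 e0; rewrite !sqrtrM ?addr_ge0 //.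
set x := Num.sqrt a; set y := Num.sqrt b; set z := Num.sqrt c; set w := Num.sqrt e.
have x0 : 0 <= x by apply: sqrtr_ge0. have y0 : 0 <= y by apply: sqrtr_ge0.
have z0 : 0 <= z by apply: sqrtr_ge0. have w0 : 0 <= w by apply: sqrtr_ge0.
rewrite -(ler_pXn2r (n := 2)) ?nnegrE ?addr_ge0 ?mulr_ge0 ?sqrtr_ge0 //.
rewrite [X in _ <= X]exprMn !sqr_sqrtr ?addr_ge0 //.
rewrite -(sqr_sqrtr a0) -(sqr_sqrtr b0) -(sqr_sqrtr c0) -(sqr_sqrtr e0) -/x -/y -/z -/w.
rewrite -subr_ge0 (_ : _ - _ = (x * w - z * y) ^+ 2) ?sqr_ge0 //; ring.
Qed.

Lemma sum_sqrt_cs (I : Type) (rs : seq I) (f g : I -> R) :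
  (forall i, 0 <= f i) -> (forall i, 0 <= g i) ->
  \sum_(i <- rs) Num.sqrt (f i * g i) <= Num.sqrt ((\sum_(i <- rs) f i) * \sum_(i <- rs) g i).
Proof.
move=> f0 g0; elim: rs => [|i rs IH]; first by rewrite !big_nil mul0r sqrtr0.
rewrite !big_cons; apply: le_trans (lerD (lexx _) IH) _.
by apply: sqrt_cs2; rewrite ?sumr_ge0.
Qed.
End Imbalance.

Section Translate.
Variables (V : zmodType) (T : {additive V -> V}).
Implicit Types A B : {fset V}.

Lemma card_sumfs_shift A B z : #|` (A +s [fset z]) +s B| = #|` A +s B|.
Proof. by rewrite -sumfsA (sumfsC _ B) sumfsA card_sumfs1. Qed.

Lemma Sset_shift A z : Sset T (A +s [fset z]) = Sset T A +s [fset z + T z].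
Proof.
apply/fsetP=> y; apply/sumfsP/sumfsP.
  move=> [_ [_ [/sumfsP[a [z1 [aA + ->]]] /timP[_ /sumfsP[b [z2 [bA + ->]]] ->] ->]]].
  rewrite !inE => /eqP-> /eqP->; exists (a + T b), (z + T z).
  by rewrite mem_sumfs ?mem_tim // inE eqxx raddfD addrACA.
move=> [_ [z' [/sumfsP[a [_ [aA /timP[b bA ->] ->]]] + ->]]]; rewrite inE => /eqP->.
exists (a + z), (T (b + z)); split; first by rewrite mem_sumfs ?inE.
  by rewrite mem_tim // mem_sumfs ?inE.
by rewrite raddfD addrACA.
Qed.

Lemma card_cl_shift (W : {pred V}) A z x : #|` cl W (A +s [fset z]) x| = #|` cl W A (x - z)|.
Proof.
rewrite -[RHS](card_sumfs1 _ z); congr #|` _|; apply/fsetP=> y; rewrite mem_cl.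
apply/andP/sumfsP.
  move=> [/sumfsP[a [z1 [aA + ->]]]]; rewrite inE => /eqP-> h.
  by exists a, z; rewrite mem_cl aA inE eqxx opprB addrA; split.
move=> [a [z1 [+ + ->]]]; rewrite mem_cl inE => /andP[aA h] /eqP->.
by split; [rewrite mem_sumfs ?inE | move: h; rewrite opprB addrA].
Qed.
End Translate.

Section Tree.
Variables (V : zmodType) (T T' Rr : {additive V -> V}) (K K' : zmodClosed V) (ras rbs : seq V).
Hypothesis tw : tower_axiom T T' Rr K K' ras rbs.
Local Notation U := (twr T T' K K').
Variables (R : realType) (B : {fset V}) (ep : R) (d : nat).
Let p : R := (size ras)%:R.
Let q : R := (size rbs)%:R.
Hypothesis ep0 : 0 <= ep.
Hypothesis BMh : forall X Y : {fset V}, X != fset0 -> Y != fset0 ->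
  bm d.+1 #|` X|%:R #|` Y|%:R (#|` X +s Y|%:R + ep * #|` X +s Y +s B|%:R : R).
Variables Pr Qr : R.
Hypotheses (Pr0 : 0 <= Pr) (Qr0 : 0 <= Qr) (Prd : Pr ^+ d.+1 = p) (Qrd : Qr ^+ d.+1 = q).
Let H := (Qr + Pr) ^+ d.+1.

(** The value demanded by the hypothesis [c_small] of [leaf]; [tree_theta] is then the factor of
    [sum_sqrt_imbalance] for the (pq)^2 classes of one step. *)
Definition tree_c : R := (8 * (p * q) ^+ 3 * (2 + p + q))^-1.
Definition tree_theta : R :=
  1 - tree_c ^+ 2 / (2 * (p * q) ^+ 2 * ((p * q) ^+ 2 + 1) ^+ 2).

Let p1 : 1 <= p. Proof. by rewrite ler1n (size_ras_gt0 tw). Qed.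
Let q1 : 1 <= q. Proof. by rewrite ler1n (size_rbs_gt0 tw). Qed.
Let pq1 : 1 <= p * q. Proof. exact: mulr_ege1. Qed.

Lemma tree_c_gt0 : 0 < tree_c.
Proof.
have pq0 : 0 < p * q by exact: lt_le_trans ltr01 pq1.
rewrite invr_gt0; apply: mulr_gt0; first by apply: mulr_gt0; rewrite ?exprn_gt0.
by move: p1 q1; lra.
Qed.

Lemma tree_c_le1 : tree_c <= 1.
Proof.
have h : 0 < tree_c by exact: tree_c_gt0.
rewrite -invf_ge1 // /tree_c invrK.
have h3 : 1 <= (p * q) ^+ 3 by rewrite exprn_ege1.
by move: p1 q1 h3; nra.
Qed.

Lemma tree_theta_bounds : 0 <= tree_theta < 1.
Proof.
have P1 : 1 <= (p * q) ^+ 2 by rewrite exprn_ege1.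
have h := tree_c_gt0; have h1 := tree_c_le1.
rewrite /tree_theta; set P := (p * q) ^+ 2 in P1 *.
have D1 : 1 <= 2 * P * (P + 1) ^+ 2.
  have : 1 <= (P + 1) ^+ 2 by rewrite exprn_ege1 //; lra.
  by move: P1; nra.
have c2 : 0 < tree_c ^+ 2 <= 1 by rewrite exprn_gt0 // exprn_ile1 // ltW.
have : 0 < tree_c ^+ 2 / (2 * P * (P + 1) ^+ 2) <= 1.
  case/andP: c2 => c2 c3; rewrite divr_gt0 //=; last by lra.
  by rewrite ler_pdivrMr; lra.
by move=> /andP[h2 h3]; rewrite subr_ge0 h3 ltrBlDr ltrDl h2.
Qed.

(** A step descends two indices on either side, the depth inspected by [leaf]. Passing to the (pq)^2
    classes divides [v] by (pq)^2, so an uneven set gains the factor [tree_theta] in the last term.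
    An even set is settled by [leaf]; at k = 0 the set lies in one deepest class, |A| <= v, and the
    last term alone suffices. *)
Theorem tree k n m (A : {fset V}) x0 (v : R) : m = (k.*2 + n.+1)%N ->
  (forall b, b \in B -> b \in U m m) ->
  (forall a, a \in A -> a - x0 \in U n.+1 n.+1) -> 0 <= v ->
  (forall y, #|` cl (U m m) A y|%:R * (p * q) ^+ k.*2 <= v) ->
  H * #|` A|%:R <= #|` Sset T A|%:R + ep * #|` Sset T A +s B|%:R +
     H * tree_theta ^+ k * Num.sqrt (#|` A|%:R * v).
Proof.
have H0 : 0 <= H by rewrite exprn_ge0 // addr_ge0.
have /andP[th0 th1] := tree_theta_bounds.
elim: k n A x0 v => [|k IH] n A x0 v hm BU AU v0 dens.
  rewrite expr0 mulr1 ler_wpDl //; first by rewrite addr_ge0 // mulr_ge0.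
  have Av : #|` A|%:R <= v.
    have := dens x0; rewrite expr0 mulr1; apply: le_trans; rewrite ler_nat.
    apply/fsubset_leq_card/fsubsetP=> a aA; rewrite mem_cl aA hm; exact: AU.
  rewrite ler_wpM2l // -[X in X <= _]ger0_norm // -sqrtr_sqr ler_sqrt; last by rewrite mulr_ge0.
  by rewrite expr2 ler_wpM2l.
have [->|A0] := eqVneq A fset0.
  rewrite cardfs0 mulr0 mul0r sqrtr0 mulr0 addr0 addr_ge0 // mulr_ge0 //.
have a0 : 0 < #|` A|%:R :> R by rewrite ltr0n cardfs_gt0.
have hm' : m = (k.*2 + n.+3)%N by rewrite hm doubleS !addSn !addnS.
have mU : {subset U m m <= U n.+3 n.+3}.
  rewrite hm'; exact: (@twrS _ _ _ _ _ _ _ _ tw k.*2 k.*2 n.+3 n.+3).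
have loss0 : 0 <= H * tree_theta ^+ k.+1 * Num.sqrt (#|` A|%:R * v).
  by apply: mulr_ge0; [apply: mulr_ge0 => //; apply: exprn_ge0 | apply: sqrtr_ge0].
have [bal|nbal] := pselect (forall x, x \in U n.+1 n.+1 ->
    `| #|` cl (U n.+3 n.+3) A (x + x0)|%:R * (p * q) ^+ 2 - #|` A|%:R | <= tree_c * #|` A|%:R).
  apply: ler_wpDr => //.
  have := @leaf _ _ _ _ _ _ _ _ tw R n (A +s [fset - x0]) B tree_c ep d _ _ _ ep0 _ BMh _ Pr Qr Pr0 Qr0 Prd Qrd.
  rewrite !Sset_shift !card_sumfs1 card_sumfs_shift; apply.
  - move=> a /sumfsP[b [z [bA + ->]]]; rewrite inE => /eqP->; exact: AU.
  - by rewrite sumfs_eq0 negb_or A0; apply/fset0Pn; exists (- x0); rewrite inE.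
  - by move=> b /BU/mU.
  - by move=> x xU; rewrite card_cl_shift opprK; apply: bal.
  by rewrite mulVf // gt_eqF // -invr_gt0 tree_c_gt0.
have [x1 x1U hx1] : exists2 x, x \in U n.+1 n.+1 & tree_c * #|` A|%:R <
    `| #|` cl (U n.+3 n.+3) A (x + x0)|%:R * (p * q) ^+ 2 - #|` A|%:R |.
  apply: contrapT => h; apply: nbal => x xU; rewrite leNgt; apply/negP=> h1.
  by apply: h; exists x.
have [rs rsz rsR] := repsAB tw 2 2 n.+1 n.+1.
have [urs rsU rsC rsI] := rsR.
pose Ar r := cl (U n.+3 n.+3) A (r + x0).
have rszR : (size rs)%:R = (p * q) ^+ 2 :> R by rewrite rsz natrM !natrX exprMn.
have sub : {subset U n.+3 n.+3 <= U n.+1 n.+1} by exact: (@twrS _ _ _ _ _ _ _ _ tw 2 2 n.+1 n.+1).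
have sumA : \sum_(r <- rs) #|` Ar r|%:R = #|` A|%:R :> R.
  have -> : A = cl (U n.+1 n.+1) A x0.
    by apply/fsetP=> x; rewrite mem_cl; case: (boolP (x \in A)) => // /AU ->.
  rewrite (card_cl_reps A x0 sub rsR) natr_sum /Ar; apply: eq_bigr => r _.
  congr (_%:R); congr #|` _|; apply/fsetP=> y; rewrite !mem_cl [r + x0]addrC.
  case: (boolP (y \in A)) => //= yA; rewrite AU //=.
have supadd (C : {fset V}) : (forall b, b \in C -> b \in U n.+3 n.+3) ->
    \sum_(r <- rs) #|` Sset T (Ar r) +s C|%:R <= #|` Sset T A +s C|%:R :> R.
  move=> CU; rewrite -natr_sum ler_nat.
  have := @Sset_superadd _ _ _ _ _ _ _ _ tw n.+3 n.+2 A C [seq r + x0 | r <- rs].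
  rewrite big_map; apply => //.
    by rewrite map_inj_uniq //; apply: addIr.
  move=> _ _ /mapP[r rr ->] /mapP[r' rr' ->]; rewrite opprD addrACA subrr addr0.
  by move/rsI->.
have pos (r : V) : 0 <= #|` Ar r|%:R :> R by [].
have Pgt0 : 0 < (p * q) ^+ 2 by rewrite exprn_gt0 //; exact: lt_le_trans ltr01 pq1.
have IHr r : H * #|` Ar r|%:R <= #|` Sset T (Ar r)|%:R + ep * #|` Sset T (Ar r) +s B|%:R +
     H * tree_theta ^+ k * Num.sqrt (#|` Ar r|%:R * (v / (p * q) ^+ 2)).
  apply: (IH n.+2 _ (r + x0)) => //.
  - by move=> a; rewrite mem_cl => /andP[].
  - by rewrite divr_ge0 // ltW.
  move=> y; rewrite ler_pdivlMr // -mulrA -exprD addn2 -doubleS.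
  apply: le_trans (dens y); rewrite ler_wpM2r ?exprn_ge0 //; first by rewrite (le_trans _ pq1).
  rewrite ler_nat; apply/fsubset_leq_card/fsubsetP=> a; rewrite !mem_cl => /andP[/andP[-> _] ->] //.
rewrite -sumA mulr_sumr; apply: le_trans (ler_sum _ (fun r _ => IHr r)) _.
rewrite !big_split /= -!mulr_sumr sumA.
apply: lerD.
  apply: lerD; last by rewrite ler_wpM2l //; apply: supadd => b /BU/mU.
  have := supadd [fset 0]; rewrite sumfs0 => h.
  apply: le_trans (h _); last by move=> b; rewrite inE => /eqP->; rewrite rpred0.
  by apply: ler_sum => r _; rewrite sumfs0.
rewrite [tree_theta ^+ k.+1]exprSr (mulrA H) -[H * _ * tree_theta * _]mulrA.
apply: ler_wpM2l; first by apply: mulr_ge0 => //; exact: exprn_ge0.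
have [r0 r0s hr0] := rsC _ x1U.
have := @sum_sqrt_imbalance R V rs (fun r => #|` Ar r|%:R) tree_c r0.
rewrite /= sumA rszR => /(_ (fun r => ler0n _ _) a0 r0s (ltW tree_c_gt0)).
have -> : Ar r0 = cl (U n.+3 n.+3) A (x1 + x0).
  by apply: cl_eq; rewrite opprD addrACA subrr addr0 -opprB rpredN.
move=> /(_ (ltW hx1)) him.
have vP0 : 0 <= v / (p * q) ^+ 2 by rewrite divr_ge0 // ltW.
under eq_bigr do rewrite sqrtrM //.
rewrite -mulr_suml; apply: le_trans (ler_wpM2r (sqrtr_ge0 _) him) _.
rewrite -/tree_theta -mulrA -sqrtrM; last by rewrite mulr_ge0 // ltW.
rewrite -[X in Num.sqrt X]mulrA [(p * q) ^+ 2 * _]mulrC divfK ?gt_eqF //.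
Qed.

(** [B0] provides the density bound of [tree]: translating a part of A_c in one U(m,m)-class by
    elements of [B0] from all (pq)^(2k) classes gives disjoint subsets of A_c + B0. Cauchy-Schwarz
    then adds up the losses of the classes modulo U(1,1). *)
Theorem tower_sumset k m (A B0 : {fset V}) : m = k.*2.+1 ->
  (forall b, b \in B -> b \in U m m) -> (forall b, b \in B0 -> b \in U 1 1) ->
  (forall x, x \in U 1 1 -> exists2 b, b \in B0 & x - b \in U m m) ->
  H * #|` A|%:R <= #|` Sset T A|%:R + ep * #|` Sset T A +s B|%:R +
     H * tree_theta ^+ k * Num.sqrt (#|` A|%:R * #|` A +s B0|%:R).
Proof.
move=> hm BU B0U B0c.
have H0 : 0 <= H by rewrite exprn_ge0 // addr_ge0.
have /andP[th0 th1] := tree_theta_bounds.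
have mU : {subset U m m <= U 1 1}.
  rewrite hm -addn1; exact: (@twrS _ _ _ _ _ _ _ _ tw k.*2 k.*2 1 1).
have [cs [ucs csA csC csI]] := class_reps (U 1 1) A.
pose Ac c := cl (U 1 1) A c; pose v c : R := #|` Ac c +s B0|%:R.
have dens c y : #|` cl (U m m) (Ac c) y|%:R * (p * q) ^+ k.*2 <= v c.
  have [rs rsz [urs rsU rsC rsI]] := repsAB tw k.*2 k.*2 1 1.
  have mE : (k.*2 + 1)%N = m by rewrite addn1.
  move: rsU rsC rsI; rewrite mE => rsU rsC rsI.
  have /choice[f fP] : forall r, exists b, r \in rs -> b \in B0 /\ r - b \in U m m.
    move=> r; have [/rsU/B0c[b bB h]|_] := boolP (r \in rs); [by exists b | by exists 0].
  have := @card_disjoint_le _ _ rs (fun r => cl (U m m) (Ac c) y +s [fset f r]) (Ac c +s B0) urs.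
  have h1 i : i \in rs -> cl (U m m) (Ac c) y +s [fset f i] `<=` Ac c +s B0.
    by move=> /fP[fB _]; apply: sumfsS; rewrite ?cl_sub // fsub1set.
  move=> /(_ h1) {h1} h2.
  have h3 i j x : i \in rs -> j \in rs -> x \in cl (U m m) (Ac c) y +s [fset f i] ->
      x \in cl (U m m) (Ac c) y +s [fset f j] -> i = j.
    move=> ii jj; have key l : l \in rs -> x \in cl (U m m) (Ac c) y +s [fset f l] -> x - (y + l) \in U m m.
      move=> /fP[_ h] /sumfsP[z [b [+ + ->]]]; rewrite mem_cl inE => /andP[_ zy] /eqP->.
      by rewrite opprD addrACA; apply: rpredD => //; rewrite -opprB rpredN.
    move=> /(key _ ii) k1 /(key _ jj) k2; apply: rsI => //.
    have -> : i - j = (x - (y + j)) - (x - (y + i)).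
      by rewrite opprB [RHS]addrC addrA subrK opprD [RHS]addrACA subrr add0r.
    exact: rpredB.
  have := h2 h3; rewrite (eq_bigr (fun=> #|` cl (U m m) (Ac c) y|)) => [|r _]; last exact: card_sumfs1.
  rewrite big_const_seq count_predT iter_addn_0 -/(size rs) rsz -(ler_nat R).
  by rewrite natrM natrM !natrX exprMn.
have tr c : H * #|` Ac c|%:R <= #|` Sset T (Ac c)|%:R + ep * #|` Sset T (Ac c) +s B|%:R +
     H * tree_theta ^+ k * Num.sqrt (#|` Ac c|%:R * v c).
  have mE : m = (k.*2 + 1)%N by rewrite addn1.
  apply: (@tree k 0 m _ c (v c) mE BU); [|by []|exact: (dens c)].
  by move=> a; rewrite mem_cl => /andP[].
have sumA : #|` A|%:R <= \sum_(c <- cs) #|` Ac c|%:R :> R.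
  rewrite -natr_sum ler_nat; apply: card_cover_le => a aA; have [c cc h] := csC a aA.
  by exists c => //; rewrite mem_cl aA.
have sumA' : \sum_(c <- cs) #|` Ac c|%:R <= #|` A|%:R :> R.
  rewrite -natr_sum ler_nat; apply: card_disjoint_le => // [c _|c c' a cc cc']; first exact: cl_sub.
  rewrite !mem_cl => /andP[_ h1] /andP[_ h2]; apply: csI => //.
  have -> : c - c' = (a - c') - (a - c) by rewrite opprB [RHS]addrC addrA subrK.
  exact: rpredB.
have sumv : \sum_(c <- cs) v c <= #|` A +s B0|%:R.
  rewrite /v -natr_sum ler_nat; apply: card_disjoint_le => // [c _|c c' a cc cc'].
    by apply: sumfsS => //; apply: cl_sub.
  have key e : a \in Ac e +s B0 -> a - e \in U 1 1.
    move=> /sumfsP[x [b [+ /B0U bU ->]]]; rewrite mem_cl => /andP[_ h].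
    by rewrite addrAC; apply: rpredD.
  move=> /key h1 /key h2; apply: csI => //.
  have -> : c - c' = (a - c') - (a - c) by rewrite opprB [RHS]addrC addrA subrK.
  exact: rpredB.
have supadd (C : {fset V}) : (forall b, b \in C -> b \in U 1 1) ->
    \sum_(c <- cs) #|` Sset T (Ac c) +s C|%:R <= #|` Sset T A +s C|%:R :> R.
  by move=> CU; rewrite -natr_sum ler_nat; apply: (@Sset_superadd _ _ _ _ _ _ _ _ tw 1 0).
apply: le_trans (ler_wpM2l H0 sumA) _.
rewrite mulr_sumr; apply: le_trans (ler_sum _ (fun c _ => tr c)) _.
rewrite !big_split /= -!mulr_sumr; apply: lerD.
  apply: lerD; last by rewrite ler_wpM2l //; apply: supadd => b /BU/mU.
  have := supadd [fset 0]; rewrite sumfs0 => h.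
  apply: le_trans (h _); last by move=> b; rewrite inE => /eqP->; rewrite rpred0.
  by apply: ler_sum => r _; rewrite sumfs0.
apply: ler_wpM2l; first by apply: mulr_ge0 => //; exact: exprn_ge0.
apply: le_trans (@sum_sqrt_cs R _ cs (fun c => #|` Ac c|%:R) v _ _) _ => //.
by rewrite ler_sqrt ?mulr_ge0 // ler_pM // sumr_ge0.
Qed.

End Tree.

(** * The tower of a coprime pair *)

Section IntMatrices.
Local Notation iv := (map_mx (intr : int -> rat)).

Lemma iv_inj m n : injective (iv : 'M[int]_(m, n) -> 'M[rat]_(m, n)).
Proof.
move=> A B /matrixP E; apply/matrixP=> i j; apply: (@intr_inj rat).
by have := E i j; rewrite !mxE.
Qed.

Lemma common_denominator m n (Q : 'M[rat]_(m, n)) :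
  exists (N : nat) (A : 'M[int]_(m, n)), (0 < N)%N /\ N%:R *: Q = iv A.
Proof.
pose N := (\prod_i \prod_j `|denq (Q i j)|)%N.
have N0 : (0 < N)%N.
  by apply: prodn_gt0 => i; apply: prodn_gt0 => j; rewrite absz_gt0 denq_neq0.
have dv i j : (`|denq (Q i j)| %| N)%N.
  rewrite /N (bigD1 i) //= dvdn_mulr // (bigD1 j) //= dvdn_mulr //.
exists N, (\matrix_(i, j) (numq (Q i j) * (N %/ `|denq (Q i j)|)%N%:Z)); split=> //.
apply/matrixP=> i j; rewrite !mxE -{1}[Q i j]divq_num_den rmorphM /=.
have dE : (denq (Q i j))%:~R = (`|denq (Q i j)|%N)%:R :> rat.
  by rewrite -[in LHS](gez0_abs (ltW (denq_gt0 _))).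
have d0 : (`|denq (Q i j)|%N)%:R != 0 :> rat by rewrite pnatr_eq0 absz_eq0 denq_neq0.
rewrite dE -{1}(divnK (dv i j)) natrM.
have -> (k : nat) : (k%:Z)%:~R = k%:R :> rat by [].
by move: d0; set x := (_ %/ _)%:R; set y := _%:R; set z := _%:~R => y0; field.
Qed.

Lemma absz_det_unit n (L : 'M[int]_n) : L \in unitmx -> `|\det L|%N = 1%N.
Proof.
rewrite unitmxE => /[dup] h; rewrite unitrE => /eqP/(congr1 absz).
by rewrite abszM => /eqP; rewrite muln_eq1 => /andP[/eqP].
Qed.

(** |det M| is the index of M Z^d when it is nonzero: in Smith coordinates the integer points with
    i-th entry in [0, |e_i|) are |det M| vectors, pairwise incongruent, so they require different
    elements of [s]. *)
Lemma det_cover d (M : 'M[int]_d) (s : seq 'cV[rat]_d) :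
  (forall z : 'cV[int]_d, exists r y, r \in s /\ iv z = r + iv (M *m y)) ->
  (`|\det M| <= size s)%N.
Proof.
move=> cov; have [L Lu [R Ru [e _ ME]]] := int_Smith_normal_form M.
set D := \matrix_(i, j) _ in ME.
have detM : (`|\det M| = \prod_(i < d) `|(e`_i)%R|)%N.
  rewrite ME !det_mulmx !abszM (absz_det_unit Lu) (absz_det_unit Ru) mul1n muln1.
  rewrite det_trig; last first.
    by apply/is_trig_mxP=> i j ij; rewrite mxE (ltn_eqF ij) mulr0n.
  rewrite (big_morph absz abszM (absz1 : `|1|%N = 1%N)); apply: eq_bigr => i _.
  by rewrite mxE eqxx mulr1n.
pose N := (\sum_(i < d) `|(e`_i)%R|).+1%N.
have eN (i : 'I_d) : (`|(e`_i)%R| <= N)%N by rewrite /N (bigD1 i) //= -addnS leq_addr.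
pose F (i : 'I_d) := [pred j : 'I_N | (j < `|(e`_i)%R|)%N].
have cF : #|family F| = `|\det M|%N.
  rewrite card_family detM.
  have cFi i : #|F i| = `|(e`_i)%R|%N.
    by rewrite -sum1_card (big_ord_narrow (eN i)) /= sum1_card card_ord.
  by rewrite foldrE big_map big_enum /=; apply: eq_bigr => i _; apply: cFi.
have /choice[g gP] : forall z, exists r, r \in s /\ exists y, iv z = r + iv (M *m y).
  by move=> z; have [r [y [rs E]]] := cov z; exists r; split=> //; exists y.
pose vec (f : {ffun 'I_d -> 'I_N}) : 'cV[int]_d := \col_i (f i : nat)%:Z.
pose G f := g (L *m vec f).
rewrite -cF cardE -(size_map G).
apply: uniq_leq_size; last by move=> _ /mapP[f _ ->]; case: (gP (L *m vec f)).
rewrite map_inj_in_uniq ?enum_uniq // => f f'; rewrite !mem_enum => /familyP fF /familyP f'F E.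
have [_ [y Ey]] := gP (L *m vec f); have [_ [y' Ey']] := gP (L *m vec f').
have : iv (L *m (vec f - vec f')) = iv (M *m (y - y')).
  have E2 : g (L *m vec f) = g (L *m vec f') by [].
  by rewrite !mulmxBr !map_mxB Ey Ey' E2 opprD addrACA subrr add0r.
move=> /iv_inj E1.
have : vec f - vec f' = D *m (R *m (y - y')).
  have := congr1 (mulmx (invmx L)) E1; rewrite mulKmx // ME -!mulmxA mulKmx //.
set w := R *m _ => E3; clearbody w; apply/ffunP=> i; apply/val_inj => /=.
have D0 j : j != i -> D i j = 0.
  by move=> ji; rewrite mxE; case: eqP => // /val_inj ij; rewrite ij eqxx in ji.
have := congr1 (fun v : 'cV_d => v i 0) E3; rewrite mxE [RHS]mxE (bigD1 i) //=.
rewrite big1 => [|j /D0->]; last by rewrite mul0r.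
have -> : D i i = e`_i by rewrite mxE eqxx mulr1n.
rewrite addr0 !mxE; have := fF i; have := f'F i; rewrite !inE.
move: (f i : nat) (f' i : nat) (e`_i) (w i 0).
clear=> a b c z hb ha E; have [z0|z0] := eqVneq z 0.
  by move: E; rewrite z0 mulr0; lia.
have : (`|c| <= `|(c * z)%R|)%N by rewrite abszM leq_pmulr // absz_gt0.
by rewrite -E; lia.
Qed.

(** The group is the image of the d x 2d matrix (Q1 | Q2). Once denominators are cleared, its Smith
    form vanishes outside the first d columns, and these give [Q]; it is invertible because Q1 = Q
    C. *)
Lemma lattice_sum d (Q1 Q2 : 'M[rat]_d) : Q1 \in unitmx ->
  exists2 Q, Q \in unitmx & forall x : 'cV[rat]_d,
   (exists z1 z2, x = Q1 *m iv z1 + Q2 *m iv z2) <-> exists z, x = Q *m iv z.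
Proof.
move=> Q1u; have [N [A [N0 QA]]] := common_denominator (row_mx Q1 Q2).
have Nn0 : N%:R != 0 :> rat by rewrite pnatr_eq0 -lt0n.
have [L Lu [R Ru [e _ ME]]] := int_Smith_normal_form A.
pose Dg : 'M[int]_d := \matrix_(i, j) (e`_i *+ (i == j :> nat)).
have DE : \matrix_(i, j) (e`_i *+ (i == j :> nat)) = row_mx Dg (0 : 'M_(d, d)).
  apply/matrixP=> i j; rewrite !mxE; case: splitP => k jk; rewrite !mxE jk //.
  by rewrite ltn_eqF ?mulr0n // ltn_addr.
pose G := L *m Dg.
have AG : A = G *m usubmx R.
  by rewrite ME DE -{1}[R]vsubmxK -mulmxA mul_row_col mul0mx addr0 mulmxA.
have GA : G = A *m (invmx R *m col_mx 1%:M 0).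
  by rewrite ME DE mulmxA mulmxK // -mulmxA mul_row_col mul0mx addr0 mulmx1.
have Q12 (z1 z2 : 'cV_d) : N%:R *: (Q1 *m iv z1 + Q2 *m iv z2) = iv (A *m col_mx z1 z2).
  by rewrite map_mxM -QA map_col_mx -mul_row_col -scalemxAl.
pose Q : 'M[rat]_d := N%:R^-1 *: iv G.
have QE (z : 'cV[int]_d) : Q *m iv z = (N%:R^-1 : rat) *: iv (G *m z) :> 'cV[rat]_d.
  by rewrite /Q -scalemxAl (map_mxM _ G).
have scN (x y : 'cV[rat]_d) : N%:R *: x = y -> x = N%:R^-1 *: y.
  by move=> <-; rewrite scalerA mulVf // scale1r.
have equiv (x : 'cV[rat]_d) : (exists z1 z2, x = Q1 *m iv z1 + Q2 *m iv z2) <-> exists z, x = Q *m iv z.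
  split=> [[z1 [z2 E]]|[z E]].
    exists (usubmx R *m col_mx z1 z2); apply: etrans (esym (QE _)); rewrite mulmxA -AG; apply: scN.
    by rewrite E Q12.
  pose y := invmx R *m col_mx 1%:M 0 *m z.
  exists (usubmx y), (dsubmx y); apply: etrans E _; apply: etrans (QE _) _; apply/esym/scN.
  by rewrite Q12 vsubmxK GA -mulmxA.
exists Q => //.
have : exists C, Q1 = Q *m C.
  exists (iv (usubmx R *m col_mx 1%:M 0)).
  rewrite /Q -scalemxAl -map_mxM mulmxA -AG map_mxM -QA map_col_mx map_mx1 map_mx0.
  by rewrite -scalemxAl mul_row_col mulmx1 mulmx0 addr0 scalerA mulVf // scale1r.
by case=> C QC; move: Q1u; rewrite QC unitmx_mul => /andP[].
Qed.

End IntMatrices.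

(** * The module Z[T] Lam and its localisation at 1 + T *)

Section KGroup.
Variables (V : zmodType) (T : {additive V -> V}) (Lam : zmodClosed V).

(** The group Lam + T Lam + ... + T^m Lam. The length is recorded because for Lam = Z^d each of
    these is a lattice, while their union need not be one. *)
Fixpoint tspan m (x : V) : Prop :=
  if m is m'.+1 then exists l y, [/\ l \in Lam, tspan m' y & x = l + T y] else x \in Lam.

Lemma tspan0 m : tspan m 0.
Proof. by elim: m => [|m IH] /=; [exact: rpred0 | exists 0, 0; rewrite rpred0 raddf0 addr0]. Qed.

Lemma tspanB m x y : tspan m x -> tspan m y -> tspan m (x - y).
Proof.
elim: m x y => [|m IH] x y /=; first exact: rpredB.
move=> [l [u [lL uX ->]]] [l' [u' [lL' uX' ->]]]; exists (l - l'), (u - u').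
by split; [exact: rpredB | exact: IH | rewrite raddfB opprD addrACA].
Qed.

Lemma tspanD m x y : tspan m x -> tspan m y -> tspan m (x + y).
Proof. by move=> xX yX; rewrite -[y]opprK -[- y]sub0r; apply/tspanB/tspanB => //; apply: tspan0. Qed.

Lemma tspanS m x : tspan m x -> tspan m.+1 x.
Proof.
elim: m x => [|m IH] x; first by move=> xL; exists x, 0; rewrite raddf0 addr0; split=> //; exact: rpred0.
by move=> [l [y [lL /IH yX ->]]]; exists l, y.
Qed.

Lemma tspan_leq m m' x : (m <= m')%N -> tspan m x -> tspan m' x.
Proof. by move=> /subnKC<-; elim: (m' - m)%N => [|k IH]; rewrite ?addn0 // addnS => /IH/tspanS. Qed.

Lemma tspanT m x : tspan m x -> tspan m.+1 (T x).
Proof. by move=> xX; exists 0, x; rewrite rpred0 add0r. Qed.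

Definition tmod x := exists m, tspan m x.

Lemma tmodB x y : tmod x -> tmod y -> tmod (x - y).
Proof.
move=> [m xm] [m' ym]; exists (maxn m m'); apply: tspanB.
  exact: tspan_leq (leq_maxl _ _) xm.
exact: tspan_leq (leq_maxr _ _) ym.
Qed.

Lemma tmod0 : tmod 0. Proof. by exists 0%N; apply: tspan0. Qed.

Lemma tmodD x y : tmod x -> tmod y -> tmod (x + y).
Proof. by move=> xJ yJ; rewrite -[y]opprK -[- y]sub0r; apply/tmodB/tmodB => //; apply: tmod0. Qed.

Lemma tmodT x : tmod x -> tmod (T x).
Proof. by move=> [m xm]; exists m.+1; apply: tspanT. Qed.

Definition onep (x : V) := x + T x.

Lemma onepB n x y : iter n onep (x - y) = iter n onep x - iter n onep y.
Proof. by elim: n => //= n ->; rewrite /onep raddfB opprD addrACA. Qed.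

Lemma onepT n x : iter n onep (T x) = T (iter n onep x).
Proof. by elim: n => //= n ->; rewrite /onep raddfD. Qed.

Lemma tmod_onep n x : tmod x -> tmod (iter n onep x).
Proof. by elim: n => //= n IH /IH h; apply: tmodD => //; apply: tmodT. Qed.

(* The localisation of Z[T].Lam at the powers of 1 + T. *)
Definition kgrp : {pred V} := [pred x | `[< exists n, tmod (iter n onep x) >]].

Lemma kgrpP x : reflect (exists n, tmod (iter n onep x)) (x \in kgrp).
Proof. exact: asboolP. Qed.

Lemma kgrp_closed : zmod_closed kgrp.
Proof.
split; first by apply/kgrpP; exists 0%N; apply: tmod0.
move=> x y /kgrpP[n xn] /kgrpP[n' yn]; apply/kgrpP; exists (n + n')%N.
rewrite onepB; apply: tmodB; last by rewrite iterD; apply: tmod_onep.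
by rewrite addnC iterD; apply: tmod_onep.
Qed.
HB.instance Definition _ := GRing.isZmodClosed.Build V kgrp kgrp_closed.

Lemma tmod_kgrp x : tmod x -> x \in kgrp.
Proof. by move=> xJ; apply/kgrpP; exists 0%N. Qed.

Lemma lam_kgrp x : x \in Lam -> x \in kgrp.
Proof. by move=> xL; apply: tmod_kgrp; exists 0%N. Qed.

Lemma kgrp_T x : x \in kgrp -> T x \in kgrp.
Proof. by move=> /kgrpP[n xn]; apply/kgrpP; exists n; rewrite onepT; apply: tmodT. Qed.

Lemma kgrp_div x y : onep y = x -> x \in kgrp -> y \in kgrp.
Proof. by move=> <- /kgrpP[n xn]; apply/kgrpP; exists n.+1; rewrite iterSr. Qed.

Variable T' : {additive V -> V}.
Hypotheses (TK : cancel T T') (TK' : cancel T' T).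

(** K = Lam + T K. This is plain on Z[T] Lam; in general, induct on the power of 1 + T through x =
    (x + T x) - T x. *)
Lemma kgrp_cov x : x \in kgrp -> exists2 l, l \in Lam & T' (x - l) \in kgrp.
Proof.
move=> /kgrpP[n]; elim: n x => [|n IH] x.
  move=> [[|m] /= xm]; first by exists x => //; rewrite subrr raddf0 rpred0.
  case: xm => l [y [lL ym ->]]; exists l => //; rewrite addrAC subrr add0r TK.
  by apply: tmod_kgrp; exists m.
rewrite iterSr => h; have [l lL hl] := IH _ h; exists l => //.
have xK : x \in kgrp by apply/kgrpP; exists n.+1; rewrite iterSr.
have -> : T' (x - l) = T' (onep x - l) - x.
  by rewrite /onep [x + T x - l]addrAC (raddfD T' (x - l)) /= TK addrK.
exact: rpredB.
Qed.

(** For k = T' l the vector T k is in Lam, so (1 + T)^n k = (1 + T)^(n+1) k - (1 + T)^n (T k) lowers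
    the power of 1 + T until it is 0. *)
Lemma lam_kgrp_tmod l : l \in Lam -> T' l \in kgrp -> tmod (T' l).
Proof.
move=> lL /kgrpP[n]; set k := T' l; have Tk : tmod (T k) by rewrite TK'; exists 0%N.
elim: n => //= n IH h; apply: IH; move: h; rewrite /onep -onepT => h.
by rewrite -[iter n _ k](addrK (iter n onep (T k))); apply: tmodB => //; apply: tmod_onep.
Qed.

Lemma fset_uniform (B : {fset V}) (P : V -> nat -> Prop) :
  (forall c m m', (m <= m')%N -> P c m -> P c m') ->
  (forall c, c \in B -> exists m, P c m) -> exists m, forall c, c \in B -> P c m.
Proof.
move=> Pm; elim/finSet_rect: B => B IH h.
have [->|/fset0Pn[c cB]] := eqVneq B fset0; first by exists 0%N => c; rewrite inE.
have [m hm] : exists m, forall c', c' \in B `\ c -> P c' m.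
  by apply: IH; [exact: fproperD1 | move=> c'; rewrite inE => /andP[_ /h]].
have [m' hm'] := h c cB; exists (maxn m m') => c' c'B.
have [->|nc] := eqVneq c' c; first exact: Pm (leq_maxr _ _) hm'.
by apply: Pm (leq_maxl _ _) _; apply: hm; rewrite !inE nc.
Qed.

Definition kgrp1 : {pred V} := [pred x | T' x \in kgrp].
Lemma kgrp1_closed : zmod_closed kgrp1.
Proof.
split; first by change (T' 0 \in kgrp); rewrite raddf0 rpred0.
by move=> x y h1 h2; change (T' (x - y) \in kgrp); rewrite raddfB; apply: rpredB.
Qed.
HB.instance Definition _ := GRing.isZmodClosed.Build V kgrp1 kgrp1_closed.

(** The last clause brings K / T K down to lattices: at a finite level the same representatives
    cover tspan (m+1) modulo T tspan m, and the index of lattices is a determinant. *)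
Lemma kgrp_reps (B : {fset V}) : (forall b, b \in B -> b \in Lam) ->
  (forall l, l \in Lam -> exists2 b, b \in B & T' (l - b) \in Lam) ->
  exists (ras : seq V) (m : nat), [/\ uniq ras, {subset ras <= Lam},
    (forall x, x \in kgrp -> exists2 r, r \in ras & T' (x - r) \in kgrp),
    (forall r r', r \in ras -> r' \in ras -> T' (r - r') \in kgrp -> r = r') &
    forall x, tspan m.+1 x -> exists2 r, r \in ras & tspan m (T' (x - r))].
Proof.
move=> BL Bc; have [cs [ucs csB csC csI]] := class_reps kgrp1 B.
have csL : {subset cs <= Lam} by move=> c /csB/BL.
have [m hm] : exists m, forall b, b \in B -> exists2 r, r \in cs & tspan m (T' (b - r)).
  apply: (@fset_uniform B (fun b m => exists2 r, r \in cs & tspan m (T' (b - r)))).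
    by move=> c m m' mm [r rr h]; exists r => //; apply: tspan_leq mm h.
  move=> b bB; have [r rr h] := csC b bB.
  have [m hm] : tmod (T' (b - r)).
    by apply: lam_kgrp_tmod => //; apply: rpredB; [apply: BL | apply: csL].
  by exists m, r.
exists cs, m; split=> // [x /kgrp_cov[l lL h]|x /= [l [y [lL yX ->]]]].
  have [b bB hb] := Bc _ lL; have [r rr hr] := csC _ bB; exists r => //.
  rewrite -[x - r](subrKA l) raddfD rpredD // -[l - r](subrKA b) raddfD rpredD //.
  exact: lam_kgrp.
have [b bB hb] := Bc _ lL; have [r rr hr] := hm _ bB; exists r => //.
have -> : l + T y - r = T y + ((l - b) + (b - r)) by rewrite subrKA [l + T y]addrC addrA.
rewrite (raddfD T' (T y)) (raddfD T' (l - b)) /= TK; apply: tspanD => //.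
by apply: tspanD => //; apply: (tspan_leq (leq0n _)).
Qed.

End KGroup.

Section RatTower.
Variable d : nat.
Local Notation iv := (map_mx (intr : int -> rat)).

Definition lamZ : {pred 'cV[rat]_d} := [pred x | `[< exists z : 'cV[int]_d, x = iv z >]].

Lemma lamZP x : reflect (exists z : 'cV[int]_d, x = iv z) (x \in lamZ).
Proof. exact: asboolP. Qed.

Lemma lamZ_closed : zmod_closed lamZ.
Proof.
split; first by apply/lamZP; exists 0; rewrite map_mx0.
by move=> x y /lamZP[z ->] /lamZP[w ->]; apply/lamZP; exists (z - w); rewrite map_mxB.
Qed.
HB.instance Definition _ := GRing.isZmodClosed.Build _ lamZ lamZ_closed.

Definition coprime_bound (M1 M2 : 'M[rat]_d) := forall P Q : 'M[rat]_d,
  P \in unitmx -> Q \in unitmx ->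
  (exists N1, P *m M1 *m Q = iv N1) -> (exists N2, P *m M2 *m Q = iv N2) ->
  1 <= `|\det P * \det Q|.

Definition mxmul (M : 'M[rat]_d) : {additive 'cV[rat]_d -> 'cV[rat]_d} := mulmx M.

Lemma tspan_lattice (Tm : 'M[rat]_d) m : exists2 Q, Q \in unitmx &
  forall x, tspan (mxmul Tm) lamZ m x <-> exists z, x = Q *m iv z.
Proof.
elim: m => [|m [Q Qu IH]].
  exists 1%:M; first exact: unitmx1.
  by move=> x; split=> [/lamZP[z ->]|[z ->]]; [exists z; rewrite mul1mx | apply/lamZP; exists z; rewrite mul1mx].
have [Q' Q'u h] := lattice_sum (Tm *m Q) (unitmx1 rat d); exists Q' => // x.
rewrite -h; split.
  move=> [l [y [/lamZP[z ->] /IH[w ->] ->]]]; exists z, w.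
  by rewrite mul1mx /mxmul /= mulmxA.
move=> [z [w ->]]; exists (iv z), (Q *m iv w); split; first by apply/lamZP; exists z.
  by apply/IH; exists w.
by rewrite mul1mx /mxmul /= mulmxA.
Qed.

Variables (L1 L2 : 'M[int]_d).
Local Notation M1 := (iv L1).
Local Notation M2 := (iv L2).
Hypotheses (u1 : M1 \in unitmx) (u2 : M2 \in unitmx).
Hypothesis cop : coprime_bound M1 M2.
Let Tm := invmx M1 *m M2.
Let T'm := invmx M2 *m M1.

Lemma TmK : cancel (mxmul Tm) (mxmul T'm).
Proof. by move=> x; rewrite /mxmul /= /Tm /T'm -!mulmxA mulKVmx // mulKmx. Qed.

Lemma TmK' : cancel (mxmul T'm) (mxmul Tm).
Proof. by move=> x; rewrite /mxmul /= /Tm /T'm -!mulmxA mulKVmx // mulKmx. Qed.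

Lemma det2_neq0 : \det L2 != 0.
Proof.
move: u2; rewrite unitmxE unitfE; apply: contraNneq => h.
by rewrite det_map_mx h.
Qed.

(** Let Q Z^d = tspan m, Q' Z^d = tspan (m+1) and P = (L1 Q')^-1. Since Q Z^d and T Q Z^d lie in Q'
    Z^d, the matrices P L1 Q and P L2 Q are integral, and coprimality gives |det P det Q| >= 1. So
    the index of T tspan m in tspan (m+1), which is |det (P L2 Q)|, is at least |det L2|, and [ras]
    covers that quotient. *)
Lemma kgrp_reps_rat : exists ras : seq 'cV[rat]_d,
  [/\ uniq ras, {subset ras <= lamZ},
    (forall x, x \in kgrp (mxmul Tm) lamZ -> exists2 r, r \in ras & mxmul T'm (x - r) \in kgrp (mxmul Tm) lamZ),
    (forall r r', r \in ras -> r' \in ras -> mxmul T'm (r - r') \in kgrp (mxmul Tm) lamZ -> r = r') &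
    (`|\det L2| <= size ras)%N].
Proof.
set D := \det L2; have D0 := det2_neq0; rewrite -/D in D0.
(* Residues modulo D = det L2 suffice: T' maps D Z^d into Z^d, as D L2^-1 is the adjugate of L2. *)
pose vec (f : {ffun 'I_d -> 'I_`|D|}) : 'cV[rat]_d := iv (\col_i (f i : nat)%:Z).
pose B : {fset 'cV[rat]_d} := [fset vec f | f in predT].
have BL b : b \in B -> b \in lamZ.
  by case/imfsetP=> f _ ->; apply/lamZP; eexists.
have Bc l : l \in lamZ -> exists2 b, b \in B & mxmul T'm (l - b) \in lamZ.
  case/lamZP=> z ->.
  have ltD i : (`|modz (z i 0%R) D| < `|D|)%N.
    by have := ltz_mod (z i 0) D0; have := modz_ge0 (z i 0) D0; lia.
  pose f : {ffun 'I_d -> 'I_`|D|} := [ffun i => Ordinal (ltD i)].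
  exists (vec f); first by apply/imfsetP; exists f.
  pose y : 'cV[int]_d := \col_i divz (z i 0) D.
  have -> : iv z - vec f = iv (D *: y).
    rewrite /vec -map_mxB; congr (iv _); apply/matrixP=> i j; rewrite !mxE ord1 ffunE /=.
    rewrite gez0_abs ?modz_ge0 // {1}(divz_eq (z i 0) D); ring.
  apply/lamZP; exists (\adj L2 *m (L1 *m y)).
  rewrite /mxmul /= /T'm map_mxZ -scalemxAr scalemxAl scalemxAl.
  have -> : (D%:~R : rat) *: invmx M2 = iv (\adj L2).
    rewrite /invmx u2 scalerA det_map_mx mulfV ?scale1r ?intr_eq0 //.
    by rewrite map_mx_adj.
  by rewrite !map_mxM mulmxA.
have [ras [m [r1 r2 r3 r4 r5]]] := kgrp_reps TmK TmK' BL Bc.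
exists ras; split=> //.
have [Q Qu hQ] := tspan_lattice Tm m; have [Q' Q'u hQ'] := tspan_lattice Tm m.+1.
pose P := invmx (M1 *m Q').
have P'u : M1 *m Q' \in unitmx by rewrite unitmx_mul u1.
have Pu : P \in unitmx by rewrite unitmx_inv.
have intM (N : 'M[rat]_d) : (forall z : 'cV[int]_d, tspan (mxmul Tm) lamZ m.+1 (invmx M1 *m N *m iv z)) ->
    exists N' : 'M[int]_d, P *m N = iv N'.
  move=> h; have /choice[g gP] : forall j : 'I_d, exists w : 'cV[int]_d, P *m N *m iv (delta_mx j 0) = iv w.
    move=> j; have /hQ'[w Ew] := h (delta_mx j 0); exists w.
    have : N *m iv (delta_mx j 0) = M1 *m Q' *m iv w.
      by rewrite -mulmxA -Ew -mulmxA mulKVmx.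
    by move=> E; rewrite -(mulmxA P N) E mulKmx.
  exists (\matrix_(i, j) g j i 0); apply/matrixP=> i j.
  have := congr1 (fun v : 'cV[rat]_d => v i 0) (gP j).
  by rewrite map_delta_mx -colE ![_ i 0]mxE => ->; rewrite !mxE.
have [N1 EN1] : exists N1 : 'M[int]_d, P *m (M1 *m Q) = iv N1.
  apply: intM => z; rewrite mulKmx //; apply: tspanS.
  by apply/hQ; exists z.
have [N2 EN2] : exists N2 : 'M[int]_d, P *m (M2 *m Q) = iv N2.
  apply: intM => z; rewrite (mulmxA (invmx M1)) -/Tm -mulmxA.
  apply: (tspanT (T := mxmul Tm)).
  by apply/hQ; exists z.
have bound := cop Pu Qu (ex_intro _ N1 (etrans (esym (mulmxA _ _ _)) EN1)) 
   (ex_intro _ N2 (etrans (esym (mulmxA _ _ _)) EN2)).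
have detN2 : (`|D| <= `|\det N2|)%N.
  rewrite -(ler_nat rat) !natr_absz !intr_norm.
  have -> : (\det N2)%:~R = \det P * \det Q * D%:~R :> rat.
    by rewrite -det_map_mx -EN2 !det_mulmx det_map_mx mulrA mulrAC.
  by rewrite normrM ler_peMl.
apply: leq_trans detN2 _.
rewrite -(size_map (mulmx (invmx Q'))); apply: det_cover => z.
have : tspan (mxmul Tm) lamZ m.+1 (Q' *m iv z) by apply/hQ'; exists z.
case/r5 => r rr /hQ[y Ey]; exists (invmx Q' *m r), y; split; first exact: map_f.
have : Q' *m iv z - r = Tm *m (Q *m iv y).
  by rewrite -Ey; apply/esym/TmK'.
move/(congr1 (mulmx (invmx Q'))); rewrite mulmxBr mulKmx // => /eqP.
rewrite subr_eq addrC => /eqP->; congr (_ + _).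
rewrite map_mxM -EN2 /P /Tm.
have -> : invmx (M1 *m Q') = invmx Q' *m invmx M1.
  by rewrite -[RHS]mulmx1 -(mulmxV P'u) !mulmxA mulmxKV // mulVmx // mul1mx.
by rewrite !mulmxA.
Qed.

End RatTower.
Arguments lamZ : clear implicits.

Section RatTowerMain.
Variables (d : nat) (L1 L2 : 'M[int]_d).
Local Notation iv := (map_mx (intr : int -> rat)).
Local Notation M1 := (iv L1).
Local Notation M2 := (iv L2).

Definition ratT := mxmul (invmx M1 *m M2).
Definition ratT' := mxmul (invmx M2 *m M1).
Definition ratR := mxmul (invmx (M1 + M2) *m M1).

Lemma rat_tower : M1 \in unitmx -> M2 \in unitmx -> M1 + M2 \in unitmx ->
  coprime_bound M1 M2 ->
  exists ras rbs, [/\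
    tower_axiom ratT ratT' ratR (kgrp ratT (lamZ d)) (kgrp ratT' (lamZ d)) ras rbs,
    {subset ras <= lamZ d}, {subset rbs <= lamZ d},
    (`|\det L2| <= size ras)%N & (`|\det L1| <= size rbs)%N].
Proof.
move=> u1 u2 u12 cop.
have cop' : coprime_bound M2 M1 by move=> P Q Pu Qu h1 h2; apply: cop.
have [ras [a1 a2 a3 a4 a5]] := kgrp_reps_rat u1 u2 cop.
have [rbs [b1 b2 b3 b4 b5]] := kgrp_reps_rat u2 u1 cop'.
have R2 x : ratR x + ratT (ratR x) = x.
  rewrite /ratR /ratT /mxmul /= -{1}[invmx (M1 + M2) *m M1 *m x](mulKmx u1).
  rewrite -[invmx M1 *m M2 *m _]mulmxA -mulmxDr -mulmxDl.
  by rewrite -[invmx (M1 + M2) *m _ *m _]mulmxA mulKVmx // mulKmx.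
have R1 x : ratR (x + ratT x) = x.
  rewrite /ratR /ratT /mxmul /= -{1}[x](mulKmx u1) -[invmx M1 *m M2 *m _]mulmxA.
  by rewrite -mulmxDr -mulmxDl -[invmx (M1 + M2) *m _ *m _]mulmxA mulKVmx // mulKmx.
exists ras, rbs; split; [|exact: a2|exact: b2|exact: a5|exact: b5].
apply: TowerAxiom; [exact: TmK | exact: TmK' | exact: R1 | exact: R2 | | | | | | ].
- exact: kgrp_T.
- by move=> x; apply: (@kgrp_div _ ratT); apply: R2.
- exact: kgrp_T.
- move=> x; apply: (@kgrp_div _ ratT').
  rewrite /onep (TmK u1 u2 : cancel ratT ratT') addrC; exact: R2.
- split; [exact: a1 | | | exact: a3 | exact: a4].
    by move=> r /a2; apply: lam_kgrp.
  by move=> r /a2; apply: lam_kgrp.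
- split; [exact: b1 | | | exact: b3 | exact: b4].
    by move=> r /b2; apply: lam_kgrp.
  by move=> r /b2; apply: lam_kgrp.
Qed.

End RatTowerMain.

(** * Long progressions in 2A - 2A *)

Section Bogolyubov.
Variables (N : nat) (z : algC).
Hypothesis zN : N.-primitive_root z.
Let N0 : (0 < N)%N := prim_order_gt0 zN.

Lemma prim_norm x : `|z ^+ x| = 1.
Proof.
rewrite normrX; have : `|z| ^+ N = 1 by rewrite -normrX (prim_expr_order zN) normr1.
by move=> /eqP; rewrite pexpr_eq1 // => /eqP->; rewrite expr1n.
Qed.

(** Exponents are natural numbers, so -x is written (N - 1) x here and below. *)
Lemma prim_conj x : (z ^+ x)^* = z ^+ (N.-1 * x).
Proof.
have z1 : z * z^* = 1 by rewrite -normCK -[z]expr1 prim_norm expr1n.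
have z2 : z * z ^+ N.-1 = 1 by rewrite -exprS prednK // (prim_expr_order zN).
have zn0 : z != 0 by apply: contra_eq_neq z1 => ->; rewrite mul0r eq_sym oner_eq0.
have -> : z ^+ (N.-1 * x) = (z^*) ^+ x by rewrite exprM; congr (_ ^+ _); apply: (mulfI zn0); rewrite z1 z2.
by rewrite rmorphXn.
Qed.

Lemma sum_prim_root x : \sum_(r < N) z ^+ (r * x) = if (N %| x)%N then N%:R else 0.
Proof.
have -> : \sum_(r < N) z ^+ (r * x) = \sum_(r < N) (z ^+ x) ^+ r.
  by apply: eq_bigr => r _; rewrite mulnC exprM.
case: ifP => nx.
  move: nx; rewrite (prim_order_dvd zN) => /eqP->.
  by rewrite (eq_bigr (fun=> 1)) ?sumr_const ?card_ord // => r _; rewrite expr1n.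
have := subrX1 (z ^+ x) N; rewrite -exprM mulnC exprM (prim_expr_order zN) expr1n subrr.
move/esym/eqP; rewrite mulf_eq0 subr_eq0 -(prim_order_dvd zN) nx /= => /eqP//.
Qed.

Variable B : seq nat.
Hypotheses (uB : uniq B) (BN : forall b, b \in B -> (b < N)%N).

Definition fou r : algC := \sum_(b <- B) z ^+ (r * b).

Lemma fou_conj r : (fou r)^* = \sum_(b <- B) z ^+ (r * (N.-1 * b)).
Proof.
rewrite rmorph_sum; apply: eq_bigr => b _ /=; rewrite prim_conj.
by rewrite mulnCA.
Qed.

Lemma fou0 : fou 0 = (size B)%:R.
Proof.
rewrite /fou (eq_bigr (fun=> 1)) ?big_const_seq ?count_predT ?iter_addr ?addr0 // => b _.
Qed.

Lemma parseval : \sum_(r < N) `|fou r| ^+ 2 = N%:R * (size B)%:R.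
Proof.
under eq_bigr => r _ do rewrite normCK fou_conj /fou big_distrlr /=.
rewrite exchange_big /=; under eq_bigr => b _ do rewrite exchange_big /=.
have -> : N%:R * (size B)%:R = \sum_(b <- B) (N%:R : algC).
  by rewrite big_const_seq count_predT iter_addr addr0 mulr_natr.
rewrite big_seq [RHS]big_seq; apply: eq_bigr => b bB.
have E c : c \in B -> \sum_(r < N) z ^+ (r * b) * z ^+ (r * (N.-1 * c)) = if c == b then N%:R else 0.
  move=> cB; under eq_bigr => r _ do rewrite -exprD -mulnDr.
  rewrite sum_prim_root; congr (if _ then _ else _).
  have E : (b + N.-1 * c + c = b + N * c)%N by rewrite -{2}(prednK N0) mulSn -addnA [(c + _)%N]addnC.
  apply/idP/eqP => [h|->]; last by rewrite -[X in (_ + X)%N]mulnC -mulnS prednK // dvdn_mull.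
  apply/eqP; rewrite -(modn_small (BN bB)) -(modn_small (BN cB)).
  move: h => /dvdnP[k hk]; rewrite -[(b %% N)%N](modnMDl c b N) mulnC addnC -E hk.
  by rewrite modnMDl eqxx.
rewrite big_seq (eq_bigr _ E) -big_seq (perm_big _ (perm_to_rem bB)) big_cons eqxx big1_seq => [|c]; first exact: addr0.
by rewrite mem_rem_uniq // inE => /andP[_ /andP[/negPf->]].
Qed.

Lemma fourth x : (forall b1 b2 b3 b4, b1 \in B -> b2 \in B -> b3 \in B -> b4 \in B ->
    ~~ (N %| b1 + b2 + x + N.-1 * (b3 + b4))%N) ->
  \sum_(r < N) `|fou r| ^+ 4 * z ^+ (r * x) = 0.
Proof.
move=> h.
have E (r : 'I_N) : `|fou r| ^+ 4 * z ^+ (r * x) =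
   \sum_(b1 <- B) \sum_(b2 <- B) \sum_(b3 <- B) \sum_(b4 <- B) z ^+ (r * (b1 + b2 + x + N.-1 * (b3 + b4))).
  rewrite (_ : `|fou r| ^+ 4 = fou r * (fou r * ((fou r)^* * (fou r)^*))); last first.
    by rewrite -[4%N]/(2 * 2)%N exprM normCK; ring.
  rewrite {1}/fou !big_distrl /=; apply: eq_bigr => b1 _.
  rewrite {1}/fou !(big_distrl, big_distrr) /=; apply: eq_bigr => b2 _.
  rewrite !fou_conj !(big_distrl, big_distrr) /= ; apply: eq_bigr => b3 _.
  rewrite !(big_distrl, big_distrr) /=; apply: eq_bigr => b4 _.
  by rewrite !mulnDr !exprD; ring.
rewrite (eq_bigr _ (fun r _ => E r)) exchange_big big_seq big1 //= => b1 b1B.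
rewrite exchange_big big_seq big1 //= => b2 b2B.
rewrite exchange_big big_seq big1 //= => b3 b3B.
rewrite exchange_big big_seq big1 //= => b4 b4B.
by rewrite sum_prim_root (negPf (h _ _ _ _ b1B b2B b3B b4B)).
Qed.

Variables (a M : nat).
Hypotheses (a0 : (0 < a)%N) (M0 : (0 < M)%N) (NaB : (N <= a * size B)%N).

(** The large spectrum. As N <= a |B|, this threshold keeps the contribution of the other
    frequencies within half of the main term. *)
Definition spec : {set 'I_N} := [set r : 'I_N | (size B)%:R ^+ 2 <= (2 * a)%:R * `|fou r| ^+ 2].

Let sB0 : (0 < size B)%N.
Proof. by move: NaB N0; case: (size B) => //; rewrite muln0; lia. Qed.

Lemma card_spec : (#|spec| <= 2 * a ^ 2)%N.
Proof.
have sB : 0 < (size B)%:R :> algC by rewrite ltr0n.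
have : #|spec|%:R * (size B)%:R ^+ 2 <= (2 * a)%:R * (N%:R * (size B)%:R) :> algC.
  rewrite -parseval mulr_sumr mulr_natl -sumr_const.
  apply: le_trans (_ : \sum_(r in spec) (2 * a)%:R * `|fou r| ^+ 2 <= _).
    by apply: ler_sum => r; rewrite inE.
  rewrite [X in _ <= X](bigID (mem spec)) /= lerDl sumr_ge0 // => r _.
  by rewrite mulr_ge0 // exprn_ge0.
rewrite expr2 !mulrA ler_pM2r // -!natrM ler_nat => h.
rewrite -(leq_pmul2r sB0); apply: leq_trans h _.
by rewrite -mulnA expnS expn1 -!mulnA leq_mul2l /= leq_mul2l NaB orbT.
Qed.

(** Otherwise the sum in [fourth] vanishes. Its real part has |B|^4 from r = 0, nonnegative terms
    from the spectrum, and by Parseval at least -|B|^2 / (2a) N |B| >= -|B|^4 / 2 from the rest. *)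
Lemma bogolyubov_point x :
  (forall r, r \in spec -> `|z ^+ (r * x) - 1| <= 1) ->
  exists b1 b2 b3 b4, [/\ b1 \in B, b2 \in B, b3 \in B & b4 \in B] /\
    (N %| b1 + b2 + x + N.-1 * (b3 + b4))%N.
Proof.
move=> near; apply: contrapT => none.
have /fourth F : forall b1 b2 b3 b4, b1 \in B -> b2 \in B -> b3 \in B -> b4 \in B ->
    ~~ (N %| b1 + b2 + x + N.-1 * (b3 + b4))%N.
  by move=> b1 b2 b3 b4 h1 h2 h3 h4; apply/negP=> h; apply: none; exists b1, b2, b3, b4.
have Re_lb (w : algC) : - `|w| <= 'Re w.
  by rewrite lerNl -raddfN /= -normrN; apply: leif_Re_Creal.
have sB : 0 < (size B)%:R :> algC by rewrite ltr0n.
have tot : \sum_(r < N) `|fou r| ^+ 4 * 'Re (z ^+ (r * x)) = 0.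
  have -> : \sum_(r < N) `|fou r| ^+ 4 * 'Re (z ^+ (r * x)) = 'Re (\sum_(r < N) `|fou r| ^+ 4 * z ^+ (r * x)).
    by rewrite raddf_sum; apply: eq_bigr => r _ /=; rewrite ReMl // rpredX // normr_real.
  by rewrite F raddf0.
have r0 : (0 < N)%N by [].
pose o : 'I_N := Ordinal r0.
have hb (r : 'I_N) : r != o -> - ((size B)%:R ^+ 2 / (2 * a)%:R * `|fou r| ^+ 2) <= `|fou r| ^+ 4 * 'Re (z ^+ (r * x)).
  move=> _; have [/near h|] := boolP (r \in spec).
    have R0 : 0 <= 'Re (z ^+ (r * x)).
      have -> : z ^+ (r * x) = 1 + (z ^+ (r * x) - 1) by ring.
      rewrite raddfD /= (Creal_ReP _ _) ?rpred1 //; apply: le_trans (lerD (lexx _) (Re_lb _)).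
      by rewrite subr_ge0.
    apply: le_trans (_ : 0 <= _); last by rewrite mulr_ge0 // exprn_ge0.
    by rewrite oppr_le0 mulr_ge0 ?divr_ge0 ?exprn_ge0.
  rewrite inE -real_ltNge ?rpredM ?rpredX ?realn ?normr_real // => h.
  have h2 : `|fou r| ^+ 2 <= (size B)%:R ^+ 2 / (2 * a)%:R.
    by rewrite ler_pdivlMr ?ltr0n ?muln_gt0 // mulrC ltW.
  apply: le_trans (_ : - `|fou r| ^+ 4 <= _).
    rewrite lerN2 -[4%N]/(2 + 2)%N exprD ler_wpM2r // exprn_ge0 //.
  rewrite -{1}[( `|fou r| ^+ 4)]mulr1 -mulrN ler_wpM2l ?exprn_ge0 //.
  by apply: le_trans (Re_lb _); rewrite prim_norm.
have : (size B)%:R ^+ 4 - (size B)%:R ^+ 2 / (2 * a)%:R * (N%:R * (size B)%:R) <= 0 :> algC.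
  rewrite -tot (bigD1 o) //= mul0n expr0 (Creal_ReP _ _) ?rpred1 // mulr1.
  rewrite -[fou o]/(fou 0) fou0 normr_nat; apply: lerD => //.
  apply: le_trans (_ : \sum_(r < N | r != o) - ((size B)%:R ^+ 2 / (2 * a)%:R * `|fou r| ^+ 2) <= _).
    rewrite sumrN lerN2 -mulr_sumr ler_wpM2l ?divr_ge0 ?exprn_ge0 // -parseval.
    by rewrite [X in _ <= X](bigD1 o) //= lerDr exprn_ge0.
  by apply: ler_sum => r; apply: hb.
rewrite subr_le0 => h.
have : (size B)%:R ^+ 2 / (2 * a)%:R * (N%:R * (size B)%:R) <= (size B)%:R ^+ 4 / 2 :> algC.
  rewrite mulrAC ler_pdivrMr ?ltr0n ?muln_gt0 //.
  have -> : (size B)%:R ^+ 4 / 2 * (2 * a)%:R = (size B)%:R ^+ 2 * ((a * size B)%:R * (size B)%:R) :> algC.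
    by rewrite !natrM; field.
  by rewrite ler_wpM2l ?exprn_ge0 // ler_pM2r // ler_nat.
move/(le_trans h); rewrite ler_pdivlMr // -[X in _ <= X]mulr1 ler_pM2l ?exprn_gt0 //.
by rewrite lern1.
Qed.

Hypothesis Nbig : ((((4 * M).+1 ^ 2) ^ (2 * a ^ 2)) < N)%N.

(** Dirichlet's pigeonhole: real and imaginary parts, shifted by 1 and scaled by 2M, fall into 4M +
    1 unit cells each. Two exponents sharing all cells differ by a v for which both parts move by at
    most 1/(2M). *)
Lemma near_one_exists : exists v, (0 < v < N)%N /\
  forall r, r \in spec -> `|z ^+ (r * v) - 1| <= M%:R^-1.
Proof.
pose c := (4 * M).+1; pose k := #|spec|.
have cell (w : algC) : `|w| = 1 -> forall g : algC -> algC, (g w \is Num.real) -> `|g w| <= `|w| ->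
    0 <= (g w + 1) * (2 * M)%:R < c%:R.
  move=> w1 g gr gw; have /andP[h1 h2] : -1 <= g w <= 1 by rewrite -real_ler_norml // -w1.
  rewrite mulr_ge0 ?ler0n //=; last by rewrite -lerBlDr sub0r.
  apply: le_lt_trans (_ : 2 * (2 * M)%:R < c%:R).
    by rewrite ler_wpM2r // -[2]/(1 + 1) lerD2r.
  by rewrite -natrM ltr_nat /c; lia.
pose q (g : algC -> algC) (x : nat) (r : nat) : nat := Num.trunc ((g (z ^+ (r * x)) + 1) * (2 * M)%:R).
pose Im' : algC -> algC := fun w => 'Im w; pose Re' : algC -> algC := fun w => 'Re w.
have ReP w : `|w| = 1 -> 0 <= (Re' w + 1) * (2 * M)%:R < c%:R.
  by move=> w1; apply: cell => //; [apply: Creal_Re | apply: leif_normC_Re_Creal].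
have ImP w : `|w| = 1 -> 0 <= (Im' w + 1) * (2 * M)%:R < c%:R.
  move=> w1; apply: cell => //; first exact: Creal_Im.
  have : `|'Re ('i * w)| <= `|'i * w| by apply: leif_normC_Re_Creal.
  by rewrite ReMil normrN normrM normCi mul1r.
pose F (x : 'I_N) : {ffun 'I_k -> 'I_c * 'I_c} :=
  [ffun i : 'I_k => let r : 'I_N := @enum_val _ (mem spec) i in (inord (q Re' x r), inord (q Im' x r))].
have : ~ injective F.
  move=> /leq_card; rewrite card_ffun card_prod !card_ord mulnn leqNgt => /negP; apply.
  apply: leq_ltn_trans Nbig; rewrite leq_pexp2l ?expn_gt0 //; exact: card_spec.
move=> /existsNP[x1 /existsNP[x2 /not_implyP[Fx nx]]].
wlog lt12 : x1 x2 Fx nx / (x1 < x2)%N.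
  move=> W; have [h|h|/val_inj//] := ltngtP x1 x2; first exact: (W x1 x2).
  by apply: (W x2 x1) => // e; apply: nx.
exists (x2 - x1)%N; split; first by rewrite subn_gt0 lt12 (leq_ltn_trans (leq_subr _ _)).
move=> r rs; have := congr1 (fun f : {ffun 'I_k -> 'I_c * 'I_c} => f (enum_rank_in rs r)) Fx.
rewrite !ffunE enum_rankK_in // => -[e1 e2].
have close g : (forall w, `|w| = 1 -> 0 <= (g w + 1) * (2 * M)%:R < c%:R) ->
    (forall w, g w \is Num.real) -> inord (q g x1 r) = inord (q g x2 r) :> 'I_c ->
    `|g (z ^+ (r * x2)) - g (z ^+ (r * x1))| <= (2 * M)%:R^-1.
  move=> gP greal; move=> e.
  have tr x : (q g x r < c)%N.
    have /andP[h1 h2] := gP _ (prim_norm (r * x)).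
    by rewrite -(ltr_nat algC); apply: le_lt_trans h2; have /andP[] := truncn_itv h1.
  have {e}e : q g x1 r = q g x2 r by rewrite -(inordK (tr x1)) -(inordK (tr x2)) e.
  have /andP[h1 _] := gP _ (prim_norm (r * x1)); have /andP[h2 _] := gP _ (prim_norm (r * x2)).
  have := truncn_itv h1; have := truncn_itv h2; rewrite -/(q g x1 r) -/(q g x2 r) e.
  set t := q g x2 r => /andP[l1 l2] /andP[l3 l4].
  have M2 : 0 < (2 * M)%:R :> algC by rewrite ltr0n muln_gt0.
  rewrite -(ler_pM2r M2) mulVf ?gt_eqF // -[X in _ * X]gtr0_norm // -normrM.
  have -> : (g (z ^+ (r * x2)) - g (z ^+ (r * x1))) * (2 * M)%:R =
     (g (z ^+ (r * x2)) + 1) * (2 * M)%:R - (g (z ^+ (r * x1)) + 1) * (2 * M)%:R by ring.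
  rewrite real_ler_norml; last by rewrite rpredB // rpredM ?rpredD ?rpred1 ?greal // realn.
  move: l1 l2 l3 l4; rewrite -[t.+1%:R]natr1.
  set u := (_ + 1) * _; set w := (_ + 1) * _ => l1 l2 l3 l4; apply/andP; split.
    by rewrite lerBrDr addrC -lerBrDr opprK; apply: le_trans (ltW l4) _; rewrite lerD2r.
  by rewrite lerBlDr addrC; apply: le_trans (ltW l2) _; rewrite lerD2r.
have cRe := close Re' ReP (@Creal_Re _) e1; have cIm := close Im' ImP (@Creal_Im _) e2.
have -> : `|z ^+ (r * (x2 - x1)) - 1| = `|z ^+ (r * x2) - z ^+ (r * x1)|.
  have -> : z ^+ (r * x2) = z ^+ (r * x1) * z ^+ (r * (x2 - x1)).
    by rewrite -exprD -mulnDr subnKC // ltnW.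
  have -> u w : u * w - u = u * (w - 1) :> algC by ring.
  by rewrite normrM prim_norm mul1r.
set u := z ^+ (r * x2) in cRe cIm *; set w := z ^+ (r * x1) in cRe cIm *.
rewrite [u]Crect [w]Crect.
have -> : 'Re u + 'i * 'Im u - ('Re w + 'i * 'Im w) = (Re' u - Re' w) + 'i * (Im' u - Im' w) by rewrite /Re' /Im'; ring.
apply: le_trans (ler_normD _ _) _; rewrite normrM normCi mul1r.
apply: le_trans (lerD cRe cIm) _; rewrite natrM invfM.
have -> : 2^-1 / M%:R + 2^-1 / M%:R = M%:R^-1 :> algC by field; rewrite pnatr_eq0 -lt0n.
by [].
Qed.

Lemma bogolyubov : exists v, (0 < v < N)%N /\ forall j, (j <= M)%N ->
  exists b1 b2 b3 b4, [/\ b1 \in B, b2 \in B, b3 \in B & b4 \in B] /\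
    (N %| b1 + b2 + j * v + N.-1 * (b3 + b4))%N.
Proof.
have [v [v0 vP]] := near_one_exists; exists v; split=> // j jM.
apply: bogolyubov_point => r rs.
have le_pow (w : algC) n : `|w| = 1 -> `|w ^+ n - 1| <= n%:R * `|w - 1|.
  move=> w1; elim: n => [|n IH]; first by rewrite expr0 subrr normr0 mul0r.
  have -> : w ^+ n.+1 - 1 = w * (w ^+ n - 1) + (w - 1) by rewrite exprS; ring.
  apply: le_trans (ler_normD _ _) _; rewrite normrM w1 mul1r -natr1 mulrDl mul1r.
  by rewrite lerD2r.
rewrite mulnCA mulnC exprM; apply: le_trans (le_pow _ _ (prim_norm _)) _.
apply: le_trans (_ : M%:R * M%:R^-1 <= _); last by rewrite divff // pnatr_eq0 -lt0n.
by rewrite ler_pM // ?ler_nat //; apply: vP.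
Qed.
End Bogolyubov.

(** If every l in 1..P-1 failed at some t, then l -> (t, (l t mod P) / N) would be injective, P
    being prime, with the residue a positive multiple of N below P; but there are at most |S| (P-1)
    / N < P - 1 such pairs. *)
Lemma good_multiplier (S : seq int) (N P : nat) : prime P -> (size S < N)%N ->
  {in S, forall t, ~~ (P %| t)%Z} ->
  exists l : nat, {in S, forall t, ~~ (N %| (l%:Z * t %% P)%Z)%Z}.
Proof.
move=> pP sN nS; apply: contrapT => none.
have P0 : P%:Z != 0 by rewrite eqz_nat -lt0n prime_gt0.
have ex l : exists t, t \in S /\ (N %| (l%:Z * t %% P)%Z)%Z.
  apply: contrapT => h; apply: none; exists l => t tS; apply/negP=> d.
  by apply: h; exists t.
have [f fP] := choice ex; pose g l := `|(l%:Z * f l %% P)%Z|%N.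
have gP l : (g l)%:Z = (l%:Z * f l %% P)%Z by rewrite /g gez0_abs // modz_ge0.
have gN l : (N %| g l)%N by have [_] := fP l; rewrite -gP.
have gltP l : (g l < P)%N by rewrite -ltz_nat gP ltz_pmod // ltz_nat prime_gt0.
have cop l l' : (l < P)%N -> (l' < P)%N -> (P %| (l%:Z - l'%:Z) * f l)%Z -> l = l'.
  move=> lP l'P; rewrite dvdzE abszM /= Euclid_dvdM // => /orP[].
    rewrite -[X in (X %| _)%N]/(`|P%:Z|)%N -dvdzE -eqz_mod_dvd !modz_small ?ltz_nat //.
    by rewrite eqz_nat => /eqP.
  by have [fS _] := fP l; have := nS _ fS; rewrite dvdzE => /negPf->.
pose s := [seq (f l, (g l %/ N)%N) | l <- iota 1 P.-1].
have us : uniq s.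
  rewrite map_inj_in_uniq ?iota_uniq // => l l'; rewrite !mem_iota add1n (prednK (prime_gt0 pP)).
  move=> /andP[_ lP] /andP[_ l'P] [ef eg]; apply: cop => //.
  have e : g l = g l' by rewrite -(divnK (gN l)) eg divnK.
  have := congr1 Posz e; rewrite !gP => /eqP; rewrite -ef eqz_mod_dvd.
  by rewrite mulrBl.
have sub : {subset s <= [seq (t, q) | t <- S, q <- iota 1 (P.-1 %/ N)]}.
  move=> x /mapP[m]; rewrite mem_iota add1n (prednK (prime_gt0 pP)) => /andP[m0 mP] ->.
  apply: allpairs_f; first by case: (fP m).
  rewrite mem_iota add1n ltnS leq_div2r ?andbT; last by move: (gltP m); case: (P).
  rewrite divn_gt0; last by case: (N) sN.
  apply: dvdn_leq (gN m); rewrite lt0n; apply/eqP=> g0.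
  suff m00 : m = 0%N by rewrite m00 in m0.
  apply: cop => //; first exact: prime_gt0.
  by rewrite subr0; apply/dvdz_mod0P; rewrite -gP g0.
have := uniq_leq_size us sub; rewrite size_map size_iota size_allpairs size_iota.
have P1 : (0 < P.-1)%N by move: (prime_gt1 pP); case: (P) => // -[].
have := leq_trunc_div P.-1 N; move: P1 sN.
set n := (_ %/ N)%N; set m := P.-1; set k := size S; clear.
case: n => [|n]; first by rewrite muln0; case: m.
move=> m0 kN h1 h2; have := leq_trans h1 h2; rewrite mulnC leq_mul2r /=.
by rewrite leqNgt kN.
Qed.

(** * Ruzsa's model of a set in a cyclic group *)

Section Model.
Variables (G : zmodType) (A : {fset G}) (theta : {additive G -> int}) (K M : nat).
Let D6 := nsum 6 (diffs A).
Hypotheses (A0 : A != fset0) (M0 : (0 < M)%N) (cD : (#|` D6| <= K * #|` A|)%N).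
Hypothesis tinj : forall y, y \in D6 -> theta y = 0 -> y = 0.
Let a := (6 * K).+1.
Hypothesis big : ((((4 * M).+1 ^ 2) ^ (2 * a ^ 2)) < #|` A|)%N.

(** [A] goes to Z by [theta], is multiplied by l modulo P, lifted to [0, P) and reduced modulo N. On
    a sixth of it short relations survive in both directions, so the multiples of v supplied by
    [bogolyubov] lift to multiples of a single w. *)
Theorem bogolyubov_ruzsa : exists w : G, w != 0 /\
  forall j, (j <= M)%N -> w *+ j \in nsum 2 (diffs A).
Proof.
have D0 : 0 \in diffs A by apply: diffs0.
have sD6 n : (n <= 6)%N -> {subset nsum n (diffs A) <= D6}.
  by move=> n6; apply/fsubsetP/nsum_mono.
have D6N y : (- y \in D6) = (y \in D6) by apply: nsumN => x; apply: diffsN.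
have dD6 x y : x \in A -> y \in A -> x - y \in D6.
  move=> xA yA; apply: (sD6 1%N) => //=; rewrite sumfs0.
  by apply: mem_sumfs; rewrite ?oppfsP ?opprK.
have [x0 x0A] := fset0Pn _ A0.
pose N := (#|` D6|).+1.
have AN : (#|` A| < N)%N.
  rewrite ltnS -(card_sumfs1 A (- x0)); apply/fsubset_leq_card/fsubsetP => y.
  by move=> /sumfsP[u [v [uA]]]; rewrite inE => /eqP-> ->; apply: dD6.
have [P Pbig pP] := prime_above (\max_(y <- D6) `|theta y|)%N.
have Pgt y : y \in D6 -> (`|theta y| < P)%N.
  by move=> yD; apply: leq_ltn_trans Pbig; rewrite (big_rem y) //= leq_maxl.
have ndv y : y \in D6 -> y != 0 -> ~~ (P %| theta y)%Z.
  move=> yD; apply: contra => /dvdzP[c e]; apply/eqP/tinj => //.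
  have := Pgt _ yD; rewrite e abszM /=; have [->|c0] := eqVneq c 0; first by rewrite mul0r.
  by rewrite ltnNge leq_pmull // absz_gt0.
have [l lP] : exists l : nat, forall y, y \in D6 -> y != 0 -> ~~ (N %| (l%:Z * theta y %% P)%Z)%Z.
  have [] := @good_multiplier [seq theta y | y <- D6 & y != 0] N P pP.
  - by rewrite size_map size_filter ltnS; apply: count_size.
  - by move=> t /mapP[u uD ->]; move: uD; rewrite mem_filter => /andP[u0 uD]; apply: ndv.
  move=> l h; exists l => y yD y0; apply: h; apply/mapP; exists y => //.
  by rewrite mem_filter y0.
have P0 : 0 < P%:Z by rewrite ltz_nat prime_gt0.
(* Any lift of absolute value below P is, up to sign, the least residue of l theta y; by the choice
   of l that residue is divisible by N only for y = 0. *)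
have claim y Dv : y \in D6 -> `|Dv| < P%:Z -> (P %| Dv - l%:Z * theta y)%Z -> (N %| Dv)%Z -> y = 0.
  wlog D0' : y Dv / 0 <= Dv.
    move=> W; have [|D0'] := leP 0 Dv; first exact: W.
    move=> yD h1 h2 h3; apply: oppr_inj; rewrite oppr0; apply: (W (- y) (- Dv)).
    - by rewrite oppr_ge0 ltW.
    - by rewrite D6N.
    - by rewrite normrN.
    - by rewrite raddfN mulrN -opprD rpredN.
    by rewrite rpredN.
  move=> yD h1 h2 h3; apply/eqP; apply: contraLR h3 => /(lP _ yD).
  move: h2; rewrite -eqz_mod_dvd => /eqP<-.
  by rewrite modz_small // D0' /=; apply: le_lt_trans h1; apply: ler_norm.
pose r y := `|(l%:Z * theta y %% P)%Z|%N.
have rP y : (r y)%:Z = (l%:Z * theta y %% P)%Z by rewrite /r gez0_abs // modz_ge0 // gt_eqF.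
have rlt y : (r y < P)%N by rewrite -ltz_nat rP ltz_pmod.
have rdv y : (P %| (r y)%:Z - l%:Z * theta y)%Z by rewrite -eqz_mod_dvd rP modz_mod.
(* Within one of six blocks, differences of lifts are below P/6. The elements of 2A' - 2A' then have
   lifts below P/3, and the three of them compared at the end stay below P, as [claim] requires. *)
pose b y := ((6 * r y) %/ P)%N.
have blt y : (b y < 6)%N by rewrite ltn_divLR ?prime_gt0 // ltn_mul2l rlt.
pose cls c := [fset x in A | b x == c].
have [c hc] : exists c, (#|` A| <= 6 * #|` cls c|)%N.
  apply: contrapT => none.
  have : (#|` A| <= \sum_(c <- iota 0 6) #|` cls c|)%N.
    apply: card_cover_le => x xA; exists (b x); first by rewrite mem_iota /= add0n.
    by rewrite !inE xA /=.
  have lt c : (6 * #|` cls c| < #|` A|)%N by rewrite ltnNge; apply/negP=> h; apply: none; exists c.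
  have -> : (\sum_(c <- iota 0 6) #|` cls c| = #|` cls 0| + (#|` cls 1| + (#|` cls 2| + (#|` cls 3| + (#|` cls 4| + #|` cls 5|)))))%N.
    by rewrite /= !big_cons big_nil addn0.
  have := lt 0%N; have := lt 1%N; have := lt 2; have := lt 3; have := lt 4; have := lt 5.
  move: (#|` cls 0|) (#|` cls 1|) (#|` cls 2|) (#|` cls 3|) (#|` cls 4|) (#|` cls 5|) (#|` A|); clear; lia.
pose A' := cls c.
have A'A x : x \in A' -> x \in A by rewrite !inE => /andP[].
have close x y : x \in A' -> y \in A' -> 6 * ((r x)%:Z - (r y)%:Z) < P%:Z.
  rewrite !inE => /andP[_ /eqP bx] /andP[_ /eqP by'].
  have := divn_eq (6 * r x) P; have := divn_eq (6 * r y) P.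
  rewrite -/(b x) -/(b y) bx by'.
  have := ltn_pmod (6 * r x) (prime_gt0 pP); have := ltn_pmod (6 * r y) (prime_gt0 pP).
  move: (_ %% _)%N (_ %% _)%N (c * P)%N => u v w; clear; lia.
pose B := [seq (r x %% N)%N | x <- A'].
have uB : uniq B.
  rewrite map_inj_in_uniq ?fset_uniq // => x y xA' yA' e.
  apply/eqP; rewrite -subr_eq0; apply/eqP; apply: (claim _ ((r x)%:Z - (r y)%:Z)).
  - by apply: dD6; apply: A'A.
  - have := close _ _ xA' yA'; have := close _ _ yA' xA'.
    by move: (r x) (r y); clear; lia.
  - rewrite raddfB /= mulrBr.
    have -> (u v w t : int) : u - v - (w - t) = (u - w) - (v - t) by ring.
    by rewrite rpredB.
  by rewrite -eqz_mod_dvd !modz_nat e.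
have BN x : x \in B -> (x < N)%N by case/mapP=> y _ ->; rewrite ltn_mod.
have [z zN] := C_prim_root_exists (ltn0Sn #|` D6| : (0 < N)%N).
have sB : size B = #|` A'| by rewrite size_map.
have NaB : (N <= a * size B)%N.
  rewrite sB /N /a; move: hc cD AN; rewrite -/A'.
  have : (0 < #|` A|)%N by rewrite cardfs_gt0.
  rewrite /N; move: (#|` A'|) (#|` A|) (#|` D6|); clear => x y w y0 h1 h2 _.
  have x0 : (0 < x)%N by case: x h1 => //; move: y0; clear; lia.
  rewrite mulSn -addn1 addnC leq_add //; apply: leq_trans h2 _.
  by rewrite -mulnA mulnCA leq_mul2l h1 orbT.
have [v [/andP[v0 vN] vP]] := @bogolyubov N z zN B uB BN a M isT M0 NaB (ltn_trans big AN).
have step j : (j <= M)%N -> exists x Dv, [/\ x \in nsum 2 (diffs A), 3 * `|Dv| < P%:Z,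
    (P %| Dv - l%:Z * theta x)%Z & (N %| Dv - j%:Z * v%:Z)%Z].
  move=> /vP[b1 [b2 [b3 [b4 [[/mapP[x1 x1A ->] /mapP[x2 x2A ->] /mapP[x3 x3A ->] /mapP[x4 x4A ->]] dv]]]]].
  exists ((x3 - x1) + (x4 - x2)), (((r x3)%:Z - (r x1)%:Z) + ((r x4)%:Z - (r x2)%:Z)); split.
  - rewrite /= sumfs0; apply: mem_sumfs; apply: mem_sumfs; rewrite ?oppfsP ?opprK; exact: A'A.
  - have := close _ _ x3A x1A; have := close _ _ x1A x3A.
    have := close _ _ x4A x2A; have := close _ _ x2A x4A.
    by move: (r x1) (r x2) (r x3) (r x4); clear; lia.
  - rewrite raddfD !raddfB /=.
    have -> : (r x3)%:Z - (r x1)%:Z + ((r x4)%:Z - (r x2)%:Z) - l%:Z * (theta x3 - theta x1 + (theta x4 - theta x2)) =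
      ((r x3)%:Z - l%:Z * theta x3) - ((r x1)%:Z - l%:Z * theta x1) + (((r x4)%:Z - l%:Z * theta x4) - ((r x2)%:Z - l%:Z * theta x2)) by ring.
    by rewrite rpredD // rpredB.
  move: dv => /dvdnP[k /(congr1 Posz)]; rewrite !PoszD !PoszM.
  have E x : (r x)%:Z = (r x %/ N)%:Z * N%:Z + (r x %% N)%:Z by rewrite {1}(divn_eq (r x) N) PoszD PoszM.
  rewrite (E x1) (E x2) (E x3) (E x4) => e; apply/dvdzP.
  have N1 : (N.-1)%:Z = N%:Z - 1 by rewrite /N /= -addn1 PoszD addrK.
  rewrite N1 in e.
  exists ((r x3 %/ N)%:Z - (r x1 %/ N)%:Z + ((r x4 %/ N)%:Z - (r x2 %/ N)%:Z) + (r x3 %% N)%:Z + (r x4 %% N)%:Z - k%:Z).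
  rewrite !mulrDl [- k%:Z * _]mulNr -e; ring.
have [w [D1 [wD wlt wP wN]]] := step 1%N M0.
exists w; split.
  apply/eqP=> w0; move: wP; rewrite w0 raddf0 mulr0 subr0 => wP.
  have D10 : D1 = 0.
    move: wP => /dvdzP[k e]; rewrite e in wlt *.
    have [->|k0] := eqVneq k 0; first by rewrite mul0r.
    have : P%:Z <= `|k * P%:Z| by rewrite normrM [X in _ * X]ger0_norm // ler_peMl //; move: k0; clear; lia.
    by move: wlt; move: (`|k * P%:Z|) (P%:Z) P0; clear; lia.
  move: wN; rewrite D10 sub0r mul1r rpredN dvdzE /= => /(dvdn_leq v0).
  by rewrite leqNgt vN.
(* The element for j + 1 is compared with [w] plus the element for j; these three members of 2A - 2A
   combine within [D6]. *)
suff S j : (j <= M)%N -> forall x Dv, x \in nsum 2 (diffs A) -> 3 * `|Dv| < P%:Z ->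
    (P %| Dv - l%:Z * theta x)%Z -> (N %| Dv - j%:Z * v%:Z)%Z -> x = w *+ j.
  move=> j jM; have [x [Dv [h1 h2 h3 h4]]] := step j jM.
  by rewrite -(S j jM x Dv).
elim: j => [|j IH] jM x Dv xD xlt xP xN.
  rewrite mulr0n; apply: (claim _ Dv) => //; first exact: (sD6 2).
  - by move: xlt; clear; lia.
  by move: xN; rewrite mul0r subr0.
have [y [Dy [yD ylt yP yN]]] := step j (ltnW jM).
have ey := IH (ltnW jM) y Dy yD ylt yP yN.
rewrite mulrS -ey; apply/eqP; rewrite -subr_eq0; apply/eqP; apply: (claim _ (Dv - (D1 + Dy))).
- have := fsubsetP (nsumDS 2 4 (diffs A)); apply; apply: mem_sumfs => //.
  have nN u : u \in nsum 4 (diffs A) -> - u \in nsum 4 (diffs A) by rewrite nsumN //; apply: diffsN.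
  by apply: nN; have := fsubsetP (nsumDS 2 2 (diffs A)); apply; apply: mem_sumfs.
- by move: wlt xlt ylt; clear; lia.
- rewrite (raddfB theta) (raddfD theta) /=.
  have -> (u s t f g h k : int) : u - (s + t) - f * (g - (h + k)) = (u - f * g) - ((s - f * h) + (t - f * k)) by ring.
  by rewrite rpredB // rpredD.
have -> : Dv - (D1 + Dy) = (Dv - j.+1%:Z * v%:Z) - ((D1 - 1%:Z * v%:Z) + (Dy - j%:Z * v%:Z)) by rewrite -addn1 PoszD; ring.
by rewrite rpredB // rpredD.
Qed.
End Model.

(** * Iterated images of sets of small doubling *)

Section Ctrl.
Variables (G : zmodType) (T : {additive G -> G}).
Implicit Types A X Y D : {fset G}.
Hypothesis Tinj : injective T.

Lemma tim_sumfs A B : tim T (A +s B) = tim T A +s tim T B.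
Proof.
apply/fsetP=> x; apply/imfsetP/sumfsP => [[y /= /sumfsP[a [b [aA bB ->]]] ->]|].
  by exists (T a), (T b); rewrite !in_imfset // raddfD.
move=> [_ [_ [/imfsetP[a /= aA ->] /imfsetP[b /= bB ->] ->]]].
by exists (a + b); rewrite ?raddfD //= mem_sumfs.
Qed.

Lemma tim_oppfs A : tim T (oppfs A) = oppfs (tim T A).
Proof.
apply/fsetP=> x; rewrite oppfsP; apply/imfsetP/imfsetP => -[y /= yA e].
  by exists (- y); rewrite -?oppfsP // e raddfN.
by exists (- y); rewrite /= ?oppfsP ?opprK // raddfN -e opprK.
Qed.

Lemma tim0 : tim T [fset 0] = [fset 0].
Proof.
apply/fsetP=> x; rewrite inE; apply/imfsetP/eqP => [[y /=]|->].
  by rewrite inE => /eqP-> ->; rewrite raddf0.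
by exists 0; rewrite /= ?inE ?raddf0.
Qed.

Lemma tim_nsum n A : tim T (nsum n A) = nsum n (tim T A).
Proof. by elim: n => [|n IH] /=; rewrite ?tim0 // tim_sumfs IH. Qed.

Lemma card_tim A : #|` tim T A| = #|` A|.
Proof. exact: card_imfset. Qed.

Lemma timS X Y : X `<=` Y -> tim T X `<=` tim T Y.
Proof. by move=> XY; apply: subset_imfset => x; apply: (fsubsetP XY). Qed.

Variables (A : {fset G}) (k : nat).
Hypotheses (A0 : A != fset0) (hk : (#|` Sset T A| <= k * #|` A|)%N).

(** Plunnecke bounds X + n (T A), Ruzsa's triangle inequality then bounds n (T A) - n (T A), and
    injectivity of T returns the bound to [A]. *)
Lemma card_nsum_diffs n : (#|` nsum n (diffs A)| <= k ^ (n + n) * #|` A|)%N.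
Proof.
have [X [XA X0 hX]] := plunnecke A0 hk.
rewrite -card_tim; apply: leq_trans (_ : #|` nsum n (tim T A) +s oppfs (nsum n (tim T A))| <= _)%N.
  apply: fsubset_leq_card; rewrite -tim_nsum -tim_oppfs -tim_sumfs; apply: timS.
  exact: nsum_diffs.
have Xgt0 : (0 < #|` X|)%N by rewrite cardfs_gt0.
rewrite -(leq_pmul2l Xgt0); apply: leq_trans (ruzsa_triangle _ _ _) _.
apply: leq_trans (leq_mul (hX n) (hX n)) _.
rewrite expnD mulnACA mulnA mulnC leq_mul2l; apply/orP; right.
by rewrite leq_mul2l fsubset_leq_card ?orbT.
Qed.

(** Covering by translates, unlike a bound on the cardinality, is inherited by sums and by images
    under T. *)
Definition ctrl C r X := exists Y, (#|` Y| <= C)%N /\ X `<=` Y +s nsum r (diffs A).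

Lemma ctrl_self : ctrl 1 1 A.
Proof.
have [x0 x0A] := fset0Pn _ A0; exists [fset x0]; rewrite cardfs1; split=> //.
apply/fsubsetP=> x xA; rewrite -[x](subrKC x0); apply: mem_sumfs; first by rewrite inE.
by rewrite /= sumfs0; apply: mem_sumfs; rewrite ?oppfsP ?opprK.
Qed.

Lemma ctrl_nsum r : ctrl 1 r (nsum r (diffs A)).
Proof. by exists [fset 0]; rewrite cardfs1 sumfsC sumfs0. Qed.

Lemma ctrlD C r X C' r' X' : ctrl C r X -> ctrl C' r' X' -> ctrl (C * C') (r + r') (X +s X').
Proof.
move=> [Y [cY sY]] [Y' [cY' sY']]; exists (Y +s Y'); split.
  exact: leq_trans (card_sumfs_le _ _) (leq_mul cY cY').
apply: fsubset_trans (sumfsS sY sY') _.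
rewrite -sumfsA [nsum r _ +s _]sumfsC -sumfsA sumfsA sumfsS // sumfsC; exact: nsumDS.
Qed.

Lemma ctrl_card C r X : ctrl C r X -> (#|` X| <= C * k ^ (r + r) * #|` A|)%N.
Proof.
move=> [Y [cY sY]]; apply: leq_trans (fsubset_leq_card sY) _.
apply: leq_trans (card_sumfs_le _ _) _; rewrite -mulnA leq_mul //; exact: card_nsum_diffs.
Qed.

Lemma card_nsum_le n X : (#|` nsum n X| <= #|` X| ^ n)%N.
Proof.
elim: n => [|n IH] /=; first by rewrite cardfs1.
by apply: leq_trans (card_sumfs_le _ _) _; rewrite expnS leq_mul2l IH orbT.
Qed.

Lemma card_oppfs X : #|` oppfs X| = #|` X|.
Proof. by apply: card_imfset; apply: oppr_inj. Qed.

Lemma nsumS n X Y : X `<=` Y -> nsum n X `<=` nsum n Y.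
Proof. by move=> XY; elim: n => [|n IH] //=; apply: sumfsS. Qed.

Lemma nsumD n X Y : nsum n (X +s Y) = nsum n X +s nsum n Y.
Proof.
elim: n => [|n IH] /=; first by rewrite sumfs0.
by rewrite IH -!sumfsA; congr (_ +s _); rewrite !sumfsA; congr (_ +s _); rewrite sumfsC.
Qed.

Lemma nsum2_iter n D : nsum n (D +s D) `<=` nsum (n + n) D.
Proof. by rewrite nsumD; apply: nsumDS. Qed.

(** By Ruzsa covering T A lies in k translates of A - A, so T (A - A) lies in k^2 translates of 2 (A
    - A). *)
Lemma ctrl_tim C r X : ctrl C r X -> ctrl (C * (k * k) ^ r) (r + r) (tim T X).
Proof.
move=> [Y [cY sY]]; have [Z [cZ sZ]] := ruzsa_cover A0 hk.
exists (tim T Y +s nsum r (Z +s oppfs Z)); split.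
  apply: leq_trans (card_sumfs_le _ _) _; rewrite card_tim leq_mul //.
  apply: leq_trans (card_nsum_le _ _) _; case: (r) => // r'; rewrite leq_exp2r //.
  by apply: leq_trans (card_sumfs_le _ _) _; rewrite card_oppfs leq_mul.
apply: fsubset_trans (timS sY) _; rewrite tim_sumfs -sumfsA sumfsS // tim_nsum.
apply: fsubset_trans (_ : nsum r ((Z +s oppfs Z) +s (diffs A +s diffs A)) `<=` _).
  apply: nsumS; rewrite /diffs tim_sumfs tim_oppfs.
  apply/fsubsetP=> x /sumfsP[a [b [/(fsubsetP sZ)/sumfsP[u [v [uZ vD ->]]]]]].
  rewrite oppfsP => /(fsubsetP sZ)/sumfsP[u' [v' [u'Z v'D e]]] ->.
  rewrite -[b]opprK e opprD addrACA; apply: mem_sumfs; apply: mem_sumfs; rewrite ?oppfsP ?opprK //.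
  by rewrite diffsN.
by rewrite nsumD sumfsS //; apply: nsum2_iter.
Qed.

Fixpoint tsum D n := if n is n'.+1 then D +s tim T (tsum D n') else [fset 0].

Fixpoint tsum_ctrl n := if n is n'.+1 then
  let: (C, r) := tsum_ctrl n' in ((C * (k * k) ^ r)%N, (2 + (r + r))%N) else (1%N, 0%N).

Lemma tsum_ctrlP n : ctrl (tsum_ctrl n).1 (tsum_ctrl n).2 (tsum (nsum 2 (diffs A)) n).
Proof.
elim: n => [|n IH]; first exact: (ctrl_nsum 0).
change (tsum _ n.+1) with (nsum 2 (diffs A) +s tim T (tsum (nsum 2 (diffs A)) n)).
rewrite [tsum_ctrl n.+1]/=; case: (tsum_ctrl n) IH => C r /= IH.
by rewrite -[X in ctrl X]mul1n; apply: ctrlD; [exact: (ctrl_nsum 2) | exact: ctrl_tim].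
Qed.

Lemma ctrl_sumset n : ctrl (1 * (1 * (k * k) ^ 1) * (tsum_ctrl n).1)
  (1 + (1 + 1) + (tsum_ctrl n).2) (Sset T A +s tsum (nsum 2 (diffs A)) n).
Proof.
apply: ctrlD (tsum_ctrlP n); apply: ctrlD ctrl_self _; exact: ctrl_tim ctrl_self.
Qed.
End Ctrl.

Lemma sumset_tsum_bound k n : exists C, forall (G : zmodType) (T : {additive G -> G}) (A : {fset G}),
  injective T -> A != fset0 -> (#|` Sset T A| <= k * #|` A|)%N ->
  (#|` Sset T A +s tsum T (nsum 2 (diffs A)) n| <= C * #|` A|)%N.
Proof.
exists (1 * (1 * (k * k) ^ 1) * (tsum_ctrl k n).1 *
  k ^ ((1 + (1 + 1) + (tsum_ctrl k n).2) + (1 + (1 + 1) + (tsum_ctrl k n).2)))%N.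
by move=> G T A Tinj A0 hk; exact: (ctrl_card Tinj A0 hk (ctrl_sumset Tinj A0 hk n)).
Qed.

(** * Small representatives *)

Section Small.
Variable d : nat.
Local Notation iv := (map_mx (intr : int -> rat)).
Local Notation V := 'cV[rat]_d.

Definition lowmx (kap C : nat) (M : 'M[rat]_d) := exists Z : 'M[int]_d,
  kap%:R *: M = iv Z /\ forall i, (\sum_j `|Z i j| <= C)%N.

Lemma lowmxM kap C k M : lowmx kap C M -> lowmx (k * kap) (k * C) M.
Proof.
move=> [Z [e h]]; exists (k%:Z *: Z); split=> [|i].
  by rewrite natrM -scalerA e map_mxZ.
under eq_bigr => j _ do rewrite mxE abszM /=.
by rewrite -big_distrr leq_mul2l h orbT.
Qed.

Lemma lowmx_le kap C C' M : (C <= C')%N -> lowmx kap C M -> lowmx kap C' M.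
Proof. by move=> CC [Z [e h]]; exists Z; split=> // i; apply: leq_trans CC. Qed.

Lemma lowmx_exists M : exists kap C, (0 < kap)%N /\ lowmx kap C M.
Proof.
have [N [A [N0 e]]] := common_denominator M.
exists N, (\sum_i \sum_j `|A i j|)%N; split=> //; exists A; split=> // i.
by rewrite [X in (_ <= X)%N](bigD1 i) //= leq_addr.
Qed.

Lemma lowmx_exists3 M1 M2 M3 : exists kap C, [/\ (0 < kap)%N, (2 * kap <= C)%N,
  lowmx kap C M1, lowmx kap C M2 & lowmx kap C M3].
Proof.
have [k1 [C1 [k10 h1]]] := lowmx_exists M1.
have [k2 [C2 [k20 h2]]] := lowmx_exists M2.
have [k3 [C3 [k30 h3]]] := lowmx_exists M3.
pose kap := (k1 * (k2 * k3))%N.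
exists kap, (2 * kap + ((k2 * k3) * C1 + (k1 * k3) * C2 + (k1 * k2) * C3))%N.
split; [by rewrite !muln_gt0 k10 k20 | exact: leq_addr | | |].
- apply: (@lowmx_le _ ((k2 * k3) * C1)); first by clear; lia.
  by rewrite /kap mulnC; apply: lowmxM.
- apply: (@lowmx_le _ ((k1 * k3) * C2)); first by clear; lia.
  by rewrite /kap mulnCA mulnC; apply: lowmxM.
apply: (@lowmx_le _ ((k1 * k2) * C3)); first by clear; lia.
by rewrite /kap mulnA; apply: lowmxM.
Qed.

Variables (kap C : nat).
Hypotheses (kap0 : (0 < kap)%N) (kC : (2 * kap <= C)%N).

(** One exponent measures both denominator and height: applying T, T' or Rr costs one unit, and so
    does an addition, because 2 kap <= C. *)
Definition small n (x : V) := exists z : 'cV[int]_d,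
  (kap ^ n)%:R *: x = iv z /\ forall i, (`|z i 0%R| <= C ^ n)%N.

Lemma small0 n : small n 0.
Proof. by exists 0; rewrite scaler0 map_mx0; split=> // i; rewrite mxE. Qed.

Lemma smallD n x y : small n x -> small n y -> small n.+1 (x + y).
Proof.
move=> [z [ez hz]] [w [ew hw]]; exists (kap%:Z *: (z + w)); split=> [|i].
  by rewrite expnS natrM -scalerA scalerDr ez ew map_mxZ map_mxD.
rewrite !mxE abszM /= expnS; apply: leq_trans (_ : kap * (2 * C ^ n) <= _)%N.
  rewrite leq_mul2l; apply/orP; right; have := hz i; have := hw i.
  by move: (z i 0%R) (w i 0%R) (C ^ n)%N; clear; lia.
by rewrite mulnA [(kap * 2)%N]mulnC leq_mul2r kC orbT.
Qed.

Lemma smallS n x : small n x -> small n.+1 x.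
Proof. by move=> h; rewrite -[x]addr0; apply: smallD => //; apply: small0. Qed.

Lemma small_leq m n x : (m <= n)%N -> small m x -> small n x.
Proof. by move=> /subnKC <- h; elim: (n - m)%N => [|k IH]; rewrite ?addn0 // addnS; apply: smallS. Qed.

Lemma small_mx n M x : lowmx kap C M -> small n x -> small n.+1 (M *m x).
Proof.
move=> [Z [eZ hZ]] [z [ez hz]]; exists (Z *m z); split=> [|i].
  by rewrite expnSr natrM -scalerA map_mxM -ez -eZ -scalemxAl -scalemxAr !scalerA mulrC.
rewrite mxE; apply: leq_trans (_ : \sum_j `|(Z i j * z j 0)%R| <= _)%N.
  elim/big_ind2: _ => // a b a' b' h h'; apply: leq_trans (leq_add h h').
  by rewrite -lez_nat PoszD !abszE ler_normD.
rewrite expnS; apply: leq_trans (_ : (\sum_j `|Z i j|) * C ^ n <= _)%N; last by rewrite leq_mul2r hZ orbT.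
by rewrite big_distrl leq_sum // => j _; rewrite abszM leq_mul2l hz orbT.
Qed.

Lemma small_iter n k M x : lowmx kap C M -> small n x -> small (k + n) (iter k (mxmul M) x).
Proof. by move=> hM hx; elim: k => [|k IH] //=; rewrite addSn; apply: small_mx. Qed.

Lemma small_iter2 n k M M' x : lowmx kap C M -> lowmx kap C M' -> small n x ->
  small (k.*2 + n) (iter k (mxmul M \o mxmul M') x).
Proof.
by move=> hM hM' hx; elim: k => [|k IH] //=; rewrite doubleS !addSn; exact: small_mx hM (small_mx hM' IH).
Qed.

Lemma small_lamZ (x : V) : x \in lamZ d -> exists n, small n x.
Proof.
move=> /lamZP[z ->]; pose n := (\sum_i `|z i 0%R|)%N.
exists n, ((kap ^ n)%:Z *: z); split=> [|i]; first by rewrite map_mxZ.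
rewrite mxE abszM /=; apply: leq_trans (_ : (2 * kap) ^ n <= _)%N; last first.
  by case: (n) => // n'; rewrite leq_exp2r.
rewrite expnMn mulnC leq_mul2r; apply/orP; right.
apply: leq_trans (ltnW (ltn_expl n (ltnSn 1))).
by rewrite /n (bigD1 i) //= leq_addr.
Qed.

Lemma small_lamZ_seq (s : seq V) : {subset s <= lamZ d} -> exists n, forall r, r \in s -> small n r.
Proof.
elim: s => [|x s IH] h; first by exists 0%N.
have [n hn] := IH (fun y ys => h y (@mem_behead _ (x :: s) y ys)); have [m hm] := small_lamZ (h x (mem_head _ _)).
exists (m + n)%N => r; rewrite inE => /orP[/eqP->|/hn].
  by apply: small_leq hm; apply: leq_addr.
by apply: small_leq; apply: leq_addl.
Qed.

Lemma small_fset n : exists F : {fset V}, forall x, small n x -> x \in F.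
Proof.
pose L := (C ^ n)%N.
pose g (f : {ffun 'I_d -> 'I_(L.*2).+1}) : V := (kap ^ n)%:R^-1 *: iv (\col_i ((f i)%:Z - L%:Z)).
exists [fset g f | f in [set: {ffun 'I_d -> 'I_(L.*2).+1}]] => x [z [ez hz]].
apply/imfsetP; exists [ffun i => inord `|(z i 0 + L%:Z)%R|%N]; first by rewrite /= inE.
have k0 : (kap ^ n)%:R != 0 :> rat by rewrite pnatr_eq0 -lt0n expn_gt0 kap0.
rewrite /g -[x in LHS](scalerK k0) ez; congr (_ *: iv _); apply/matrixP=> i j.
rewrite ord1 mxE ffunE inordK; have := hz i; rewrite -/L ?ltnS -?addnn; move: (z i 0%R) (L); clear; lia.
Qed.

Variables (Tm T'm Rm : 'M[rat]_d) (K K' : zmodClosed V) (ras rbs : seq V).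
Hypothesis tw : tower_axiom (mxmul Tm) (mxmul T'm) (mxmul Rm) K K' ras rbs.
Hypotheses (lT : lowmx kap C Tm) (lT' : lowmx kap C T'm) (lR : lowmx kap C Rm).
Hypotheses (lK : {subset lamZ d <= K}) (lK' : {subset lamZ d <= K'}).
Variable s0 : nat.
Hypotheses (sa : forall r, r \in ras -> small s0 r) (sb : forall r, r \in rbs -> small s0 r).
Local Notation U := (twr (mxmul Tm) (mxmul T'm) K K').

(** Each level adds one digit of either kind. The longer one, T'^(n+1) (T Rr)^(2n+3) r', has
    exponent (n+1) + 2(2n+3) + s0 = s0 + 5n + 7, and two additions raise this to s0 + 5(n+1) + 4. *)
Lemma small_cover n x : x \in U 1 1 ->
  exists2 b, small (s0 + (5 * n + 4)) b & x - b \in U n.+1 n.+1.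
Proof.
move=> xU; elim: n => [|n [b sb1 hb]].
  by exists 0; [exact: small0 | rewrite subr0].
have [_ _ cA _] := repsA_digits tw n.+1 n.+1.
have [_ /mapP[r rr ->] h1] := cA _ hb.
have [_ _ cB _] := repsB_digits tw n.+2 n.+1.
have [_ /mapP[r' rr' ->] h2] := cB _ h1.
exists (b + iter n.+1 (mxmul Tm) (iter (n.+1 + n.+1) (mxmul Rm) r) +
  iter n.+1 (mxmul T'm) (iter (n.+1 + n.+2) (mxmul Tm \o mxmul Rm) r')); last by rewrite !opprD !addrA.
have le5 : ((s0 + (5 * n + 7)).+2 <= s0 + (5 * n.+1 + 4))%N by clear; lia.
apply: (small_leq le5); apply: smallD; first apply: smallD.
- by apply: small_leq sb1; clear; lia.
- apply: (@small_leq (n.+1 + (n.+1 + n.+1 + s0))); first by clear; lia.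
  by do 2!apply: small_iter => //; apply: sa.
apply: (@small_leq (n.+1 + ((n.+1 + n.+2).*2 + s0))); first by clear; lia.
by apply: small_iter => //; apply: small_iter2 => //; apply: sb.
Qed.

Lemma lamZ_low M n (x : V) : lowmx kap C M -> x \in lamZ d ->
  iter n (mxmul M) ((kap ^ n)%:R *: x) \in lamZ d.
Proof.
move=> [Z [eZ _]] /lamZP[z ->]; elim: n z => [|n IH] z; first by rewrite scale1r; apply/lamZP; exists z.
have E : mxmul M ((kap ^ n.+1)%:R *: iv z) = (kap ^ n)%:R *: iv (Z *m z).
  by rewrite map_mxM -eZ expnSr natrM -scalerA -scalemxAl -[LHS]/(M *m _) -!scalemxAr.
by rewrite iterSr E; apply: IH.
Qed.

Lemma scaled_lamZ_twr m (x : V) : x \in lamZ d -> (kap ^ m)%:R *: x \in U m m.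
Proof. by move=> xL; rewrite inE; apply/andP; split; [apply: lK | apply: lK']; apply: lamZ_low. Qed.

Definition cbasis m := [seq (kap ^ m)%:R *: (delta_mx i 0 : V) | i <- enum 'I_d].

Lemma zfree_cbasis m : zfree (cbasis m).
Proof.
move=> ns; rewrite size_map size_enum_ord => sn h.
have k0 : (kap ^ m)%:R != 0 :> rat by rewrite pnatr_eq0 -lt0n expn_gt0 kap0.
have ens : ns = [seq ns`_i | i : 'I_d <- enum 'I_d].
  apply: (@eq_from_nth _ 0); first by rewrite size_map size_enum_ord.
  move=> i; rewrite sn => ilt; rewrite (nth_map (Ordinal ilt)) ?size_enum_ord //.
  by rewrite nth_enum_ord.
have ez : zip (cbasis m) ns = [seq ((kap ^ m)%:R *: (delta_mx i 0 : V), ns`_i) | i : 'I_d <- enum 'I_d].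
  by rewrite {1}ens zip_map.
move: h; rewrite ez big_map big_enum /= => h.
apply/(all_nthP 0) => i; rewrite sn => ilt; have := congr1 (fun M : V => M (Ordinal ilt) 0) h.
rewrite summxE mxE (bigD1 (Ordinal ilt)) //= big1 ?addr0; last first.
  by move=> j ji; rewrite -scaler_int !mxE eq_sym (negPf ji) mulr0 mulr0.
rewrite -scaler_int !mxE !eqxx mulr1 => /eqP; rewrite mulf_eq0 (negPf k0) orbF intr_eq0.
by [].
Qed.

Lemma mem_cbox m mm (b : V) : b \in box (cbasis m) mm ->
  exists z : 'cV[int]_d, b = (kap ^ m)%:R *: iv z /\ forall i, (`|z i 0%R| <= d * mm)%N.
Proof.
suff H s (x : V) : x \in box [seq (kap ^ m)%:R *: (delta_mx i 0 : V) | i : 'I_d <- s] mm ->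
    exists z : 'cV[int]_d, x = (kap ^ m)%:R *: iv z /\ forall i, (`|z i 0%R| <= size s * mm)%N.
  by move=> /H; rewrite size_enum_ord.
elim: s x => [|j s IH] x /=.
  by rewrite inE => /eqP->; exists 0; split=> [|i]; rewrite ?map_mx0 ?scaler0 // mxE.
case/sumfsP=> _ [c [/imfsetP[n /= nm ->] /IH[z [-> hz]] ->]].
move: nm; rewrite mem_iota add0n => nm.
exists (n%:Z *: delta_mx j 0 + z); split=> [|i].
  rewrite map_mxD map_mxZ scalerDr -scaler_nat; congr (_ + _).
  by rewrite !scalerA mulrC; congr (_ *: _); apply/matrixP=> u v; rewrite !mxE; case: (_ && _).
rewrite !mxE mulSn; apply: leq_trans (leq_add _ (hz i)); last by exact: leqnn.
have : (n * (i == j) <= mm)%N by case: (i == j); rewrite ?muln1 ?muln0 // ltnW.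
by rewrite eqxx andbT; case: (i == j); move: (z i 0%R); clear; lia.
Qed.
End Small.

(** * Cyclic vectors *)

(** Through the images T^i w a progression in the single direction w becomes a box in D + T D + ...
    . *)
Lemma tsum_mem (G : zmodType) (T : {additive G -> G}) (D : {fset G}) (w : G) M :
  (forall n : int, (`|n| <= M)%N -> w *~ n \in D) ->
  forall m (c : nat -> int), (forall i, (i < m)%N -> (`|c i| <= M)%N) ->
  \sum_(i < m) iter i T w *~ c i \in tsum T D m.
Proof.
move=> hw; elim=> [|m IH] c hc; first by rewrite big_ord0 /= inE.
rewrite big_ord_recl /=; apply: mem_sumfs; first exact/hw/hc.
have -> : \sum_(i < m) iter (lift ord0 i) T w *~ c (lift ord0 i) =
   T (\sum_(i < m) iter i T w *~ c i.+1).
  by rewrite raddf_sum; apply: eq_bigr => i _; rewrite raddfMz.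
by apply/imfsetP; eexists; last by []; apply: (IH (fun i => c i.+1)) => i im; apply: hc.
Qed.

Section Cyclic.
Variables (n : nat) (Tm : 'M[rat]_n.+1).
Local Notation iv := (map_mx (intr : int -> rat)).
Local Notation V := 'cV[rat]_n.+1.
Hypothesis simpleT : forall U : 'M[rat]_n.+1, (U *m Tm^T <= U)%MS -> U = 0 \/ row_full U.

Lemma iter_mxmul i (x : V) : iter i (mxmul Tm) x = Tm ^+ i *m x.
Proof.
elim: i => [|i IH]; first by rewrite expr0 mul1mx.
by rewrite exprS -[RHS]mulmxA -IH.
Qed.

Definition krylov (e : V) : 'M[rat]_n.+1 := \matrix_(i, j) iter j (mxmul Tm) e i 0.

Lemma krylov_mul e (c : V) : krylov e *m c = \sum_(i < n.+1) c i 0 *: iter i (mxmul Tm) e.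
Proof.
apply/matrixP=> i j; rewrite ord1 !mxE summxE; apply: eq_bigr => k _.
by rewrite !mxE mulrC.
Qed.

Lemma horner_mx_coef (p : {poly rat}) (x : V) : (size p <= n.+1)%N ->
  horner_mx Tm p *m x = \sum_(i < n.+1) p`_i *: iter i (mxmul Tm) x.
Proof.
move=> sp; have {1}-> : p = \sum_(i < n.+1) p`_i *: 'X^i.
  by rewrite -poly_def; apply/polyP=> i; rewrite coef_poly; case: ltnP => // h; rewrite nth_default // (leq_trans sp).
rewrite raddf_sum mulmx_suml; apply: eq_bigr => i _.
by rewrite /= linearZ /= rmorphXn /= horner_mx_X -scalemxAl iter_mxmul.
Qed.

Lemma iter_krylov e m : exists c : V, iter m (mxmul Tm) e = krylov e *m c.
Proof.
pose p := 'X^m %% char_poly Tm.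
exists (\col_i p`_i); rewrite krylov_mul.
under eq_bigr => i _ do rewrite mxE.
rewrite -horner_mx_coef; last first.
  by rewrite -ltnS -(size_char_poly Tm) ltn_modp -size_poly_eq0 size_char_poly.
rewrite iter_mxmul; congr (_ *m _).
have := congr1 (horner_mx Tm) (divp_eq ('X^m) (char_poly Tm)).
by rewrite rmorphD rmorphM /= Cayley_Hamilton mulr0 add0r rmorphXn /= horner_mx_X.
Qed.

(** The span of the T^i e is nonzero and, by Cayley-Hamilton, T-invariant; as T has no proper
    invariant subspace, it is everything. *)
Lemma krylov_unit e : e != 0 -> krylov e \in unitmx.
Proof.
move=> e0; rewrite -unitmx_tr.
have [| h |] := simpleT (U := (krylov e)^T); last by rewrite row_full_unit.
  apply/row_subP=> j; have [c hc] := iter_krylov e j.+1.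
  have -> : row j ((krylov e)^T *m Tm^T) = c^T *m (krylov e)^T.
    rewrite -[RHS]trmx_mul -hc; apply/matrixP=> i k.
    rewrite ord1 -[iter j.+1 _ _]/(Tm *m iter j (mxmul Tm) e) !mxE; apply: eq_bigr => l _.
    by rewrite !mxE mulrC.
  exact: submxMl.
case/eqP: e0; apply/matrixP=> i j; have := congr1 (fun M : 'M[rat]_n.+1 => M 0 i) h.
by rewrite !mxE ord1.
Qed.

(** As e is cyclic, w = p(T) e for some polynomial p. Then G = p(T) commutes with T, so its kernel
    is T-invariant, and the kernel is not everything because w is nonzero. *)
Lemma cyclic_transfer (e w : V) : e != 0 -> w != 0 ->
  exists G : 'M[rat]_n.+1, [/\ G \in unitmx, G *m Tm = Tm *m G & G *m e = w].
Proof.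
move=> e0 w0; pose c := invmx (krylov e) *m w; pose p := \poly_(i < n.+1) c (inord i) 0.
pose G := horner_mx Tm p.
have Ge : G *m e = w.
  rewrite /G horner_mx_coef ?size_poly // -[RHS](mulKVmx (krylov_unit e0)) krylov_mul.
  by apply: eq_bigr => i _; rewrite coef_poly ltn_ord inord_val.
have GT : G *m Tm = Tm *m G.
  have := congr1 (horner_mx Tm) (mulrC p 'X).
  by rewrite !rmorphM /= horner_mx_X.
exists G; split=> //.
have [| h |] := simpleT (U := kermx G^T).
- apply/sub_kermxP; rewrite -mulmxA -trmx_mul GT trmx_mul mulmxA.
  by rewrite mulmx_ker mul0mx.
- by rewrite -unitmx_tr -row_free_unit -kermx_eq0 h.
rewrite -sub1mx => /sub_kermxP; rewrite mul1mx => h.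
case/eqP: w0; rewrite -Ge -[G]trmxK h trmx0 mul0mx //.
Qed.

Lemma cyclic_coords (e : V) : e != 0 -> exists c C : nat, (0 < c)%N /\
  forall (z : 'cV[int]_n.+1) (L : nat), (forall i, (`|z i 0%R| <= L)%N) ->
  exists m : nat -> int, (forall i, (`|m i| <= C * L)%N) /\
    iv z = \sum_(i < n.+1) iter i (mxmul Tm) (c%:R^-1 *: e) *~ m i.
Proof.
move=> e0; have [c [F [c0 eF]]] := common_denominator (invmx (krylov e)).
exists c, (\sum_i \sum_j `|F i j|)%N; split=> // z L hz.
exists (fun i => (F *m z) (inord i) 0); split=> [i|].
  rewrite mxE; set k := inord i.
  apply: leq_trans (_ : \sum_j `|(F k j * z j 0)%R| <= _)%N.
    elim/big_ind2: _ => // a b a' b' h h'; apply: leq_trans (leq_add h h').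
    by rewrite -lez_nat PoszD !abszE ler_normD.
  apply: leq_trans (_ : (\sum_j `|F k j|) * L <= _)%N; last first.
    by rewrite leq_mul2r [X in (_ <= X)%N](bigD1 k) //= leq_addr orbT.
  by rewrite big_distrl leq_sum // => j _; rewrite abszM leq_mul2l hz orbT.
have cn0 : c%:R != 0 :> rat by rewrite pnatr_eq0 -lt0n.
rewrite -[LHS](mulKVmx (krylov_unit e0)) krylov_mul; apply: eq_bigr => i _.
rewrite inord_val -scaler_int !iter_mxmul -scalemxAr scalerA; congr (_ *: _).
have -> : ((F *m z) i 0)%:~R = (iv (F *m z)) i 0 by rewrite [RHS]mxE.
by rewrite map_mxM -eF -scalemxAl [RHS]mulrC [X in _ = _ * X]mxE mulKf.
Qed.
End Cyclic.

(** * Sumsets of lattice points *)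

Lemma nsum_diffs_image (G G' : zmodType) (f : {additive G -> G'}) (A : {fset G}) k x :
  x \in nsum k (diffs A) -> f x \in nsum k (diffs [fset f a | a in A]).
Proof.
elim: k x => [|k IH] x /=; first by rewrite !inE => /eqP->; rewrite raddf0.
case/sumfsP=> _ [y [/sumfsP[a [b [aA bA ->]]] /IH h ->]]; rewrite raddfD; apply: mem_sumfs => //.
rewrite raddfD; apply: mem_sumfs; first by apply/imfsetP; exists a.
by rewrite oppfsP -raddfN; apply/imfsetP; exists (- b) => //=; rewrite -oppfsP.
Qed.

Lemma base_expansion_eq0 m (c : nat -> int) (L : nat) :
  (forall i, (i < m)%N -> (`|c i| < L)%N) -> \sum_(i < m) c i * L%:Z ^+ i = 0 ->
  forall i, (i < m)%N -> c i = 0.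
Proof.
elim: m c => [|m IH] c hc h i //; move: h; rewrite big_ord_recl expr0 mulr1.
have -> : \sum_(j < m) c (lift ord0 j) * L%:Z ^+ lift ord0 j = L%:Z * \sum_(j < m) c j.+1 * L%:Z ^+ j.
  by rewrite mulr_sumr; apply: eq_bigr => j _; rewrite lift0 exprS mulrCA.
set s := \sum_(j < m) _ => h.
have c0 := hc 0%N isT.
have s0 : s = 0.
  apply/eqP; apply: contraTT c0 => s0; rewrite -leqNgt.
  have -> : c 0%N = - (L%:Z * s) by apply/eqP; rewrite -addr_eq0 h.
  by rewrite abszN abszM leq_pmulr // absz_gt0.
case: i => [|i] im; first by move: h; rewrite s0 mulr0 addr0.
by apply: (IH (fun j => c j.+1)) => // j jm; apply: hc.
Qed.

(** Coordinates are read as signed digits in a base L larger than every entry that occurs, and such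
    an expansion of 0 has only zero digits. *)
Lemma separating_functional d (D : {fset 'cV[int]_d}) :
  exists theta : {additive 'cV[int]_d -> int}, forall y, y \in D -> theta y = 0 -> y = 0.
Proof.
pose L := (\max_(y <- D) \sum_i `|y i 0%R|).+1%N.
pose r : 'rV[int]_d := \row_i (L%:Z ^+ i).
exists (mxtrace \o mulmx r) => y yD /= h.
have hL i : (`|y i 0%R| < L)%N.
  rewrite ltnS; apply: leq_trans (_ : \sum_i `|y i 0%R| <= _)%N.
    by rewrite (bigD1 i) //= leq_addr.
  by rewrite (big_rem y) //= leq_maxl.
pose c k : int := if insub k is Some i then y i 0 else 0.
have cE (i : 'I_d) : c i = y i 0 by rewrite /c valK.
apply/matrixP=> i j; rewrite ord1 mxE -cE; apply: (@base_expansion_eq0 d c L).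
- by move=> k kd; rewrite (cE (Ordinal kd)).
- move: h; rewrite /mxtrace big_ord1 mxE => h; rewrite -[RHS]h; apply: eq_bigr => k _.
  by rewrite cE mxE mulrC.
exact: ltn_ord.
Qed.

Section AP.
Variable d : nat.
Local Notation iv := (map_mx (intr : int -> rat)).
Local Notation V := 'cV[rat]_d.

Lemma progression_in_diffs (T : {additive V -> V}) (A : {fset 'cV[int]_d}) (k M : nat) :
  injective T -> A != fset0 -> (0 < M)%N ->
  (#|` Sset T [fset (iv a : V) | a in A]| <= k * #|` A|)%N ->
  ((((4 * M).+1 ^ 2) ^ (2 * (6 * k ^ 12).+1 ^ 2)) < #|` A|)%N ->
  exists w : V, w != 0 /\ forall n : int, (`|n| <= M)%N ->
    w *~ n \in nsum 2 (diffs [fset (iv a : V) | a in A]).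
Proof.
move=> Tinj A0 M0 hk big; set A' := [fset (iv a : V) | a in A].
have cA : #|` A'| = #|` A| by apply: card_imfset; apply: iv_inj.
have A'0 : A' != fset0 by rewrite -cardfs_eq0 cA cardfs_eq0.
have [theta thP] := separating_functional (nsum 6 (diffs A)).
have cD : (#|` nsum 6 (diffs A)| <= k ^ 12 * #|` A|)%N.
  have := @card_nsum_diffs _ T Tinj A' k A'0; rewrite cA => /(_ hk 6) h.
  apply: leq_trans h.
  have <- : #|` [fset (iv x : V) | x in nsum 6 (diffs A)]| = #|` nsum 6 (diffs A)|.
    by apply: card_imfset; apply: iv_inj.
  apply/fsubset_leq_card/fsubsetP=> _ /imfsetP[x /= xD ->].
  exact: (@nsum_diffs_image _ _ (map_mx intr : {additive 'cV[int]_d -> V}) A 6 x xD).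
have [w [w0 wP]] := bogolyubov_ruzsa A0 M0 cD thP big.
exists (iv w); split.
  by apply: contraNneq w0 => h; apply/eqP/(@iv_inj d 1); rewrite h map_mx0.
have pos j : (j <= M)%N -> (iv w : V) *+ j \in nsum 2 (diffs A').
  move=> /wP h; have := @nsum_diffs_image _ _ (map_mx intr : {additive 'cV[int]_d -> V}) _ _ _ h.
  by rewrite raddfMn.
have nN u : u \in nsum 2 (diffs A') -> - u \in nsum 2 (diffs A').
  by rewrite nsumN //; apply: diffsN.
case=> j hj; first exact: pos.
by rewrite NegzE mulrNz; apply: nN; apply: pos.
Qed.
End AP.

(** * Moving a set by a map that commutes with T *)

Section Transport.
Variables (V : zmodType) (T g g' : {additive V -> V}).
Hypotheses (gK : cancel g g') (gK' : cancel g' g) (gT : forall x, g (T x) = T (g x)).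
Variables (A B D : {fset V}).
Hypothesis BD : forall b, b \in B -> g b \in D.

Lemma tim_gK : tim g (tim g' A) = A.
Proof.
apply/fsetP=> x; apply/timP/idP => [[_ /timP[a aA ->] ->]|xA]; first by rewrite gK'.
by exists (g' x); rewrite ?gK'; first exact: mem_tim.
Qed.

Lemma tim_Sset X : tim g (Sset T X) = Sset T (tim g X).
Proof.
rewrite /Sset tim_sumfs; congr (_ +s _).
apply/fsetP=> x; apply/timP/timP => -[_ /timP[a aX ->] ->].
  by exists (g a); rewrite ?gT //; apply: mem_tim.
by exists (T a); rewrite ?gT //; apply: mem_tim.
Qed.

Let ginj : injective g := can_inj gK.

Lemma card_transport : #|` tim g' A| = #|` A|.
Proof. by rewrite -(card_tim ginj) tim_gK. Qed.

Lemma card_transport_Sset : #|` Sset T (tim g' A)| = #|` Sset T A|.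
Proof. by rewrite -(card_tim ginj) tim_Sset tim_gK. Qed.

Lemma card_transport_box : (#|` Sset T (tim g' A) +s B| <= #|` Sset T A +s D|)%N.
Proof.
rewrite -(card_tim ginj) tim_sumfs tim_Sset tim_gK; apply/fsubset_leq_card/sumfsS => //.
by apply/fsubsetP=> x /timP[b /BD h ->].
Qed.

Lemma card_transport_add : A != fset0 -> (#|` tim g' A +s B| <= #|` Sset T A +s D|)%N.
Proof.
move=> /fset0Pn[a aA]; apply: leq_trans card_transport_box.
rewrite /Sset -sumfsA [tim T _ +s _]sumfsC sumfsA.
by apply: (@card_sumfs_gel _ _ _ (T (g' a))); do 2!apply: mem_tim.
Qed.
End Transport.

(** The progression length required at depth k is at most a constant times (2 C^12)^k, and the size
    condition of the Bogolyubov step is a fixed power of it. *)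
Lemma growth_bound (a c d C s : nat) : (0 < C)%N -> exists E : nat, (1 < E)%N /\ forall k,
  ((((4 * (c * (d * 2 ^ k * C ^ (k.*2.+1 + (s + (5 * k.*2 + 4))))).+1).+1 ^ 2) ^ a) < E ^ k.+1)%N.
Proof.
move=> C0; pose X := (c * d * C ^ (s + 5)).+1; pose Y := (2 * C ^ 12)%N.
pose Z := ((4 * X).+1 * Y)%N; pose E := (Z ^ (2 * a)).+1.
have Y0 : (0 < Y)%N by rewrite muln_gt0 expn_gt0 C0.
have Z0 : (0 < Z)%N by rewrite muln_gt0.
exists E.+1; split=> // k.
set M := (_ * (_ * _)).+1%N.
have ME : (M <= X * Y ^ k)%N.
  have -> : M = (c * d * C ^ (s + 5) * Y ^ k).+1.
    rewrite /M /Y expnMn -expnM; congr _.+1.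
    have -> : (k.*2.+1 + (s + (5 * k.*2 + 4)) = (s + 5) + 12 * k)%N by clear; lia.
    by rewrite expnD; ring.
  by rewrite /X mulSn -[X in (X <= _)%N]add1n leq_add2r expn_gt0 Y0.
have h : ((4 * M).+1 <= Z ^ k.+1)%N.
  apply: leq_trans (_ : (4 * X).+1 * Y ^ k <= _)%N.
    rewrite [X in (_ <= X)%N]mulSn -[X in (X <= _)%N]add1n leq_add ?expn_gt0 ?Y0 //.
    by rewrite -mulnA; apply: leq_mul.
  rewrite /Z expnMn; apply: leq_mul; first by rewrite -{1}[(4 * X).+1]expn1 leq_pexp2l.
  by rewrite leq_pexp2l.
apply: leq_ltn_trans (_ : (Z ^ k.+1) ^ (2 * a) < _)%N.
  by rewrite -expnM; case: (2 * a)%N => // b; rewrite leq_exp2r.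
rewrite -expnM mulnC expnM; apply: leq_trans (_ : E ^ k.+1 <= _)%N; last by rewrite leq_exp2r.
by rewrite ltn_exp2r.
Qed.

Section RatMain.
Variables (R : realType) (n : nat) (L1 L2 : 'M[int]_n.+1).
Local Notation iv := (map_mx (intr : int -> rat)).
Local Notation V := 'cV[rat]_n.+1.
Local Notation M1 := (iv L1).
Local Notation M2 := (iv L2).
Hypotheses (u1 : M1 \in unitmx) (u2 : M2 \in unitmx) (u12 : M1 + M2 \in unitmx).
Hypothesis cop : coprime_bound M1 M2.
Local Notation Tm := (invmx M1 *m M2).
Hypothesis simpleT : forall U : 'M[rat]_n.+1, (U *m Tm^T <= U)%MS -> U = 0 \/ row_full U.
Variables Pr Qr : R.
Hypotheses (Pr0 : 0 <= Pr) (Qr0 : 0 <= Qr).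
Hypotheses (PrE : Pr ^+ n.+1 = `|\det L2|%:~R) (QrE : Qr ^+ n.+1 = `|\det L1|%:~R).

Theorem lattice_sumset_loss : exists (E : nat) (C th : R), [/\ (1 < E)%N, 0 <= C, 0 < th < 1 &
  forall (A : {fset 'cV[int]_n.+1}) k, (E ^ k.+1 <= #|` A|)%N ->
  (Qr + Pr) ^+ n.+1 * #|` A|%:R <=
    #|` Sset (ratT L1 L2) [fset (iv a : V) | a in A]|%:R + C * th ^+ k * #|` A|%:R].
Proof.
have [ras [rbs [tw rasL rbsL sras srbs]]] := rat_tower u1 u2 u12 cop.
have [P' P'0 P'E] := @root_exists R n (size ras)%:R (ler0n _ _).
have [Q' Q'0 Q'E] := @root_exists R n (size rbs)%:R (ler0n _ _).
have HH : (Qr + Pr) ^+ n.+1 <= (Q' + P') ^+ n.+1.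
  rewrite lerXn2r ?nnegrE ?addr_ge0 // lerD // -(@ler_pXn2r _ n.+1) ?nnegrE //.
    by rewrite QrE Q'E -abszE -[X in X <= _]/(`|\det L1|%N)%:R ler_nat.
  by rewrite PrE P'E -abszE -[X in X <= _]/(`|\det L2|%N)%:R ler_nat.
set H' := (Q' + P') ^+ n.+1 in HH.
have H'0 : 0 <= H' by rewrite exprn_ge0 // addr_ge0.
have [kap [C0 [kap0 kC lT lT' lR]]] :=
  lowmx_exists3 (invmx M1 *m M2) (invmx M2 *m M1) (invmx (M1 + M2) *m M1).
have C00 : (0 < C0)%N by apply: leq_trans kC; rewrite muln_gt0.
have [s0 s0P] : exists s0, (forall r, r \in ras -> small kap C0 s0 r) /\ (forall r, r \in rbs -> small kap C0 s0 r).
  have [|s h] := small_lamZ_seq kC (s := ras ++ rbs).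
    by move=> x; rewrite mem_cat => /orP[/rasL|/rbsL].
  by exists s; split=> r rr; apply: h; rewrite mem_cat rr ?orbT.
case: s0P => sa sb.
pose e : V := delta_mx 0 0.
have e0 : e != 0.
  apply/eqP=> /matrixP/(_ 0 0); rewrite !mxE !eqxx => /eqP; by rewrite oner_eq0.
have [c [C2 [c0 coords]]] := cyclic_coords simpleT e0.
(* Since [kk] >= [H'], a set with |A + T A| > kk |A| satisfies the bound outright; otherwise [kk] is
   its doubling constant. *)
pose kk := Num.trunc (H' + 1).
have kkH : H' <= kk%:R.
  have /andP[_] := truncn_itv (addr_ge0 H'0 (@ler01 R)).
  by rewrite -/kk -natr1 ltrD2r => /ltW.
have [C1 C1P] := sumset_tsum_bound kk n.+1.
have [E [E1 EP]] := growth_bound (2 * (6 * kk ^ 12).+1 ^ 2) C2 n.+1 s0 C00.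
have /andP[th0 th1] := tree_theta_bounds tw R.
set th := tree_theta _ _ _ in th0 th1.
(* The maximum with 1/2 lets th'^k dominate also the Brunn-Minkowski error 1/2^k of a box of side
   2^k. *)
pose th' := Num.max th 2^-1.
have th'0 : 0 < th' by rewrite lt_max invr_gt0 ltr0n orbT.
have th'1 : th' < 1 by rewrite gt_max th1 invf_lt1 // ltr1n.
have bC := bmC_ge0 R n.+1.
exists E, (bmC R n.+1 * C1%:R + H' * (C1.+1)%:R), th'; split=> //.
- by rewrite addr_ge0 // mulr_ge0.
- by rewrite th'0.
move=> A k hE.
set A' := [fset (iv a : V) | a in A].
have cA : #|` A'| = #|` A| by apply: card_imfset; apply: iv_inj.
have A0 : A != fset0 by rewrite -cardfs_gt0; apply: leq_trans hE; rewrite expn_gt0 (ltnW E1).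
have A'0 : A' != fset0 by rewrite -cardfs_eq0 cA cardfs_eq0.
have loss0 : 0 <= (bmC R n.+1 * C1%:R + H' * (C1.+1)%:R) * th' ^+ k * #|` A|%:R.
  apply: mulr_ge0 => //; apply: mulr_ge0; last by apply: exprn_ge0; apply: ltW.
  by apply: addr_ge0; apply: mulr_ge0.
have [big|small'] := ltnP (kk * #|` A|) #|` Sset (ratT L1 L2) A'|.
  apply: ler_wpDr => //; apply: le_trans (_ : kk%:R * #|` A|%:R <= _).
    by rewrite ler_wpM2r // (le_trans HH).
  by rewrite -natrM ler_nat ltnW.
have Tinj : injective (ratT L1 L2) by apply: can_inj; exact: (tw_TK tw).
(* [m] is the depth reached from U(1,1) in k steps, [f] the exponent of [small_cover] at that depth;
   [Lam] bounds the entries of all vectors of [B] and [B0] after scaling by kap^f. *)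
pose m := k.*2.+1; pose f := (s0 + (5 * k.*2 + 4))%N.
pose Lam := (n.+1 * 2 ^ k * C0 ^ (m + f))%N.
have [w [w0 wP]] := @progression_in_diffs _ _ _ kk (C2 * Lam).+1 Tinj A0 isT small' (leq_trans (EP k) hE).
have kf0 : (kap ^ f)%:R != 0 :> rat by rewrite pnatr_eq0 -lt0n expn_gt0 kap0.
have cn0 : c%:R != 0 :> rat by rewrite pnatr_eq0 -lt0n.
(* The scaling absorbs the denominators of [B0] and of [cyclic_coords]: every vector of [B] and [B0]
   is an integral combination of the T^i eN, with coefficients small enough for the progression
   along w = G eN. *)
pose eN : V := (kap ^ f)%:R^-1 *: (c%:R^-1 *: e).
have eN0 : eN != 0 by rewrite !scaler_eq0 !invr_eq0 (negPf kf0) (negPf cn0).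
have [G [Gu GT Ge]] := cyclic_transfer simpleT eN0 w0.
have GTx (y : V) : G *m (Tm *m y) = Tm *m (G *m y) by rewrite [LHS]mulmxA GT -[LHS]mulmxA.
pose D := tsum (ratT L1 L2) (nsum 2 (diffs A')) n.+1.
have key (x : V) (z : 'cV[int]_n.+1) : (kap ^ f)%:R *: x = iv z -> (forall i, (`|z i 0%R| <= Lam)%N) ->
    G *m x \in D.
  move=> xz hz; have [mm [hm em]] := coords z Lam hz.
  have itG i (y : V) : G *m iter i (mxmul Tm) y = iter i (mxmul Tm) (G *m y).
    by elim: i => [|i IH] //=; rewrite -IH; exact: GTx.
  have -> : G *m x = \sum_(i < n.+1) iter i (mxmul Tm) w *~ mm i.
    rewrite -[x](scalerK kf0) xz em -Ge scaler_sumr mulmx_sumr; apply: eq_bigr => i _.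
    rewrite /eN -itG -!scaler_int -!scalemxAr scalerA mulrC -scalerA; congr (_ *: _).
    by rewrite !iter_mxmul -!scalemxAr.
  apply: tsum_mem => [j hj|i _]; last exact: hm.
  by apply: wP; apply: leqW.
pose g : {additive V -> V} := mxmul G; pose g' : {additive V -> V} := mxmul (invmx G).
have gK : cancel g g' by move=> x; apply: mulKmx.
have gK' : cancel g' g by move=> x; apply: mulKVmx.
have gT x : g (ratT L1 L2 x) = ratT L1 L2 (g x) by exact: GTx.
pose K : zmodClosed V := kgrp (ratT L1 L2) (lamZ n.+1); pose K' : zmodClosed V := kgrp (ratT' L1 L2) (lamZ n.+1).
pose B := box (cbasis n.+1 kap m) (2 ^ k).
have Lam1 : (C0 ^ f <= Lam)%N.
  rewrite /Lam expnD mulnA leq_pmull // !muln_gt0 !expn_gt0 C00 //.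
have BD b : b \in B -> g b \in D.
  move=> /mem_cbox[z [-> hz]]; apply: (key _ ((kap ^ (f + m))%:Z *: z)).
    by rewrite scalerA -natrM -expnD map_mxZ.
  move=> i; rewrite mxE abszM /= mulnC; apply: leq_mul (hz i) _.
  rewrite addnC; case: (m + f)%N => // j; rewrite leq_exp2r //.
  by apply: leq_trans kC; rewrite leq_pmull.
have [F FP] := @small_fset n.+1 kap C0 kap0 f.
pose B0 : {fset V} := [fset x in F | (x \in twr (ratT L1 L2) (ratT' L1 L2) K K' 1 1) && `[< small kap C0 f x >]].
have B0D b : b \in B0 -> g b \in D.
  rewrite !inE => /and3P[_ _ /asboolP[z [ez hz]]]; apply: (key _ z ez) => i.
  exact: leq_trans (hz i) Lam1.
have hB b : b \in B -> b \in twr (ratT L1 L2) (ratT' L1 L2) K K' m m.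
  move=> /mem_cbox[z [-> _]].
  apply: (@scaled_lamZ_twr n.+1 kap C0 _ _ _ _ lT lT') => [x|x|]; [exact: lam_kgrp|exact: lam_kgrp|].
  by apply/lamZP; exists z.
have hB0 b : b \in B0 -> b \in twr (ratT L1 L2) (ratT' L1 L2) K K' 1 1.
  by rewrite !inE => /and3P[].
have cov (x : V) : x \in twr (ratT L1 L2) (ratT' L1 L2) K K' 1 1 ->
    exists2 b, b \in B0 & x - b \in twr (ratT L1 L2) (ratT' L1 L2) K K' m m.
  move=> xU; have [b sb1 hb] := small_cover kC tw lT lT' lR sa sb k.*2 xU.
  have bU : b \in twr (ratT L1 L2) (ratT' L1 L2) K K' 1 1.
    have -> : b = x - (x - b) by rewrite opprB addrC subrK.
    apply: rpredB => //; move: hb; rewrite -[k.*2.+1]addn1; exact: (twrS tw).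
  exists b => //; move: bU; rewrite !inE FP //= => ->; exact/asboolP.
have BMh (X Y : {fset V}) : X != fset0 -> Y != fset0 ->
    bm n.+1 #|` X|%:R #|` Y|%:R (#|` X +s Y|%:R + (bmC R n.+1 / (2 ^ k)%:R) * #|` X +s Y +s B|%:R).
  move=> X0 Y0; have sz : size (cbasis n.+1 kap m) = n.+1 by rewrite size_map size_enum_ord.
  have := @brunn_minkowski_box R (2 ^ k) V (cbasis n.+1 kap m) X Y; rewrite sz; apply=> //.
    by rewrite expn_gt0.
  exact: zfree_cbasis.
have ep0 : 0 <= bmC R n.+1 / (2 ^ k)%:R by rewrite divr_ge0.
(* The descent is run on G^-1 A, whose sumset has the size of that of A; G carries the boxes [B] and
   [B0] into [D]. *)
have := tower_sumset tw ep0 BMh P'0 Q'0 P'E Q'E (tim g' A') (erefl m) hB hB0 cov.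
rewrite -/H' -/th (card_transport_Sset gK gK' gT) (card_transport gK gK') cA.
have hC : (#|` Sset (ratT L1 L2) A' +s D| <= C1 * #|` A|)%N.
  by rewrite -cA; apply: C1P => //; rewrite cA.
have h1 : #|` Sset (ratT L1 L2) (tim g' A') +s B|%:R <= C1%:R * #|` A|%:R :> R.
  by rewrite -natrM ler_nat; apply: leq_trans hC; exact: (card_transport_box gK gK' gT _ BD).
have h2 : #|` tim g' A' +s B0|%:R <= C1%:R * #|` A|%:R :> R.
  by rewrite -natrM ler_nat; apply: leq_trans hC; exact: (card_transport_add gK gK' gT B0D A'0).
have h3 : Num.sqrt (#|` A|%:R * #|` tim g' A' +s B0|%:R) <= (C1.+1)%:R * #|` A|%:R :> R.
  rewrite -[X in _ <= X]ger0_norm ?mulr_ge0 // -sqrtr_sqr ler_sqrt ?sqr_ge0 //.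
  apply: le_trans (_ : #|` A|%:R * (C1%:R * #|` A|%:R) <= _); first by rewrite ler_wpM2l.
  rewrite -!natrM -natrX ler_nat; move: (#|` A|) (C1); clear; nia.
have t1 : th ^+ k <= th' ^+ k by rewrite lerXn2r ?nnegrE ?(ltW th'0) // le_max lexx.
have t2 : ((2 ^ k)%:R : R)^-1 <= th' ^+ k.
  by rewrite natrX -exprVn lerXn2r ?nnegrE ?invr_ge0 ?(ltW th'0) // le_max lexx orbT.
move=> main; apply: le_trans (_ : H' * #|` A|%:R <= _); first by rewrite ler_wpM2r.
have l1 : bmC R n.+1 / (2 ^ k)%:R * #|` Sset (ratT L1 L2) (tim g' A') +s B|%:R <=
    bmC R n.+1 * C1%:R * th' ^+ k * #|` A|%:R.
  apply: le_trans (ler_wpM2l ep0 h1) _; rewrite [X in X <= _]mulrA; apply: ler_wpM2r => //.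
  by rewrite [X in _ <= X]mulrAC; apply: ler_wpM2r => //; apply: ler_wpM2l.
have l2 : H' * th ^+ k * Num.sqrt (#|` A|%:R * #|` tim g' A' +s B0|%:R) <=
    H' * (C1.+1)%:R * th' ^+ k * #|` A|%:R.
  apply: le_trans (ler_wpM2l _ h3) _; first by apply: mulr_ge0 => //; apply: exprn_ge0.
  rewrite [X in X <= _]mulrA; apply: ler_wpM2r => //.
  by rewrite [X in _ <= X]mulrAC; apply: ler_wpM2r => //; apply: ler_wpM2l.
apply: le_trans main _; rewrite -addrA; apply: lerD => //.
apply: le_trans (lerD l1 l2) _; rewrite le_eqVlt; apply/orP; left; apply/eqP.
by move: (bmC R n.+1) (C1.+1)%:R => b c'; ring.
Qed.
End RatMain.

(** * From real to integral points *)

Lemma dirichlet_simultaneous (R : realType) (xs : seq R) (Q : nat) : (0 < Q)%N ->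
  exists2 q : nat, (0 < q)%N & forall x, x \in xs -> exists z : int, `|q%:R * x - z%:~R| <= Q%:R^-1.
Proof.
move=> Q0; have Qr0 : 0 < Q%:R :> R by rewrite ltr0n.
pose s := size xs; pose fr (y : R) : R := y - (Num.floor y)%:~R.
have fr0 y : 0 <= fr y < 1.
  by rewrite /fr subr_ge0 ltrBlDr addrC; have := floor_itv y; rewrite intrD.
pose t (y : R) : nat := Num.trunc (Q%:R * fr y).
have tP y : (t y)%:R <= Q%:R * fr y < (t y)%:R + 1.
  by have /andP[h _] := fr0 y; have := truncn_itv (mulr_ge0 (ltW Qr0) h); rewrite natr1.
have tQ y : (t y < Q)%N.
  rewrite -(ltr_nat R); have /andP[h _] := tP y; apply: le_lt_trans h _.
  by rewrite gtr_pMr //; have /andP[] := fr0 y.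
case: Q Q0 Qr0 t tP tQ => // Q _ Qr0 t tP tQ.
pose F (q : 'I_(Q.+1 ^ s).+1) : {ffun 'I_s -> 'I_Q.+1} := [ffun i : 'I_s => inord (t (q%:R * xs`_i))].
have : ~ injective F.
  by move=> /leq_card; rewrite card_ffun !card_ord ltnn.
move=> /existsNP[q1 /existsNP[q2 /not_implyP[Fq nq]]].
wlog lt12 : q1 q2 Fq nq / (q1 < q2)%N.
  move=> W; have [h|h|/val_inj//] := ltngtP q1 q2; first exact: (W q1 q2).
  by apply: (W q2 q1) => // e; apply: nq.
exists (q2 - q1)%N; first by rewrite subn_gt0.
move=> x xxs; pose i : 'I_s := Ordinal (ltac:(by rewrite /s index_mem) : (index x xs < s)%N).
have ex : xs`_i = x by rewrite /= nth_index.
have := congr1 (fun f : {ffun 'I_s -> 'I_Q.+1} => f i) Fq.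
rewrite !ffunE ex => /(congr1 val) /=; rewrite !inordK // => et.
exists (Num.floor (q2%:R * x) - Num.floor (q1%:R * x)).
have -> : (q2 - q1)%:R * x - (Num.floor (q2%:R * x) - Num.floor (q1%:R * x))%:~R = fr (q2%:R * x) - fr (q1%:R * x).
  by rewrite natrB ?(ltnW lt12) // rmorphB /fr /=; ring.
have := tP (q2%:R * x); have := tP (q1%:R * x); rewrite et.
set f1 := fr _; set f2 := fr _; set u := (t _)%:R => /andP[a1 a2] /andP[b1 b2].
rewrite -(ler_pM2l Qr0) divff ?gt_eqF // -[X in X * _]gtr0_norm // -normrM ler_norml mulrBr.
by move: a1 a2 b1 b2; clear; lra.
Qed.

Lemma separating_multiple (R : realType) (ys : seq R) :
  exists2 N : nat, (0 < N)%N & forall y, y \in ys -> y != 0 -> 1 <= N%:R * `|y|.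
Proof.
elim: ys => [|y ys [N N0 IH]]; first by exists 1%N.
pose m := (Num.trunc `|y|^-1).+1; exists (N + m)%N; first by rewrite addn_gt0 N0.
move=> x; rewrite inE natrD mulrDl => /orP[/eqP->|xs] x0.
  apply: le_trans (_ : m%:R * `|y| <= _); last by rewrite lerDr mulr_ge0.
  have y0 : 0 < `|y| by rewrite normr_gt0.
  rewrite -ler_pdivrMr // div1r.
  have h : 0 <= `|y|^-1 by rewrite invr_ge0 ltW.
  by have /andP[_ /ltW] := truncn_itv h.
by apply: le_trans (IH _ xs x0) _; rewrite lerDl mulr_ge0.
Qed.

Section Reduce.
Variables (R : realType) (d : nat) (L1 L2 : 'M[int]_d).

Definition intsum (A : {fset 'cV[int]_d}) : {fset 'cV[int]_d} :=
  [fset (L1 *m a + L2 *m b)%R | a in A, b in A].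

(** Coordinates are scaled so that distinct ones differ by at least 1, then rounded with error 1/Q,
    Q = 2S + 3. As 2/Q < 1, distinct points stay distinct; equal sums stay equal, since their
    rounded versions differ by integers of size at most 2S/Q < 1. So rounding induces a map from the
    real sumset onto the integral one. *)
Lemma integral_model (A : {fset 'cV[R]_d}) : exists A' : {fset 'cV[int]_d},
  #|` A'| = #|` A| /\ (#|` intsum A'| <= #|` sumset_lin L1 L2 A|)%N.
Proof.
pose S := (\sum_i \sum_j (`|L1 i j| + `|L2 i j|))%N; pose Q := (2 * S).+3.
have [N0 N00 sep] := separating_multiple [seq x - y | x <- [seq (a : 'cV[R]_d) i 0 | a <- A, i <- enum 'I_d],
   y <- [seq (a : 'cV[R]_d) i 0 | a <- A, i <- enum 'I_d]].
have [q q0 qP] := @dirichlet_simultaneous R [seq N0%:R * (a : 'cV[R]_d) i 0 | a <- A, i <- enum 'I_d] Q isT.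
have /choice[r rP] : forall x, exists z : int,
    x \in [seq N0%:R * (a : 'cV[R]_d) i 0 | a <- A, i <- enum 'I_d] -> `|q%:R * x - z%:~R| <= Q%:R^-1.
  by move=> x; have [/qP[z hz]|_] := boolP (x \in _); [exists z | exists 0].
pose rho (a : 'cV[R]_d) : 'cV[int]_d := \col_i r (N0%:R * a i 0).
pose err (a : 'cV[R]_d) : 'cV[R]_d := (q%:R * N0%:R) *: a - map_mx intr (rho a).
have errP a i : a \in A -> `|err a i 0| <= Q%:R^-1.
  move=> aA; rewrite !mxE -mulrA; apply: rP; apply/allpairsP; exists (a, i) => /=.
  by rewrite mem_enum.
have Q0 : 0 < Q%:R :> R by rewrite ltr0n.
have rinj : {in A &, injective rho}.
  move=> a b aA bA e; apply/matrixP=> i j; rewrite ord1.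
  apply/eqP; rewrite -subr_eq0; apply: contraT => ab.
  have := sep (a i 0 - b i 0); rewrite ab => /(_ _ isT) h.
  have {}h : 1 <= N0%:R * `|a i 0 - b i 0|.
    by apply: h; apply/allpairsP; exists (a i 0, b i 0); split=> //=; apply/allpairsP;
      [exists (a, i) | exists (b, i)]; rewrite /= mem_enum.
  have : `|(q%:R * N0%:R) * (a i 0 - b i 0)| <= 2 / Q%:R.
    have -> : (q%:R * N0%:R) * (a i 0 - b i 0) = err a i 0 - err b i 0.
      have errE c : err c i 0 = q%:R * N0%:R * c i 0 - (rho c i 0)%:~R by rewrite !mxE.
      by rewrite !errE e; ring.
    apply: le_trans (ler_normB _ _) _; rewrite mulr_natl mulr2n; exact: lerD (errP _ _ aA) (errP _ _ bA).
  rewrite ler_pdivlMr // => h2.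
  have : q%:R * N0%:R * `|a i 0 - b i 0| * 3 <= 2.
    apply: le_trans h2; rewrite normrM [X in _ <= X * _ * _]ger0_norm ?mulr_ge0 //.
    by rewrite ler_wpM2l ?mulr_ge0 // ler_nat.
  have : 1 <= q%:R * N0%:R * `|a i 0 - b i 0|.
    by rewrite -mulrA; apply: mulr_ege1; rewrite ?ler1n.
  by move: (q%:R * N0%:R * _) => z; lra.
have Lerr (L : 'M[int]_d) (v : 'cV[R]_d) i : (forall j, `|v j 0| <= Q%:R^-1) ->
    `|(mxZ R L *m v) i 0| <= (\sum_j `|L i j|)%N%:R / Q%:R.
  move=> hv; rewrite mxE; apply: le_trans (ler_norm_sum _ _ _) _.
  rewrite natr_sum mulr_suml; apply: ler_sum => j _; rewrite normrM mxE.
  by rewrite -intr_norm -abszE ler_wpM2l.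
have wd a b a' b' : a \in A -> b \in A -> a' \in A -> b' \in A ->
    mxZ R L1 *m a + mxZ R L2 *m b = mxZ R L1 *m a' + mxZ R L2 *m b' ->
    L1 *m rho a + L2 *m rho b = L1 *m rho a' + L2 *m rho b'.
  move=> aA bA a'A b'A e; apply/eqP; rewrite -subr_eq0; apply/eqP/matrixP=> i j; rewrite ord1.
  set D := _ - _.
  have ED : (D i 0)%:~R = - ((mxZ R L1 *m err a) i 0 + (mxZ R L2 *m err b) i 0 -
       ((mxZ R L1 *m err a') i 0 + (mxZ R L2 *m err b') i 0)) :> R.
    have -> : (D i 0)%:~R = (map_mx intr D : 'cV[R]_d) i 0 by rewrite [RHS]mxE.
    have -> : map_mx intr D = - (mxZ R L1 *m err a + mxZ R L2 *m err b - (mxZ R L1 *m err a' + mxZ R L2 *m err b')) :> 'cV[R]_d.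
      have EE c e' : mxZ R L1 *m err c + mxZ R L2 *m err e' =
          (q%:R * N0%:R) *: (mxZ R L1 *m c + mxZ R L2 *m e') - map_mx intr (L1 *m rho c + L2 *m rho e').
        rewrite map_mxD !map_mxM -/(mxZ R L1) -/(mxZ R L2) /err !mulmxBr -!scalemxAr addrACA.
        by rewrite scalerDr opprD.
      by rewrite !EE e /D map_mxB !opprB [RHS]addrC subrKA.
    by rewrite !mxE.
  have hD : `|(D i 0)%:~R| <= (2 * S)%:R / Q%:R :> R.
    rewrite ED normrN.
    have hS : ((\sum_j `|L1 i j|) + (\sum_j `|L2 i j|) <= S)%N.
      by rewrite -big_split /S [X in (_ <= X)%N](bigD1 i) //= leq_addr.
    have h3 c e' : c \in A -> e' \in A -> `|(mxZ R L1 *m err c) i 0 + (mxZ R L2 *m err e') i 0| <= S%:R / Q%:R.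
      move=> cA eA; apply: le_trans (ler_normD _ _) _.
      apply: le_trans (lerD (Lerr L1 _ i (fun j => errP c j cA)) (Lerr L2 _ i (fun j => errP e' j eA))) _.
      by rewrite -mulrDl ler_wpM2r ?invr_ge0 // -natrD ler_nat.
    apply: le_trans (ler_normB _ _) _; apply: le_trans (lerD (h3 _ _ aA bA) (h3 _ _ a'A b'A)) _.
    by rewrite -mulrDl -natrD addnn mul2n.
  have : `|(D i 0)%:~R| < 1 :> R.
    by apply: le_lt_trans hD _; rewrite ltr_pdivrMr // mul1r ltr_nat /Q !ltnS ltnW.
  rewrite -intr_norm -[X in _ < X]/(1%:~R) ltr_int => h; rewrite [RHS]mxE; move: (D i 0) h; clear; lia.
have /choice[h hP] : forall s : 'cV[R]_d, exists t, forall a b, a \in A -> b \in A ->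
    s = mxZ R L1 *m a + mxZ R L2 *m b -> L1 *m rho a + L2 *m rho b = t.
  move=> s; have [[a [b [aA bA e]]]|none] := pselect (exists a b, [/\ a \in A, b \in A &
      s = mxZ R L1 *m a + mxZ R L2 *m b]).
    by exists (L1 *m rho a + L2 *m rho b) => a' b' a'A b'A e'; apply: wd => //; rewrite -e -e'.
  by exists 0 => a b aA bA e; case: none; exists a, b.
exists [fset rho a | a in A]; split; first by rewrite card_in_imfset.
apply: leq_trans (_ : #|` [fset h s | s in sumset_lin L1 L2 A]| <= _)%N; last exact: leq_imfset_card.
apply/fsubset_leq_card/fsubsetP=> x /imfset2P[_ /= /imfsetP[a /= aA ->] [_ /imfsetP[b /= bA ->] ->]].
apply/imfsetP; exists (mxZ R L1 *m a + mxZ R L2 *m b).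
  by apply/imfset2P; exists a => //; exists b.
exact: hP.
Qed.

Local Notation iv := (map_mx (intr : int -> rat)).

Lemma card_intsum (A : {fset 'cV[int]_d}) : iv L1 \in unitmx ->
  #|` intsum A| = #|` Sset (ratT L1 L2) [fset (iv a : 'cV[rat]_d) | a in A]|.
Proof.
move=> u1; pose f (x : 'cV[int]_d) : 'cV[rat]_d := invmx (iv L1) *m iv x.
have finj : injective f by move=> x y /(can_inj (mulKVmx u1))/iv_inj.
have <- : #|` [fset f x | x in intsum A]| = #|` intsum A| by apply: card_imfset.
congr #|` _|; apply/fsetP=> x; apply/imfsetP/sumfsP.
  move=> [_ /imfset2P[a /= aA [b /= bA ->]] ->]; exists (iv a), (ratT L1 L2 (iv b)).
  split; [by apply/imfsetP; exists a | by apply/mem_tim/imfsetP; exists b |].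
  by rewrite /f map_mxD !map_mxM mulmxDr mulKmx // /ratT [X in _ + X]mulmxA.
move=> [_ [_ [/imfsetP[a /= aA ->] /timP[_ /imfsetP[b /= bA ->] ->] ->]]].
exists (L1 *m a + L2 *m b); first by apply/imfset2P; exists a => //; exists b.
by rewrite /f map_mxD !map_mxM mulmxDr mulKmx // /ratT [X in _ = _ + X]mulmxA.
Qed.
End Reduce.

(** * Irreducible and degenerate pairs *)

Section Irreducible.
Variables (d : nat) (L1 L2 : 'M[int]_d).
Local Notation iv := (map_mx (intr : int -> rat)).
Hypothesis irr : irreducible_pair L1 L2.

Lemma coprime_pair_bound : coprime_pair L1 L2 -> coprime_bound (iv L1) (iv L2).
Proof.
move=> cop P Q Pu Qu h1 h2; rewrite leNgt; apply/negP=> h; apply: cop.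
exists P, Q; split=> //; apply/andP; split=> //.
by move: Pu Qu; rewrite !unitmxE !unitfE => Pu Qu; rewrite normr_gt0 mulf_neq0.
Qed.

(** The lines of u and v would violate irreducibility; if v = 0 both images vanish and the line of u
    takes the place of that of v. A kernel vector of L1, L2 or L1 + L2 is of this kind. *)
Lemma irreducible_line (u v : 'rV[rat]_d) : (1 < d)%N -> u != 0 ->
  (u *m (iv L1)^T <= v)%MS -> (u *m (iv L2)^T <= v)%MS -> False.
Proof.
move=> d1 u0; wlog v0 : v / v != 0.
  move=> W h1 h2; have [v0|v0] := eqVneq v 0; last exact: (W v).
  by apply: (W u u0); [move: h1 | move: h2]; rewrite v0 => /submx0null->; rewrite sub0mx.
have rk (w : 'rV[rat]_d) : w != 0 -> \rank <<w>>%MS = 1%N by move=> w0; rewrite genmxE rank_rV w0.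
move=> h1 h2; apply: (irr (U := <<u>>%MS) (V := <<v>>%MS)); rewrite ?(rk _ u0) ?(rk _ v0) //.
have sub (M : 'M[rat]_d) : (u *m M <= v)%MS -> (<<u>>%MS *m M <= <<v>>%MS)%MS.
  by move=> h; rewrite genmxE; apply: submx_trans h; apply: submxMr; rewrite genmxE.
by split; apply: sub.
Qed.

Lemma singular_left_kernel (M : 'M[rat]_d) : M \notin unitmx ->
  exists2 u : 'rV[rat]_d, u != 0 & u *m M^T = 0.
Proof.
rewrite -unitmx_tr -row_free_unit -kermx_eq0 => /rowV0Pn[u /sub_kermxP h u0].
by exists u.
Qed.

Lemma irreducible_unit : (1 < d)%N ->
  [/\ iv L1 \in unitmx, iv L2 \in unitmx & iv L1 + iv L2 \in unitmx].
Proof.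
move=> d1; split; apply: contraT => /singular_left_kernel[u u0 hu].
- by case: (@irreducible_line u (u *m (iv L2)^T)); rewrite ?hu ?sub0mx.
- by case: (@irreducible_line u (u *m (iv L1)^T)); rewrite ?hu ?sub0mx.
case: (@irreducible_line u (u *m (iv L2)^T)) => //.
move/eqP: hu; rewrite linearD /= mulmxDr addr_eq0 => /eqP->.
by rewrite eqmx_opp.
Qed.

(** If U is invariant under L1^-1 L2, then V = L1 U has the dimension of U and contains L2 U. *)
Lemma irreducible_simple : iv L1 \in unitmx ->
  forall U : 'M[rat]_d, (U *m (invmx (iv L1) *m iv L2)^T <= U)%MS -> U = 0 \/ row_full U.
Proof.
move=> u1 U hU; have [r0|r0] := posnP (\rank U); first by left; apply/eqP; rewrite -mxrank_eq0 r0.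
right; rewrite /row_full eqn_leq rank_leq_row /= leqNgt; apply/negP=> rd.
have f1 : row_free (iv L1)^T by rewrite row_free_unit unitmx_tr.
apply: (irr (U := U) (V := U *m (iv L1)^T)); rewrite ?mxrankMfree //; split=> //.
have -> : (mxZ rat L2)^T = (invmx (iv L1) *m iv L2)^T *m (iv L1)^T by rewrite -trmx_mul mulKVmx.
by rewrite mulmxA submxMr.
Qed.
End Irreducible.

Section Numerics.
Variables (R : realType) (E : nat) (th : R).
Hypotheses (E1 : (1 < E)%N) (th01 : 0 < th < 1).
(** Chosen so that E^sigma = 1 / th: the factor th^j at a size below E^j saves at least the power
    sigma of the size. *)
Let sigma : R := - ln th / ln E%:R.

Let lnE : 0 < ln E%:R :> R. Proof. by rewrite ln_gt0 // ltr1n. Qed.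

Lemma decay_exponent_gt0 : 0 < sigma.
Proof. by case/andP: th01 => h0 h1; rewrite divr_gt0 // oppr_gt0 ln_lt0 // h0. Qed.

Lemma decay_powR (N j : nat) : (0 < N)%N -> (N < E ^ j)%N -> th ^+ j * N%:R <= N%:R `^ (1 - sigma).
Proof.
case/andP: th01 => th0 th1 N0 NE.
have N0' : N%:R != 0 :> R by rewrite pnatr_eq0 -lt0n.
have E0 : 0 < E%:R :> R by rewrite ltr0n ltnW.
rewrite powRD; last by rewrite N0' implybT.
rewrite powRN powRr1 // mulrC ler_wpM2l //.
have Es : E%:R `^ sigma = th^-1.
  by rewrite /powR gt_eqF // /sigma divfK ?gt_eqF // expRN lnK // posrE.
rewrite -[X in X <= _]invrK lef_pV2 ?posrE ?powR_gt0 ?ltr0n ?invr_gt0 ?exprn_gt0 //.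
apply: le_trans (_ : (E ^ j)%:R `^ sigma <= _).
  by apply: ge0_ler_powR; rewrite ?nnegrE ?(ltW decay_exponent_gt0) // ler_nat ltnW.
rewrite natrX -powR_mulrn ?(ltW E0) // -powRrM mulrC powRrM Es powR_mulrn ?invr_ge0 ?(ltW th0) //.
by rewrite exprVn.
Qed.

(** The largest k with E^(k+1) <= N is taken. Then N < E^(k+2), and replacing th^k by th^(k+2) costs
    1 / th^2. For 0 < N < E there is no such k, and H N itself is absorbed through H / th. *)
Lemma loss_powR (C H : R) : 0 <= C -> 0 <= H -> exists D sigma' : R, 0 < D /\ 0 < sigma' /\
  forall (N : nat) (S : R), 0 <= S ->
    (forall k, (E ^ k.+1 <= N)%N -> H * N%:R <= S + C * th ^+ k * N%:R) ->
    H * N%:R - D * N%:R `^ (1 - sigma') <= S.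
Proof.
case/andP: (th01) => th0 th1 C0 H0.
pose D := C / th ^+ 2 + H / th + 1.
have D1 : 0 <= C / th ^+ 2 by rewrite divr_ge0 // exprn_ge0 // ltW.
have D2 : 0 <= H / th by rewrite divr_ge0 // ltW.
have D0 : 0 < D by rewrite /D; move: D1 D2; lra.
exists D, sigma; split=> //; split; first exact: decay_exponent_gt0.
move=> N S S0 h; have [->|N0] := posnP N.
  by rewrite mulr0 sub0r; apply: le_trans S0; rewrite oppr_le0 mulr_ge0 ?powR_ge0 // ltW.
rewrite lerBlDr; have := trunc_log_bounds E1 N0; case: (trunc_log E N) => [|k] /andP[l1 l2].
  have hd := decay_powR N0 l2; apply: ler_wpDl => //.
  apply: le_trans (_ : H / th * N%:R `^ (1 - sigma) <= _); last first.
    by rewrite ler_wpM2r ?powR_ge0 // /D; move: D1; lra.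
  apply: le_trans (ler_wpM2l D2 hd); rewrite expr1 mulrA divfK ?gt_eqF //.
have hd := decay_powR N0 l2; apply: le_trans (h k l1) _; rewrite lerD2l.
apply: le_trans (_ : C / th ^+ 2 * N%:R `^ (1 - sigma) <= _); last first.
  by rewrite ler_wpM2r ?powR_ge0 // /D; move: D2; lra.
apply: le_trans (ler_wpM2l D1 hd); rewrite mulrA ler_wpM2r //.
by rewrite -[k.+2]addn2 exprD mulrCA divfK ?expf_neq0 ?gt_eqF // mulrC.
Qed.
End Numerics.

Section Generic.
Variables (R : realType) (n : nat) (L1 L2 : 'M[int]_n.+1).
Local Notation iv := (map_mx (intr : int -> rat)).

Theorem nonsingular_sumset : irreducible_pair L1 L2 -> coprime_pair L1 L2 ->
  iv L1 \in unitmx -> iv L2 \in unitmx -> iv L1 + iv L2 \in unitmx ->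
  exists (D sigma : R), 0 < D /\ 0 < sigma /\
    forall A : {fset 'cV[R]_n.+1},
      ((`|\det L1|%:~R : R) `^ (n.+1%:R^-1) + (`|\det L2|%:~R : R) `^ (n.+1%:R^-1)) ^+ n.+1
          * (#|` A|%fset)%:R
        - D * (((#|` A|%fset)%:R : R) `^ (1 - sigma)) <= (#|` sumset_lin L1 L2 A|%fset)%:R.
Proof.
move=> irr cop u1 u2 u12.
have rootE (x : R) : 0 <= x -> (x `^ n.+1%:R^-1) ^+ n.+1 = x.
  by move=> x0; rewrite -powR_mulrn ?powR_ge0 // -powRrM mulVf ?pnatr_eq0 // powRr1.
have [E [C [th [E1 C0 th01 loss]]]] := lattice_sumset_loss u1 u2 u12 (coprime_pair_bound cop)
  (irreducible_simple irr u1) (powR_ge0 _ _) (powR_ge0 _ _)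
  (rootE `|\det L2|%:~R (ler0z _ _)) (rootE `|\det L1|%:~R (ler0z _ _)).
set H := (_ + _) ^+ n.+1 in loss *.
have H0 : 0 <= H by rewrite exprn_ge0 // addr_ge0 // powR_ge0.
have [D [sigma [D0 [s0 h]]]] := loss_powR E1 th01 C0 H0.
exists D, sigma; split=> //; split=> // A; apply: h => // k.
have [A' [cA' hA']] := integral_model L1 L2 A; rewrite -cA' => /loss hk.
apply: le_trans hk _; rewrite lerD2r -card_intsum // ler_nat //.
Qed.
End Generic.

(** * Dimension one, with L1, L2 or L1 + L2 equal to 0 *)

Section Degenerate.
Variables (R : realType) (L1 L2 : 'M[int]_1).
Local Notation iv := (map_mx (intr : int -> rat)).
Local Notation l1 := (L1 0 0).
Local Notation l2 := (L2 0 0).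
Hypothesis cop : coprime_bound (iv L1) (iv L2).

Lemma coprime_scalar (t : rat) (z1 z2 : int) : t != 0 ->
  t * l1%:~R = z1%:~R -> t * l2%:~R = z2%:~R -> 1 <= `|t|.
Proof.
move=> t0 h1 h2.
have E (L : 'M[int]_1) z : t * (L 0 0)%:~R = z%:~R -> exists N, t%:M *m iv L *m 1%:M = iv N.
  move=> h; exists z%:M; apply/matrixP=> i j; rewrite !ord1 mulmx1 mul_scalar_mx !mxE eqxx.
  by rewrite !mulr1n.
have := @cop t%:M 1%:M; rewrite unitmx1 det1 mulr1 det_scalar expr1; apply; rewrite ?(E _ z1) ?(E _ z2) //.
- by rewrite unitmxE det_scalar expr1 unitfE.
- exact: E h1.
exact: E h2.
Qed.

(** Coprimality excludes a common factor g of the entries with |g| > 1, by scaling with 1/g, and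
    excludes two zero entries, by scaling with 1/2. *)
Lemma degenerate_entries : l1 = 0 \/ l2 = 0 \/ l1 = - l2 ->
  [\/ l1 = 0 /\ `|l2| = 1, l2 = 0 /\ `|l1| = 1 | l1 = - l2 /\ `|l2| = 1].
Proof.
have norm1 (g e1 e2 : int) : g != 0 -> l1 = e1 * g -> l2 = e2 * g -> `|g| = 1.
  move=> g0 h1 h2; have gq : g%:~R != 0 :> rat by rewrite intr_eq0.
  have := @coprime_scalar g%:~R^-1 e1 e2.
  rewrite invr_eq0 gq h1 h2 !rmorphM /= ![_^-1 * _]mulrC !mulfK // => /(_ isT erefl erefl).
  rewrite normfV invf_ge1 ?normr_gt0 // -intr_norm -[X in _ <= X]/(1%:~R) ler_int.
  by move: g0; clear; lia.
have half : l1 = 0 -> l2 = 0 -> False.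
  move=> h1 h2; have := @coprime_scalar 2^-1 0 0; rewrite h1 h2 !mulr0 => /(_ isT erefl erefl).
  by rewrite normfV invf_ge1 // normr_nat lern1.
move=> [h1|[h2|h]].
- have [h2|h2] := eqVneq l2 0; first by case: (half h1 h2).
  by apply: Or31; split=> //; apply: (norm1 l2 0 1); rewrite ?mul0r ?mul1r.
- have [h1|h1] := eqVneq l1 0; first by case: (half h1 h2).
  by apply: Or32; split=> //; apply: (norm1 l1 1 0); rewrite ?mul0r ?mul1r.
have [h2|h2] := eqVneq l2 0; first by case: half; rewrite // h h2 oppr0.
by apply: Or33; split=> //; apply: (norm1 l2 (-1) 1); rewrite ?mulN1r ?mul1r.
Qed.

Lemma mxZ11 (L : 'M[int]_1) : mxZ R L = ((L 0 0)%:~R)%:M.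
Proof. by apply/matrixP=> i j; rewrite !ord1 !mxE eqxx mulr1n. Qed.

Lemma mem_sumset_lin (A : {fset 'cV[R]_1}) a b : a \in A -> b \in A ->
  l1%:~R *: a + l2%:~R *: b \in sumset_lin L1 L2 A.
Proof.
move=> aA bA; apply/imfset2P; exists a => //; exists b => //.
by rewrite !mxZ11 !mul_scalar_mx.
Qed.

(** When l1 = - l2 the sumset is A - A up to sign. With m the least element of A, the differences a
    - m and m - a have only 0 in common, which gives 2 |A| - 1 of them. *)
Lemma degenerate_card (A : {fset 'cV[R]_1}) : l1 = 0 \/ l2 = 0 \/ l1 = - l2 ->
  ((`|l1| + `|l2|) * #|` A| <= #|` sumset_lin L1 L2 A| + 1)%N.
Proof.
move=> /degenerate_entries deg.
have unit_neq0 (l : int) : `|l| = 1 -> l%:~R != 0 :> R by rewrite intr_eq0 -normr_eq0 => ->.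
have scal_inj (c : R) : c != 0 -> injective (fun a : 'cV[R]_1 => c *: a) by move=> c0 x y /(scalerI c0).
have [->|A0] := eqVneq A fset0; first by rewrite cardfs0 muln0.
have one (f : 'cV[R]_1 -> 'cV[R]_1) : injective f -> (forall a, a \in A -> f a \in sumset_lin L1 L2 A) ->
    (#|` A| <= #|` sumset_lin L1 L2 A| + 1)%N.
  move=> fi fS; have <- : #|` [fset f a | a in A]| = #|` A| by apply: card_imfset.
  apply: leq_trans (leq_addr _ _); apply/fsubset_leq_card/fsubsetP=> _ /imfsetP[a /= aA ->]; exact: fS.
case: deg => -[h1 h2].
- have -> : (`|l1| + `|l2| = 1)%N by rewrite h1; move: h2; lia.
  rewrite mul1n; apply: one (scal_inj _ (unit_neq0 _ h2)) _ => a aA.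
  by have := mem_sumset_lin aA aA; rewrite h1 scale0r add0r.
- have -> : (`|l1| + `|l2| = 1)%N by rewrite h1; move: h2; lia.
  rewrite mul1n; apply: one (scal_inj _ (unit_neq0 _ h2)) _ => a aA.
  by have := mem_sumset_lin aA aA; rewrite h1 scale0r addr0.
have -> : (`|l1| + `|l2| = 2)%N by rewrite h1; move: h2; lia.
have c0 := unit_neq0 _ h2; set c : R := l2%:~R in c0.
have mem a b : a \in A -> b \in A -> c *: (b - a) \in sumset_lin L1 L2 A.
  by move=> aA bA; have := mem_sumset_lin aA bA; rewrite h1 rmorphN scaleNr addrC -scalerBr.
have [a0 a0A] := fset0Pn _ A0.
have [m mA mP] := @fset_argmin _ _ R (fun a : 'cV[R]_1 => a 0 0) A a0 a0A.
pose X := [fset c *: (a - m) | a in A]; pose Y := [fset c *: (m - a) | a in A `\ m].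
have cX : #|` X| = #|` A| by apply: card_imfset => x y /(scalerI c0)/addIr.
have cY : (#|` Y| + 1 = #|` A|)%N.
  rewrite addn1 (cardfsD1 m) mA; congr _.+1.
  by apply: card_imfset => x y /(scalerI c0)/addrI/oppr_inj.
have dXY : X `&` Y = fset0.
  apply/eqP; rewrite -fsubset0; apply/fsubsetP=> x; rewrite inE => /andP[/imfsetP[a /= aA ->]].
  case/imfsetP=> b /=; rewrite !inE => /andP[bm bA] /(scalerI c0) e.
  case/eqP: bm; apply/matrixP=> i j; rewrite !ord1.
  have := congr1 (fun v : 'cV[R]_1 => v 0 0) e; rewrite !mxE.
  by have := mP _ aA; have := mP _ bA; lra.
have sub : X `|` Y `<=` sumset_lin L1 L2 A.
  apply/fsubsetP=> x; rewrite inE => /orP[] /imfsetP[a /=]; last rewrite !inE => /andP[_].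
    by move=> aA ->; apply: mem.
  by move=> aA ->; apply: mem.
have := fsubset_leq_card sub; rewrite cardfsU dXY cardfs0 subn0 cX => h.
by rewrite mul2n -addnn -{2}cY addnA leq_add2r.
Qed.

Lemma degenerate_sumset : l1 = 0 \/ l2 = 0 \/ l1 = - l2 ->
  exists (D sigma : R), 0 < D /\ 0 < sigma /\
    forall A : {fset 'cV[R]_1},
      ((`|\det L1|%:~R : R) `^ (1%:R^-1) + (`|\det L2|%:~R : R) `^ (1%:R^-1)) ^+ 1
          * (#|` A|%fset)%:R
        - D * (((#|` A|%fset)%:R : R) `^ (1 - sigma)) <= (#|` sumset_lin L1 L2 A|%fset)%:R.
Proof.
(* With sigma = 1 the power of |A| is 1, even for empty A, so the loss is exactly the 1 of
   [degenerate_card]. *)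
move=> deg; exists 1, 1; split=> //; split=> // A.
rewrite subrr powRr0 mulr1 lerBlDr expr1 !det_mx11.
have -> : (1%:R^-1 : R) = 1 by rewrite invr1.
rewrite !powRr1 ?ler0z // -!abszE.
have -> (x y : nat) : (x%:Z)%:~R + (y%:Z)%:~R = (x + y)%:R :> R by rewrite natrD.
by rewrite -natrM natr1 ler_nat; apply: leq_trans (degenerate_card A deg) _; rewrite addn1.
Qed.
End Degenerate.

Theorem theorem6p1 (R : realType) (d : nat) (hd : (0 < d)%N)
  (L1 L2 : 'M[int]_d) :
  irreducible_pair L1 L2 -> coprime_pair L1 L2 ->
  exists (D sigma : R), 0 < D /\ 0 < sigma /\
    forall A : {fset 'cV[R]_d},
      ((#|` sumset_lin L1 L2 A|%fset)%:R : R) >=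
        ((`|\det L1|%:~R : R) `^ (d%:R^-1) + (`|\det L2|%:~R : R) `^ (d%:R^-1)) ^+ d
          * (#|` A|%fset)%:R
        - D * (((#|` A|%fset)%:R : R) `^ (1 - sigma)).
Proof.
(* For d > 1 irreducibility makes L1, L2 and L1 + L2 invertible, as the tower requires; for d = 1
   any of them may vanish, and these cases are settled directly. *)
move=> irr cop; case: d hd L1 L2 irr cop => [//|[|n]] _ L1 L2 irr cop; last first.
  have [u1 u2 u12] := irreducible_unit irr isT.
  exact: nonsingular_sumset.
pose iv (L : 'M[int]_1) : 'M[rat]_1 := map_mx intr L.
have unitE (M : 'M[rat]_1) : (M \in unitmx) = (M 0 0 != 0) by rewrite unitmxE det_mx11 unitfE.
have [u1|] := boolP (iv L1 \in unitmx); last first.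
  rewrite unitE negbK mxE intr_eq0 => /eqP h.
  by apply: degenerate_sumset; [exact: coprime_pair_bound | left].
have [u2|] := boolP (iv L2 \in unitmx); last first.
  rewrite unitE negbK mxE intr_eq0 => /eqP h.
  by apply: degenerate_sumset; [exact: coprime_pair_bound | right; left].
have [u12|] := boolP (iv L1 + iv L2 \in unitmx); last first.
  rewrite unitE negbK !mxE -rmorphD intr_eq0 addr_eq0 => /eqP h.
  by apply: degenerate_sumset; [exact: coprime_pair_bound | right; right].
exact: nonsingular_sumset.
Qed.
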